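(* Let $n\in\mathbb N$, $\alpha>0$, $1<p<\infty$ and $\frac1p+\frac1{p'}=1$. For every $f\in\mathcal{H}^n_{p,\alpha}\setminus\{0\}$ and every multi-index $\mathbf j\in\mathbb N^n$, \[ \frac{|\langle f,z^{\mathbf j}\rangle_\alpha|}{\|f\|_{p,\alpha}}\le\frac{|\langle z^{\mathbf j},z^{\mathbf j}\rangle_\alpha|}{\|z^{\mathbf j}\|_{p,\alpha}}, \] equivalently $\mathcal{R}_{p,\alpha}(f,z^{\mathbf j})\le\mathcal{R}_{p,\alpha}(z^{\mathbf j},z^{\mathbf j})$, where $\mathcal{R}_{p,\alpha}(g,h)=\frac{|\langle g,h\rangle_\alpha|}{\|g\|_{p,\alpha}\|h\|_{p',\alpha}}$. Both inequalities are equalities if and only if $f(z)$ is a constant multiple of $z^{\mathbf j}$.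
   Context: For $\alpha>0$, $\gamma^n_\alpha(dz)=(\alpha/\pi)^n e^{-\alpha|z|^2}\lambda^n(dz)$ on $\mathbb C^n$, with $\lambda^n$ Lebesgue measure. For $1\le q<\infty$, $\mathcal{H}^n_{q,\alpha}$ is the space of holomorphic $f$ on $\mathbb C^n$ with $\|f\|_{q,\alpha}:=\left(\int|f|^q\,d\gamma^n_{\alpha q/2}\right)^{1/q}<\infty$. $\langle f,g\rangle_\alpha=\int f\overline g\,d\gamma^n_\alpha$. $z^{\mathbf j}=z_1^{j_1}\cdots z_n^{j_n}$. *)

(* Defs.v *)
From mathcomp Require Import all_boot all_order all_algebra.
From mathcomp Require Import all_classical all_reals all_analysis.
From mathcomp Require Import complex.
Set Implicit Arguments. Unset Strict Implicit. Unset Printing Implicit Defensive.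
Import Order.TTheory GRing.Theory Num.Theory.
Local Open Scope ring_scope.

Definition cabs {R : realType} (z : R[i]) : R :=
  Num.sqrt (complex.Re z ^+ 2 + complex.Im z ^+ 2).

Definition cconj {R : realType} (z : R[i]) : R[i] := Complex (complex.Re z) (- complex.Im z).

Definition sqnorm {R : realType} (n : nat) (z : 'I_n -> R[i]) : R :=
  \sum_(k < n) cabs (z k) ^+ 2.

Definition upd {R : realType} (n : nat) (z : 'I_n -> R[i]) (k : nat) (w : R[i])
  : 'I_n -> R[i] := fun i => if nat_of_ord i == k then w else z i.

Definition monom {R : realType} (n : nat) (j : 'I_n -> nat) (z : 'I_n -> R[i])
  : R[i] := \prod_(k < n) z k ^+ j k.

(* f : C^n -> C is holomorphic: continuous and complex differentiable in each
   variable separately (Osgood's definition; equivalent to the usual one). *)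
Definition holomorphic {R : realType} (n : nat) (f : ('I_n -> R[i]) -> R[i]) : Prop :=
  (forall z (e : R), 0 < e -> exists2 d : R, 0 < d &
     forall w, (forall k, cabs (w k - z k) < d) -> cabs (f w - f z) < e) /\
  (forall z (k : 'I_n), exists L : R[i], forall e : R, 0 < e -> exists2 d : R, 0 < d &
     forall h : R[i], h != 0 -> cabs h < d ->
       cabs ((f (upd z k (z k + h)) - f z) / h - L) < e).

Local Open Scope ereal_scope.

(* integral over C = R^2 w.r.t. Lebesgue measure lambda^2 (nonnegative integrands),
   computed as an iterated integral (Tonelli) *)
Definition intC {R : realType} (G : R[i] -> \bar R) : \bar R :=
  \int[@lebesgue_measure R]_(x in setT)
     \int[@lebesgue_measure R]_(y in setT) G (Complex x y).

Fixpoint iterC {R : realType} (n : nat) (k : nat)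
  (G : ('I_n -> R[i]) -> \bar R) (z : 'I_n -> R[i]) : \bar R :=
  match k with
  | 0 => G z
  | k'.+1 => intC (fun w => iterC k' G (upd z k' w))
  end.

Definition intCn {R : realType} (n : nat) (G : ('I_n -> R[i]) -> \bar R) : \bar R :=
  iterC n G (fun _ => 0%R).

Local Close Scope ereal_scope.

(* same, for real-valued (integrable) integrands, via Fubini *)
Definition RintC {R : realType} (g : R[i] -> R) : R :=
  Rintegral (@lebesgue_measure R) setT
    (fun x => Rintegral (@lebesgue_measure R) setT (fun y => g (Complex x y))).

Fixpoint RiterC {R : realType} (n : nat) (k : nat)
  (g : ('I_n -> R[i]) -> R) (z : 'I_n -> R[i]) : R :=
  match k with
  | 0 => g z
  | k'.+1 => RintC (fun w => RiterC k' g (upd z k' w))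
  end.

Definition RintCn {R : realType} (n : nat) (g : ('I_n -> R[i]) -> R) : R :=
  RiterC n g (fun _ => 0).

Definition CintCn {R : realType} (n : nat) (h : ('I_n -> R[i]) -> R[i]) : R[i] :=
  Complex (RintCn (fun z => complex.Re (h z))) (RintCn (fun z => complex.Im (h z))).

(* density of gamma^n_a w.r.t. lambda^n : (a/pi)^n exp(-a|z|^2) *)
Definition gdens {R : realType} (n : nat) (a : R) (z : 'I_n -> R[i]) : R :=
  (a / pi) ^+ n * expR (- (a * sqnorm z)).

Definition Nint {R : realType} (n : nat) (q a : R) (f : ('I_n -> R[i]) -> R[i])
  : \bar R :=
  intCn (fun z => ((cabs (f z)) `^ q * gdens (a * q / 2) z)%:E).

Definition inH {R : realType} (n : nat) (q a : R) (f : ('I_n -> R[i]) -> R[i]) : Prop :=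
  holomorphic f /\ (Nint q a f < +oo)%E.

Definition normH {R : realType} (n : nat) (q a : R) (f : ('I_n -> R[i]) -> R[i]) : R :=
  (fine (Nint q a f)) `^ q^-1.

Definition innerH {R : realType} (n : nat) (a : R) (f g : ('I_n -> R[i]) -> R[i])
  : R[i] :=
  CintCn (fun z => f z * cconj (g z) * Complex (gdens a z) 0).

Definition Rpa {R : realType} (n : nat) (p p' a : R) (g h : ('I_n -> R[i]) -> R[i]) : R :=
  cabs (innerH a g h) / (normH p a g * normH p' a h).

(* Main.v *)
(** Write [h = z^j]. In logarithmic coordinates Goursat's theorem on a rectangle
    of height [2 pi] shows that the circle means of [f(z) z_k^(-j_k)] in the
    variable [z_k] do not depend on the radius. Hence, with [C] the mean of
    [f conj(h)] over the unit torus and any weight [w] depending only on the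
    moduli [|z_k|], rotation invariance of Lebesgue measure on the plane gives
    [int f conj(h) w = C int |h|^2 w]. The Gaussian weight yields
    [<f, h> = C <h, h>]. The weight [|h|^(p-2) exp(-a p |z|^2 / 2)] makes the
    linear term vanish when the strict convexity inequality
    [|u|^p >= |v|^p + p |v|^(p-2) Re((u - v) conj v)] is integrated at
    [u = f], [v = C h]; thus [||f||_p >= |C| ||h||_p], with equality only if
    [f = C h].

    Measurability of the iterated integrals comes from lower semicontinuity,
    which Fatou's lemma propagates through each integration. *)
Require Import Defs.
From mathcomp Require Import all_boot all_order all_algebra.
From mathcomp Require Import all_classical all_reals all_analysis.
From mathcomp Require Import measurable_realfun complex lra ring.
Set Implicit Arguments. Unset Strict Implicit. Unset Printing Implicit Defensive.
Import Order.TTheory GRing.Theory Num.Theory.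
Import numFieldNormedType.Exports.
Local Open Scope classical_set_scope.
Local Open Scope ring_scope.

(** * Goursat's theorem on rectangles *)

Section Goursat.
Variable R : realType.
Implicit Types (P Q cP cQ : R -> R -> R).

(** Goursat rather than Green: holomorphy gives no continuity of the partial derivatives. The
    substitution [z_k = exp w] turns [f(z) z_k^(-j_k)], possibly singular at the origin, into a
    function holomorphic on the whole plane with period [2 pi i].

    Polar coordinates never enter. A plane integral equals the integral of its circle averages, so
    proportional circle averages give proportional integrals.

    For [1 < p < 2] the weight [|h|^(p-2)] blows up on the zeros of [h]. It is always kept next to
    [Re(F conj h)], which is [O(|h|)]; the product is continuous because [p - 2 > -1].

    The iterated real integrals in the inner product may meet slices that are not integrable. Signed
    integrands are therefore split into positive and negative parts, and identities are claimed only
    where both partial integrals are finite.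

    The exponent [p'] enters through Young's inequality, which makes [f conj h] integrable, and
    through the common factor [||h||_p'] of the two ratios. *)

Definition diff2 (S : R -> R -> R) (x y l m : R) : R :=
  S (x + l) (y + m) - S (x + l) y - S x (y + m) + S x y.

(* The 1-form [P ds + Q dt] is differentiable at the point, with zero exterior
   derivative there. *)
Definition closed_form_at P Q (s0 t0 : R) :=
  exists p1 p2 q2 : R, forall e : R, 0 < e -> exists2 d : R, 0 < d &
  forall s t, `|s - s0| < d -> `|t - t0| < d ->
    `|P s t - P s0 t0 - p1 * (s - s0) - p2 * (t - t0)| <= e * (`|s - s0| + `|t - t0|) /\
    `|Q s t - Q s0 t0 - p2 * (s - s0) - q2 * (t - t0)| <= e * (`|s - s0| + `|t - t0|).

Lemma mvt_is_derive (f df : R -> R) (a b : R) : a < b ->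
  (forall x : R, is_derive x 1 f (df x)) ->
  exists2 c, a < c < b & f b - f a = df c * (b - a).
Proof.
move=> ab fd; have [|c] := MVT ab (fun x _ => fd x).
  apply: continuous_subspaceT => x.
  by apply: differentiable_continuous; apply/derivable1_diffP; apply: ex_derive.
by rewrite in_itv /=; exists c.
Qed.

(** The second difference of [cQ - cP] is the counterclockwise boundary integral of [P ds + Q dt],
    written through primitives on the four sides. By the mean value theorem it is an increment of
    [Q] times [m] minus an increment of [P] times [l]. The linear parts contribute [p2 * l * m] to
    both terms because the form is closed, so only the errors of differentiability remain. *)
Lemma diff2_small P Q cP cQ (s0 t0 : R) :
  (forall s t : R, is_derive s 1 (cP^~ t) (P s t)) ->
  (forall s t : R, is_derive t 1 (cQ s) (Q s t)) ->
  closed_form_at P Q s0 t0 ->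
  forall e, 0 < e -> exists2 d, 0 < d & forall x y l m,
    0 < l -> 0 < m -> l < d -> m < d -> x <= s0 <= x + l -> y <= t0 <= y + m ->
    `|diff2 (fun s t => cQ s t - cP s t) x y l m| <= e * (l + m) ^+ 2.
Proof.
move=> dP dQ [p1 [p2 [q2 H]]] e e0.
have e20 : 0 < e / 2 by lra.
have [d d0 Hd] := H _ e20; exists d => // x y l m l0 m0 ld md xs yt.
have ab_l : x < x + l by lra.
have ab_m : y < y + m by lra.
have nb s : x <= s <= x + l -> `|s - s0| <= l by move=> /andP[? ?]; move/andP: xs => [? ?]; rewrite ler_norml; lra.
have nb' t : y <= t <= y + m -> `|t - t0| <= m by move=> /andP[? ?]; move/andP: yt => [? ?]; rewrite ler_norml; lra.
have HH s t : x <= s <= x + l -> y <= t <= y + m ->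
    `|P s t - P s0 t0 - p1 * (s - s0) - p2 * (t - t0)| <= e/2 * (l + m) /\
    `|Q s t - Q s0 t0 - p2 * (s - s0) - q2 * (t - t0)| <= e/2 * (l + m).
  move=> hs ht; have h1 := nb _ hs; have h2 := nb' _ ht.
  have [||E1 E2] := Hd s t; [lra|lra|].
  by split; [apply: (le_trans E1)|apply: (le_trans E2)]; rewrite ler_pM2l//; lra.
(* Applied to the difference of two opposite sides, the mean value theorem yields one common height
   [tau], so that [Q] is compared at two points of the same horizontal line. *)
have [tau ht Et] := @mvt_is_derive (fun t => cQ (x + l) t - cQ x t) (fun t => Q (x + l) t - Q x t) _ _ ab_m
  (fun t => is_deriveB (dQ _ _) (dQ _ _)).
have [sg hs Es] := @mvt_is_derive (fun s => cP s (y + m) - cP s y) (fun s => P s (y + m) - P s y) _ _ ab_l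
  (fun t => is_deriveB (dP _ _) (dP _ _)).
have -> : diff2 (fun s t => cQ s t - cP s t) x y l m =
   (Q (x + l) tau - Q x tau) * m - (P sg (y + m) - P sg y) * l.
  have Em : y + m - y = m by rewrite addrAC subrr add0r.
  have El : x + l - x = l by rewrite addrAC subrr add0r.
  rewrite Em in Et; rewrite El in Es; rewrite -Et -Es /diff2; ring.
have [] := HH (x + l) tau; [lra|lra|] => _; rewrite ler_norml => Q1.
have [] := HH x tau; [lra|lra|] => _; rewrite ler_norml => Q2.
have [] := HH sg (y + m); [lra|lra|]; rewrite ler_norml => P1 _.
have [] := HH sg y; [lra|lra|]; rewrite ler_norml => P2 _.
set U := Q (x + l) tau - Q x tau in Et *. set V := P sg (y + m) - P sg y in Es *.
have U1 : `|U - p2 * l| <= e * (l + m) by rewrite ler_norml /U; lra.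
have V1 : `|V - p2 * m| <= e * (l + m) by rewrite ler_norml /V; lra.
have -> : U * m - V * l = (U - p2 * l) * m - (V - p2 * m) * l by ring.
apply: (le_trans (ler_normB _ _)); rewrite !normrM (gtr0_norm l0) (gtr0_norm m0).
have -> : e * (l + m) ^+ 2 = e * (l + m) * m + e * (l + m) * l by ring.
by apply: lerD; rewrite ler_pM2r.
Qed.

(** Bisection: of the four quarters of a rectangle, one keeps at least a quarter of the defect. At
    the common point of the nested rectangles this contradicts [diff2_small], whose bound also
    scales like [4^-k] but with an arbitrarily small constant. *)
Lemma goursat_rectangle P Q cP cQ :
  (forall s t : R, is_derive s 1 (cP^~ t) (P s t)) ->
  (forall s t : R, is_derive t 1 (cQ s) (Q s t)) ->
  (forall s t, closed_form_at P Q s t) ->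
  forall a b l m, 0 < l -> 0 < m ->
    diff2 (fun s t => cQ s t - cP s t) a b l m = 0.
Proof.
move=> dP dQ cl a b l m l0 m0; set S := fun s t => _.
apply: contrapT => /eqP D0.
set eta := `|diff2 S a b l m|; have eta0 : 0 < eta by rewrite normr_gt0.
pose lk k : R := l / 2 ^+ k; pose mk k : R := m / 2 ^+ k.
have lkS k : lk k = lk k.+1 + lk k.+1 by rewrite /lk exprS invfM; field.
have mkS k : mk k = mk k.+1 + mk k.+1 by rewrite /mk exprS invfM; field.
have lk0 k : 0 < lk k by rewrite divr_gt0// exprn_gt0.
have mk0 k : 0 < mk k by rewrite divr_gt0// exprn_gt0.
pose bad k (xy : R * R) := eta / 4 ^+ k <= `|diff2 S xy.1 xy.2 (lk k) (mk k)|.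
(* The implication stands under the existential, so that [choice] yields a total successor function;
   for a rectangle that is not [bad] the value [(0, 0)] is a dummy. *)
have step k xy : exists xy' : R * R, bad k xy -> [/\ bad k.+1 xy',
    (xy'.1 = xy.1 \/ xy'.1 = xy.1 + lk k.+1) & (xy'.2 = xy.2 \/ xy'.2 = xy.2 + mk k.+1)].
  case: xy => x y; rewrite /bad /=.
  have [|no] := pselect (eta / 4 ^+ k <= `|diff2 S x y (lk k) (mk k)|); last by exists (0,0) => /no.
  move=> bk.
  have E : diff2 S x y (lk k) (mk k) = diff2 S x y (lk k.+1) (mk k.+1)
    + diff2 S (x + lk k.+1) y (lk k.+1) (mk k.+1) + diff2 S x (y + mk k.+1) (lk k.+1) (mk k.+1)
    + diff2 S (x + lk k.+1) (y + mk k.+1) (lk k.+1) (mk k.+1).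
    rewrite /diff2 (lkS k) (mkS k) (addrA x) (addrA y).
    set s1 := S _ _; set s2 := S _ _; set s3 := S _ _; ring.
  have E4 : eta / 4 ^+ k = 4 * (eta / 4 ^+ k.+1).
    by rewrite exprS invfM [RHS]mulrCA; congr (_ * _); rewrite mulVKf ?pnatr_eq0.
  set r := eta / 4 ^+ k.+1 in E4 *.
  rewrite E4 E in bk.
  have [h|h1] := leP r `|diff2 S x y (lk k.+1) (mk k.+1)|; first by exists (x, y) => _; split => //; left.
  have [h|h2] := leP r `|diff2 S (x + lk k.+1) y (lk k.+1) (mk k.+1)|; first by exists (x + lk k.+1, y) => _; split => //; [right|left].
  have [h|h3] := leP r `|diff2 S x (y + mk k.+1) (lk k.+1) (mk k.+1)|; first by exists (x, y + mk k.+1) => _; split => //; [left|right].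
  exists (x + lk k.+1, y + mk k.+1) => _; split; [|by right|by right] => /=.
  have N1 := ler_normD (diff2 S x y (lk k.+1) (mk k.+1) + diff2 S (x + lk k.+1) y (lk k.+1) (mk k.+1) + diff2 S x (y + mk k.+1) (lk k.+1) (mk k.+1)) (diff2 S (x + lk k.+1) (y + mk k.+1) (lk k.+1) (mk k.+1)).
  have N2 := ler_normD (diff2 S x y (lk k.+1) (mk k.+1) + diff2 S (x + lk k.+1) y (lk k.+1) (mk k.+1)) (diff2 S x (y + mk k.+1) (lk k.+1) (mk k.+1)).
  have N3 := ler_normD (diff2 S x y (lk k.+1) (mk k.+1)) (diff2 S (x + lk k.+1) y (lk k.+1) (mk k.+1)).
  lra.
have {step}/choice[nx nxP] : forall kxy : nat * (R * R), exists xy' : R * R, bad kxy.1 kxy.2 -> [/\ bad kxy.1.+1 xy',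
    (xy'.1 = kxy.2.1 \/ xy'.1 = kxy.2.1 + lk kxy.1.+1) & (xy'.2 = kxy.2.2 \/ xy'.2 = kxy.2.2 + mk kxy.1.+1)].
  by move=> [k xy]; exact: step.
pose w := fix w k := if k is k'.+1 then nx (k', w k') else (a, b).
have wb k : bad k (w k).
  elim: k => [|k IH]; first by rewrite /bad /lk /mk /= !expr0 !divr1.
  by have [] := nxP (k, w k) IH.
have w1 k : (w k).1 <= (w k.+1).1 /\ (w k.+1).1 + lk k.+1 <= (w k).1 + lk k.
  have [_ + _] := nxP (k, w k) (wb k); rewrite (lkS k) => /= -[] ->; have := lk0 k.+1; lra.
have w2 k : (w k).2 <= (w k.+1).2 /\ (w k.+1).2 + mk k.+1 <= (w k).2 + mk k.
  have [_ _] := nxP (k, w k) (wb k); rewrite (mkS k) => /= -[] ->; have := mk0 k.+1; lra.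
(* The common point of nested intervals is the supremum of their left ends; it is applied to each
   coordinate separately. *)
have nested (u : nat -> R) (v : nat -> R) : (forall k, 0 < v k) ->
    (forall k, u k <= u k.+1 /\ u k.+1 + v k.+1 <= u k + v k) ->
    exists s, forall k, u k <= s <= u k + v k.
  move=> v0 uv.
  have mon k i : u k <= u (k + i)%N /\ u (k + i)%N + v (k + i)%N <= u k + v k.
    elim: i => [|i [h1 h2]]; first by rewrite addn0.
    by rewrite addnS; have [h3 h4] := uv (k + i)%N; split; lra.
  have ub k : ubound (range u) (u k + v k).
    move=> _ [i _ <-].
    have [h|h] := leqP i k.
      have [+ _] := mon i (k - i)%N; rewrite subnKC//; have := v0 k; lra.
    have [_ +] := mon k (i - k)%N; rewrite subnKC 1?ltnW//; have := v0 i; lra.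
  exists (sup (range u)) => k; apply/andP; split.
    by apply: ub_le_sup; [exists (u 0%N + v 0%N); exact: ub | exists k].
  by apply: ge_sup; [exists (u 0%N), 0%N | exact: ub].
have [s Hs] := nested (fun k => (w k).1) lk lk0 w1.
have [t Ht] := nested (fun k => (w k).2) mk mk0 w2.
have lm0 : 0 < (l + m) ^+ 2 by rewrite exprn_gt0//; lra.
(* With this constant the upper bound on the [k]-th rectangle is half of the lower bound
   [eta / 4 ^+ k]. *)
have e0 : 0 < eta / (l + m) ^+ 2 / 2 by rewrite !divr_gt0.
have [d d0 Hd] := diff2_small dP dQ (cl s t) e0.
have [k [kl km]] : exists k, lk k < d /\ mk k < d.
  have [k Hk] : exists k : nat, (l + m) / d < k%:R.
    by exists (Num.bound ((l + m) / d)); apply: archi_boundP; rewrite divr_ge0//; lra.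
  have k2 : (k%:R : R) <= 2 ^+ k by rewrite -natrX ler_nat ltnW// ltn_expl.
  have H2 : l + m < d * 2 ^+ k.
    rewrite -ltr_pdivrMl// mulrC; exact: lt_le_trans Hk k2.
  exists k; rewrite /lk /mk !ltr_pdivrMr ?exprn_gt0//; split; lra.
have := Hd _ _ _ _ (lk0 k) (mk0 k) kl km (Hs k) (Ht k).
have := wb k; rewrite /bad => B1 B2; have := le_trans B1 B2.
have -> : lk k + mk k = (l + m) / 2 ^+ k by rewrite /lk /mk; ring.
have -> : ((l + m) / 2 ^+ k) ^+ 2 = (l + m) ^+ 2 / 4 ^+ k.
  by rewrite expr_div_n -exprM mulnC exprM; congr (_ / _ ^+ _); rewrite expr2 -natrM.
have -> : eta / (l + m) ^+ 2 / 2 * ((l + m) ^+ 2 / 4 ^+ k) = (eta / 4 ^+ k) / 2.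
  by field; rewrite expf_neq0 ?pnatr_eq0//=; lra.
have : 0 < eta / 4 ^+ k by rewrite divr_gt0 ?exprn_gt0.
lra.
Qed.
End Goursat.

(** * Modulus, complex exponential and complex differentiability *)

Section ComplexBasics.
Variable R : realType.
Implicit Types (z w h : R[i]) (x y s t : R).

Lemma cabsE z : (cabs z)%:C%C = `|z|.
Proof. by rewrite normc_def. Qed.

Lemma cabs_ge0 z : 0 <= cabs z.
Proof. exact: sqrtr_ge0. Qed.

Lemma cabs0 : cabs (0 : R[i]) = 0.
Proof. by rewrite /cabs /= expr0n addr0 sqrtr0. Qed.

Lemma cabs1 : cabs (1 : R[i]) = 1.
Proof. by rewrite /cabs /= expr0n addr0 expr1n sqrtr1. Qed.

Lemma cabs_sqr z : cabs z ^+ 2 = complex.Re z ^+ 2 + complex.Im z ^+ 2.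
Proof. by rewrite sqr_sqrtr// addr_ge0// sqr_ge0. Qed.

Lemma cabsM z w : cabs (z * w) = cabs z * cabs w.
Proof. by apply: (@complexI R); rewrite rmorphM /= !cabsE normrM. Qed.

Lemma cabsX z n : cabs (z ^+ n) = cabs z ^+ n.
Proof. by elim: n => [|n IH]; rewrite ?expr0 ?cabs1// !exprS cabsM IH. Qed.

Lemma cabs_eq0 z : (cabs z == 0) = (z == 0).
Proof. by rewrite -(inj_eq (@complexI R)) cabsE normr_eq0. Qed.

Lemma cabs_gt0 z : (0 < cabs z) = (z != 0).
Proof. by rewrite lt_def cabs_ge0 cabs_eq0 andbT. Qed.

Lemma cabsD z w : cabs (z + w) <= cabs z + cabs w.
Proof. by rewrite -lecR rmorphD /= !cabsE ler_normD. Qed.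

Lemma cabsN z : cabs (- z) = cabs z.
Proof. by apply: (@complexI R); rewrite !cabsE normrN. Qed.

Lemma cabsC z w : cabs (z - w) = cabs (w - z).
Proof. by rewrite -cabsN opprB. Qed.

Lemma cabs_dist z w : `|cabs z - cabs w| <= cabs (z - w).
Proof.
have := cabsD (z - w) w; have := cabsD (w - z) z.
by rewrite !subrK (cabsC w z) ler_norml => ? ?; lra.
Qed.

Lemma cabs_Re z : `|complex.Re z| <= cabs z.
Proof.
rewrite -ler_sqr ?nnegrE ?cabs_ge0// cabs_sqr real_normK ?num_real//.
by rewrite lerDl sqr_ge0.
Qed.

Lemma cabs_Im z : `|complex.Im z| <= cabs z.
Proof.
rewrite -ler_sqr ?nnegrE ?cabs_ge0// cabs_sqr real_normK ?num_real//.
by rewrite lerDr sqr_ge0.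
Qed.

Lemma cabs_le_ReIm z : cabs z <= `|complex.Re z| + `|complex.Im z|.
Proof.
rewrite -ler_sqr ?nnegrE ?cabs_ge0 ?addr_ge0// cabs_sqr sqrrD.
rewrite !real_normK ?num_real//.
have := mulr_ge0 (normr_ge0 (complex.Re z)) (normr_ge0 (complex.Im z)); lra.
Qed.

Lemma ReB z w : complex.Re (z - w) = complex.Re z - complex.Re w.
Proof. by case: z; case: w. Qed.

Lemma ImB z w : complex.Im (z - w) = complex.Im z - complex.Im w.
Proof. by case: z; case: w. Qed.

Lemma cabs_conj z : cabs (cconj z) = cabs z.
Proof. by rewrite /cabs /cconj /= sqrrN. Qed.

Lemma cconjM z w : cconj (z * w) = cconj z * cconj w.
Proof. by case: z => a b; case: w => c d; rewrite /cconj; simpc; congr Complex => /=; ring. Qed.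

Lemma mul_cconj z : z * cconj z = (cabs z ^+ 2)%:C%C.
Proof. by rewrite cabs_sqr; case: z => a b; rewrite /cconj; simpc; congr Complex => /=; ring. Qed.

Definition cis t : R[i] := Complex (cos t) (sin t).

Lemma cabs_cis t : cabs (cis t) = 1.
Proof. by rewrite /cabs /= cos2Dsin2 sqrtr1. Qed.

Lemma cisD s t : cis (s + t) = cis s * cis t.
Proof. by rewrite /cis sinD cosD; simpc; congr Complex; ring. Qed.

Lemma cis_periodic t : cis (t + pi *+ 2) = cis t.
Proof. by rewrite /cis cosD2pi sinD2pi. Qed.

Definition cexp z : R[i] := (expR (complex.Re z))%:C%C * cis (complex.Im z).

Lemma cexpD z w : cexp (z + w) = cexp z * cexp w.
Proof. by case: z => a b; case: w => c d; rewrite /cexp /= expRD rmorphM /= cisD; ring. Qed.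

Lemma cexp0 : cexp 0 = 1.
Proof. by rewrite /cexp /= expR0 /cis cos0 sin0 mul1r. Qed.

Lemma cexpN z : cexp z * cexp (- z) = 1.
Proof. by rewrite -cexpD subrr cexp0. Qed.

(** The logarithm is [ln |z| + i t], where [t] is [acos] of the normalised real part, with its sign
    changed when the imaginary part is negative. *)
Lemma polar z : z != 0 -> exists w, cexp w = z.
Proof.
move=> z0; have r0 : 0 < cabs z by rewrite cabs_gt0.
pose c := complex.Re z / cabs z; pose d := complex.Im z / cabs z.
have cd : c ^+ 2 + d ^+ 2 = 1.
  by rewrite /c /d !expr_div_n -mulrDl -cabs_sqr divff// expf_neq0// gt_eqF.
have c1 : -1 <= c <= 1 by rewrite -ler_norml -(@expr_le1 _ 2)// real_normK ?num_real// -cd lerDl sqr_ge0.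
have [t [tc td]] : exists t, cos t = c /\ sin t = d.
  have h1 : cos (acos c) = c by apply: acosK; rewrite in_itv.
  have h2 : sin (acos c) = `|d|.
    rewrite sin_acos// (_ : 1 - c ^+ 2 = d ^+ 2) ?sqrtr_sqr//; lra.
  have [d0|d0] := leP 0 d.
    by exists (acos c); rewrite h1 h2 ger0_norm.
  by exists (- acos c); rewrite cosN sinN h1 h2 ltr0_norm// opprK.
exists (Complex (ln (cabs z)) t); rewrite /cexp /= lnK ?posrE// /cis tc td /c /d.
move: r0; case: z {z0 c d cd c1 tc td} => a b /= r0; simpc.
by rewrite ![cabs _ * (_ / _)]mulrCA divff ?mulr1// gt_eqF.
Qed.

Lemma is_derive_epsilon (f : R -> R) (x df : R) : is_derive x 1 f df ->
  forall e : R, 0 < e -> exists2 d : R, 0 < d & forall h : R, `|h| < d ->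
    `|f (x + h) - f x - df * h| <= e * `|h|.
Proof.
move=> [fd fv] e e0.
have := fd; rewrite /derivable /= => /cvg_ex[l Hl].
have ll : l = df by rewrite -fv; apply/esym/cvg_lim.
move: Hl; rewrite ll => /cvgrPdist_le /(_ e e0).
rewrite /prop_near1 /= => -[d /= d0 Hd].
exists d => // h hd.
have [->|h0] := eqVneq h 0; first by rewrite addr0 subrr mulr0 subr0 normr0 mulr0.
have /= := Hd h; rewrite sub0r normrN => /(_ hd h0).
rewrite /GRing.scale /= mulr1 -normrN opprB.
have -> : h^-1 * (f (h + x) - f x) - df = (f (x + h) - f x - df * h) / h.
  by rewrite (addrC x); field.
by rewrite normf_div ler_pdivrMr// normr_gt0.
Qed.

(** Differentiability as a bound on increments: [h = 0] is allowed and no quotient occurs, which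
    makes the chain and product rules plain estimates. *)
Definition cdiff (N : R[i] -> R[i]) z (L : R[i]) := forall e : R, 0 < e ->
  exists2 d : R, 0 < d & forall h, cabs h < d ->
    cabs (N (z + h) - N z - L * h) <= e * cabs h.

Lemma cdiff_lip N z L : cdiff N z L -> exists2 d : R, 0 < d &
  forall h, cabs h < d -> cabs (N (z + h) - N z) <= (cabs L + 1) * cabs h.
Proof.
move=> /(_ 1 ltr01)[d d0 Hd]; exists d => // h hd.
rewrite -(subrK (L * h) (N (z + h) - N z)) mulrDl addrC.
by apply: (le_trans (cabsD _ _)); rewrite cabsM lerD2l Hd.
Qed.

Lemma cdiff_comp N M z L L' : cdiff M z L -> cdiff N (M z) L' ->
  cdiff (N \o M) z (L' * L).
Proof.
move=> dM dN e e0; have [d1 d10 H1] := cdiff_lip dM.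
have cL := cabs_ge0 L; have cL' := cabs_ge0 L'.
have e1 : 0 < e / 2 / (cabs L + 1) by rewrite !divr_gt0//; lra.
have [d2 d20 H2] := dN _ e1.
have e3 : 0 < e / 2 / (cabs L' + 1) by rewrite !divr_gt0//; lra.
have [d3 d30 H3] := dM _ e3.
exists (Num.min d1 (Num.min d3 (d2 / (cabs L + 1)))).
  by rewrite !lt_min d10 d30 divr_gt0//; lra.
move=> h; rewrite !lt_min => /and3P[h1 h3 h2].
have k0 := cabs_ge0 h.
have hL : cabs (M (z + h) - M z) <= (cabs L + 1) * cabs h by exact: H1.
have hL2 : cabs (M (z + h) - M z) < d2.
  apply: (le_lt_trans hL); rewrite mulrC -ltr_pdivlMr//; lra.
have := H2 _ hL2; rewrite subrKC => A.
have {}A := le_trans A (ler_wpM2l (ltW e1) hL).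
have -> : (N \o M) (z + h) - (N \o M) z - L' * L * h =
  (N (M (z + h)) - N (M z) - L' * (M (z + h) - M z)) + L' * (M (z + h) - M z - L * h).
  by rewrite /=; ring.
apply: (le_trans (cabsD _ _)); rewrite (splitr e) mulrDl; apply: lerD.
  by apply: (le_trans A); rewrite mulrA divfK//; lra.
rewrite cabsM; apply: (@le_trans _ _ ((cabs L' + 1) * (e / 2 / (cabs L' + 1) * cabs h))).
  by apply: ler_pM => //; rewrite ?cabs_ge0 ?H3//; lra.
by rewrite mulrA mulrC [X in _ * X]mulrC divfK 1?mulrC//; lra.
Qed.

Lemma cdiffM N M z L L' : cdiff N z L -> cdiff M z L' ->
  cdiff (fun z => N z * M z) z (L * M z + N z * L').
Proof.
move=> dN dM e e0.
have [d1 d10 H1] := cdiff_lip dN.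
have cL := cabs_ge0 L; have cL' := cabs_ge0 L'; have cN := cabs_ge0 (N z); have cM := cabs_ge0 (M z).
have [d2 d20 H2] := dN (e / 3 / (cabs (M z) + 1)) ltac:(by rewrite !divr_gt0//; lra).
have [d3 d30 H3] := dM (e / 3 / (cabs (N z) + 1)) ltac:(by rewrite !divr_gt0//; lra).
have [d4 d40 H4] := cdiff_lip dM.
(* [k] bounds the product of the two increments by [k |h|^2]; the radius [e / 3 / k] makes this
   second-order term at most [e / 3 * |h|]. *)
set k := (cabs L + 1) * (cabs L' + 1).
have k0 : 0 < k by rewrite mulr_gt0//; lra.
exists (Num.min (Num.min d1 d2) (Num.min (Num.min d3 d4) (e / 3 / k))).
  by rewrite !lt_min d10 d20 d30 d40 !divr_gt0.
move=> h; rewrite !lt_min => /andP[/andP[h1 h2] /andP[/andP[h3 h4] h5]].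
have hh := cabs_ge0 h.
have -> : N (z + h) * M (z + h) - N z * M z - (L * M z + N z * L') * h =
  (N (z + h) - N z - L * h) * M z + N z * (M (z + h) - M z - L' * h)
  + (N (z + h) - N z) * (M (z + h) - M z) by ring.
have -> : e * cabs h = e / 3 * cabs h + e / 3 * cabs h + e / 3 * cabs h by field.
apply: (le_trans (cabsD _ _)); apply: lerD.
  apply: (le_trans (cabsD _ _)); apply: lerD.
  - rewrite cabsM; apply: (@le_trans _ _ (e / 3 / (cabs (M z) + 1) * cabs h * (cabs (M z) + 1))).
      by apply: ler_pM; rewrite ?cabs_ge0 ?H2//; lra.
    by rewrite mulrAC divfK//; lra.
  - rewrite cabsM mulrC; apply: (@le_trans _ _ (e / 3 / (cabs (N z) + 1) * cabs h * (cabs (N z) + 1))).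
      by apply: ler_pM; rewrite ?cabs_ge0 ?H3//; lra.
    by rewrite mulrAC divfK//; lra.
rewrite cabsM; apply: (@le_trans _ _ (k * cabs h * cabs h)).
    have -> : k * cabs h * cabs h = ((cabs L + 1) * cabs h) * ((cabs L' + 1) * cabs h) by rewrite /k; ring.
    by apply: ler_pM; rewrite ?cabs_ge0 ?H1 ?H4.
  by apply: ler_wpM2r => //; rewrite mulrC -ler_pdivlMr// ltW.
Qed.

Lemma cdiff_cst (c : R[i]) z : cdiff (fun=> c) z 0.
Proof. by move=> e e0; exists 1 => // h _; rewrite subrr mul0r subr0 cabs0 mulr_ge0 ?cabs_ge0// ltW. Qed.

Lemma cdiffX N z L n : cdiff N z L -> exists L', cdiff (fun z => N z ^+ n) z L'.
Proof.
move=> dN; elim: n => [|n [L' IH]].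
  by exists 0; under eq_fun do rewrite expr0; exact: cdiff_cst.
exists (L * N z ^+ n + N z * L').
have -> : (fun z => N z ^+ n.+1) = (fun z => N z * N z ^+ n).
  by apply/funext => ?; rewrite exprS.
exact: (cdiffM dN IH).
Qed.

Lemma cdiff_opp z : cdiff (fun z => - z) z (-1).
Proof.
move=> e e0; exists 1 => // h _.
by rewrite (_ : _ - _ = 0) ?cabs0 ?mulr_ge0 ?cabs_ge0 ?(ltW e0)//; ring.
Qed.

(** The addition formula moves the question to the origin, where the real derivatives of [expR],
    [cos] and [sin] at [0] suffice. *)
Lemma cdiff_cexp z : cdiff cexp z (cexp z).
Proof.
move=> e e0.
have cE := cabs_ge0 (cexp z).
(* The five error terms below add up to at most [7 e' |h|], rounded to [8]. The cap [e' <= 1]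
   together with [|h| < e' / 2] gives [|1 + a| <= 2]. *)
set e' := Num.min (e / (cabs (cexp z) + 1) / 8) 1.
have e'0 : 0 < e' by rewrite lt_min !divr_gt0//; lra.
have e'1 : e' <= 1 by rewrite ge_min lexx orbT.
have [d1 d10 H1] := is_derive_epsilon (is_derive_expR 0) e'0.
have [d2 d20 H2] := is_derive_epsilon (is_derive_cos 0) e'0.
have [d3 d30 H3] := is_derive_epsilon (is_derive_sin 0) e'0.
exists (Num.min (Num.min d1 d2) (Num.min d3 (e' / 2))).
  by rewrite !lt_min d10 d20 d30 divr_gt0.
move=> h; rewrite !lt_min => /andP[/andP[h1 h2] /andP[h3 h4]].
have -> : cexp (z + h) - cexp z - cexp z * h = cexp z * (cexp h - 1 - h) by rewrite cexpD; ring.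
have hh := cabs_ge0 h; have hr := cabs_Re h; have hi := cabs_Im h.
rewrite cabsM.
suff : cabs (cexp h - 1 - h) <= 8 * e' * cabs h.
  move=> B; apply: (@le_trans _ _ ((cabs (cexp z) + 1) * (8 * e' * cabs h))).
    by apply: ler_pM; rewrite ?cabs_ge0//; lra.
  rewrite mulrA ler_wpM2r// mulrCA mulrC -ler_pdivlMr// mulrC -ler_pdivlMr; last lra.
  by rewrite mulrAC ge_min mulrAC lexx.
move: (H1 (complex.Re h) (le_lt_trans hr h1)) (H2 (complex.Im h) (le_lt_trans hi h2)) (H3 (complex.Im h) (le_lt_trans hi h3)).
rewrite !add0r expR0 mul1r cos0 sin0 oppr0 mul0r ?(subr0, addr0) mul1r.
move: hr hi hh h4; set r := cabs h; case: (h) => a b /= ar br r0 r4 Ea Cb Sb.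
have cb1 := cos_le1 b. have cb2 := cos_geN1 b.
have -> : cexp (a +i* b)%C - 1 - (a +i* b)%C = ((expR a * cos b - 1 - a) +i* (expR a * sin b - b))%C.
  by rewrite /cexp /cis /=; simpc.
apply: (le_trans (cabs_le_ReIm _)) => /=.
have -> : expR a * cos b - 1 - a = (expR a - 1 - a) * cos b + (1 + a) * (cos b - 1) by ring.
have -> : expR a * sin b - b = (expR a - 1 - a) * sin b + (1 + a) * (sin b - b) + a * b by ring.
have M (x1 x2 y1 y2 : R) : `|x1| <= y1 -> `|x2| <= y2 -> `|x1 * x2| <= y1 * y2.
  by move=> *; rewrite normrM ler_pM.
have a2 : `|1 + a| <= 2 by apply: (le_trans (ler_normD _ _)); rewrite normr1; lra.
have Ea' : `|expR a - 1 - a| <= e' * r by apply: (le_trans Ea); rewrite ler_pM2l.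
have Cb' : `|cos b - 1| <= e' * r by apply: (le_trans Cb); rewrite ler_pM2l.
have Sb' : `|sin b - b| <= e' * r by apply: (le_trans Sb); rewrite ler_pM2l.
have cb : `|cos b| <= 1 by rewrite ler_norml; lra.
have sb : `|sin b| <= 1 by rewrite ler_norml sin_geN1 sin_le1.
have T1 := M _ _ _ _ Ea' cb. have T2 := M _ _ _ _ a2 Cb'.
have T3 := M _ _ _ _ Ea' sb. have T4 := M _ _ _ _ a2 Sb'.
have T5 : `|a * b| <= e' * r by apply: M => //; lra.
have S1 := ler_normD ((expR a - 1 - a) * cos b) ((1 + a) * (cos b - 1)).
have S2 := ler_normD ((expR a - 1 - a) * sin b + (1 + a) * (sin b - b)) (a * b).
have S3 := ler_normD ((expR a - 1 - a) * sin b) ((1 + a) * (sin b - b)).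
have er : 0 <= e' * r by rewrite mulr_ge0// ltW.
lra.
Qed.

(** The form [Im G ds + Re G dt] is the imaginary part of [G(w) dw] for [w = s + i t]. The
    Cauchy-Riemann equations identify the [t]-slope of [Im G] and the [s]-slope of [Re G]: both are
    [Re L]. *)
Lemma closed_form_cdiff (G : R[i] -> R[i]) (s t : R) L : cdiff G (Complex s t) L ->
  closed_form_at (fun s t => complex.Im (G (Complex s t)))
                 (fun s t => complex.Re (G (Complex s t))) s t.
Proof.
move=> dG; exists (complex.Im L), (complex.Re L), (- complex.Im L) => e e0.
have [d d0 Hd] := dG e e0; exists (d / 2); first lra.
move=> s' t' hs ht.
pose h := Complex (s' - s) (t' - t).
have hb : cabs h <= `|s' - s| + `|t' - t| by exact: cabs_le_ReIm.
have hd : cabs h < d by lra.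
have := Hd h hd.
have -> : Complex s t + h = Complex s' t' by rewrite /h; simpc; rewrite !(addrC s) !(addrC t) !subrK.
set D := _ - _ - _ => HD.
have {}HD : cabs D <= e * (`|s' - s| + `|t' - t|) by apply: (le_trans HD); rewrite ler_pM2l.
split.
- have -> : complex.Im (G (Complex s' t')) - complex.Im (G (Complex s t)) - complex.Im L * (s' - s) - complex.Re L * (t' - t) = complex.Im D.
    by rewrite /D /h; case: (G (Complex s' t')) => a b; case: (G (Complex s t)) => a' b'; case: (L) => c d'; simpc => /=; ring.
  exact: le_trans (cabs_Im _) HD.
- have -> : complex.Re (G (Complex s' t')) - complex.Re (G (Complex s t)) - complex.Re L * (s' - s) - - complex.Im L * (t' - t) = complex.Re D.
    by rewrite /D /h; case: (G (Complex s' t')) => a b; case: (G (Complex s t)) => a' b'; case: (L) => c d'; simpc => /=; ring.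
  exact: le_trans (cabs_Re _) HD.
Qed.

End ComplexBasics.

(** * Circle means and their independence of the radius *)

Section CircleMean.
Variable R : realType.
Notation mu := (@lebesgue_measure R).
Implicit Types (u v P : R -> R).

Lemma continuous_integrable_itv u (a b : R) : continuous u ->
  mu.-integrable `[a, b] (EFin \o u).
Proof.
move=> cu; apply: continuous_compact_integrable; first exact: segment_compact.
exact: continuous_subspaceT.
Qed.

Lemma nbhs_dist (x d : R) : 0 < d -> \forall t \near x, `|t - x| < d.
Proof. by move=> d0; apply/nbhs_ballP; exists d => //= t; rewrite /ball /= distrC. Qed.

(** The integral starts at [-(|x| + 1)], which moves with [x]; subtracting the value at [0] makes
    the result independent of the starting point, as [FE] shows. Primitives on bounded intervals are
    thus glued to one on the whole line. *)
Lemma antiderivative u : continuous u ->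
  exists P, forall x : R, is_derive x 1 P (u x).
Proof.
move=> cu.
pose F (M x : R) := (\int[mu]_(t in `[- M, x]) u t)%R.
pose P x := F (`|x| + 1) x - F (`|x| + 1) 0.
have FE M N x : 0 < M -> M <= N -> - M <= x -> F N x - F N 0 = F M x - F M 0.
  move=> M0 MN Mx.
  have H y : - M <= y -> F N y = F N (- M) + F M y.
    move=> My; have iN := @continuous_integrable_itv u (- N) y cu.
    have := @Rintegral_itvB _ u (BLeft (- N)) (BRight y) (- M) iN.
    rewrite !bnd_simp => /(_ _ My).
    have NM : - N <= - M by rewrite lerN2.
    rewrite Rintegral_itv_obnd_cbnd; last first.
      apply: integrableS (@continuous_integrable_itv u (- M) y cu) => //.
      exact: subset_itv_oc_cc.
    by move=> /(_ NM); rewrite /F => <-; rewrite addrC subrK.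
  rewrite (H x)// (H 0); first ring.
  by rewrite oppr_le0 ltW.
exists P => x.
(* One lower end [- N] that serves every [y] at distance less than [1] from [x]. *)
pose N := `|x| + 2.
have N0 : 0 < N by rewrite /N; have := normr_ge0 x; lra.
apply: (@near_eq_is_derive _ _ _ (fun y => F N y - F N 0)).
  near=> y.
  have yx : `|y - x| < 1 by near: y; exact: nbhs_dist.
  have h1 : 0 < `|y| + 1 by rewrite ltr_wpDl.
  have h2 : `|y| + 1 <= N by have := lerB_dist y x; rewrite /N; lra.
  have h3 : - (`|y| + 1) <= y by have := ler_norm (- y); rewrite normrN; lra.
  by rewrite /P (FE _ _ _ h1 h2 h3).
rewrite -[u x]subr0; apply: is_deriveB.
have xN : x < N by rewrite /N; have := ler_norm x; lra.
have [||d1 d2] := @continuous_FTC1_closed _ u (- N) x N xN (@continuous_integrable_itv u _ _ cu).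
- by rewrite /N; have := ler_norm (- x); rewrite normrN; lra.
- exact: cu.
by split; [exact: d1|rewrite -derive1E].
Unshelve. all: by end_near. Qed.

Lemma twopi_gt0 : 0 < (pi : R) *+ 2.
Proof. by rewrite pmulrn_lgt0// pi_gt0. Qed.

Notation circ := (uniform_prob twopi_gt0).

(** Integrating against the uniform probability on [[0, 2 pi]] normalises the mean and lets Tonelli
    and Fubini treat the angle as one more integration variable. *)
Definition cmean u : R := (\int[circ]_t u t)%R.

Lemma circ_integrable u : continuous u -> circ.-integrable setT (EFin \o u).
Proof.
move=> cu; have mu_ : measurable_fun setT u by exact: continuous_measurable_fun.
apply/integrableP; split; first exact/measurable_EFinP.
rewrite integral_uniform//; last by apply: measurableT_comp => //; exact/measurable_EFinP.
apply: lte_mul_pinfty; rewrite ?lee_fin ?invr_ge0 ?subr0 ?(ltW twopi_gt0)//.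
by have /integrableP[] := @continuous_integrable_itv u 0 (pi *+ 2) cu.
Qed.

Lemma circ_integral u : continuous u ->
  (\int[circ]_t (u t)%:E = ((pi *+ 2)^-1)%:E * \int[mu]_(t in `[0%R, (pi *+ 2)%R]) (u t)%:E)%E.
Proof.
move=> cu; have mu_ : measurable_fun setT u by exact: continuous_measurable_fun.
have mE : measurable_fun setT (EFin \o u) by exact/measurable_EFinP.
have iu := @continuous_integrable_itv u 0 (pi *+ 2) cu.
have -> : (\int[mu]_(t in `[0%R, (pi *+ 2)%R]) (u t)%:E =
    \int[mu]_(t in `[0%R, (pi *+ 2)%R]) (EFin \o u)^\+ t - \int[mu]_(t in `[0%R, (pi *+ 2)%R]) (EFin \o u)^\- t)%E.
  exact: integralE.
rewrite muleBr//; last first.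
  by apply: fin_num_adde_defl; rewrite fin_numN; exact: integrable_neg_fin_num.
have -> : (\int[circ]_t (u t)%:E = \int[circ]_t (EFin \o u)^\+ t - \int[circ]_t (EFin \o u)^\- t)%E.
  exact: integralE.
have mp : measurable_fun setT ((EFin \o u)^\+)%E by exact: measurable_funepos.
have mn : measurable_fun setT ((EFin \o u)^\-)%E by exact: measurable_funeneg.
by rewrite !(integral_uniform _ mp) ?(integral_uniform _ mn)// !subr0.
Qed.

Lemma cmean_FTC u P : continuous u -> (forall x : R, is_derive x 1 P (u x)) ->
  cmean u = (P (pi *+ 2) - P 0) / (pi *+ 2).
Proof.
move=> cu dP; rewrite /cmean /Rintegral circ_integral//.
have cP : continuous P.
  by move=> x; apply: differentiable_continuous; apply/derivable1_diffP; apply: ex_derive.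
rewrite (@continuous_FTC2 _ u P); first by rewrite -EFinB -EFinM /= mulrC.
- exact: twopi_gt0.
- exact: continuous_subspaceT.
- split; first by move=> x _; apply: ex_derive.
  + by apply: cvg_at_right_filter; exact: cP.
  + by apply: cvg_at_left_filter; exact: cP.
- by move=> x _; rewrite derive1E; apply: derive_val.
Qed.

Lemma cmean_cst (c : R) : cmean (fun=> c) = c.
Proof.
rewrite /cmean Rintegral_cst//.
rewrite (_ : fine _ = 1) ?mulr1//; apply: (@congr1 _ _ fine _ 1%E).
exact: (probability_setT (uniform_prob twopi_gt0)).
Qed.

Lemma cmeanZ (c : R) u : continuous u -> cmean (fun t => c * u t) = c * cmean u.
Proof. by move=> cu; rewrite /cmean RintegralZl//; exact: circ_integrable. Qed.

Lemma cmeanD u v : continuous u -> continuous v ->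
  cmean (fun t => u t + v t) = cmean u + cmean v.
Proof. by move=> cu cv; rewrite /cmean RintegralD//; exact: circ_integrable. Qed.

Lemma le_cmean u v : continuous u -> continuous v -> (forall t, u t <= v t) ->
  cmean u <= cmean v.
Proof. by move=> cu cv uv; apply: le_Rintegral => //; exact: circ_integrable. Qed.

Lemma cdiff_continuous_line (G : R[i] -> R[i]) : (forall z, exists L, cdiff G z L) ->
  forall (Z : R -> R[i]), (forall s t, cabs (Z s - Z t) <= `|s - t|) ->
  continuous (fun t => complex.Re (G (Z t))) /\ continuous (fun t => complex.Im (G (Z t))).
Proof.
move=> dG Z lZ.
have H (x e : R) : 0 < e -> \forall t \near x, cabs (G (Z x) - G (Z t)) <= e.
  move=> e0; have [L /cdiff_lip[d d0 Hd]] := dG (Z x).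
  have L0 : 0 < cabs L + 1 by have := cabs_ge0 L; lra.
  have m0 : 0 < Num.min d (e / (cabs L + 1)) by rewrite lt_min d0 divr_gt0.
  near=> t.
  have : `|t - x| < Num.min d (e / (cabs L + 1)) by near: t; exact: nbhs_dist.
  rewrite lt_min => /andP[h1 h2].
  have h := lZ t x.
  rewrite cabsC -[Z t](subrKC (Z x)); apply: (le_trans (Hd _ (le_lt_trans h h1))).
  rewrite mulrC -ler_pdivlMr//; apply: (le_trans h); exact: ltW.
split=> x; apply/cvgrPdist_le => e e0; near=> t.
  apply: le_trans (_ : cabs (G (Z x) - G (Z t)) <= _); last by near: t; exact: H.
  by rewrite -ReB; exact: cabs_Re.
apply: le_trans (_ : cabs (G (Z x) - G (Z t)) <= _); last by near: t; exact: H.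
by rewrite -ImB; exact: cabs_Im.
Unshelve. all: by end_near. Qed.

(* Goursat on a rectangle of height [2 pi]: periodicity cancels the horizontal
   sides. *)
Lemma cmean_cexp_shift (G : R[i] -> R[i]) : (forall z, exists L, cdiff G z L) ->
  (forall s t : R, G (Complex s (t + pi *+ 2)) = G (Complex s t)) ->
  forall w : R[i], cmean (fun t => complex.Re (G (w + Complex 0 t))) =
                   cmean (fun t => complex.Re (G (Complex 0 t))).
Proof.
move=> dG pG w.
pose Q s t := complex.Re (G (Complex s t)); pose P s t := complex.Im (G (Complex s t)).
have cQ s : continuous (Q s).
  have [] := cdiff_continuous_line dG (Z := fun t => Complex s t) _ => // x y.
  by apply: (le_trans (cabs_le_ReIm _)); simpc => /=; rewrite ?subrr normr0 add0r.
have cP t : continuous (P^~ t).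
  have [] := cdiff_continuous_line dG (Z := fun s => Complex s t) _ => // x y.
  by apply: (le_trans (cabs_le_ReIm _)); simpc => /=; rewrite ?subrr normr0 addr0.
have /choice[IQ IQd] : forall s, exists I : R -> R, forall x : R, is_derive x 1 I (Q s x).
  by move=> s; exact: antiderivative.
have /choice[IP' IP'd] : forall t, exists I : R -> R, forall x : R, is_derive x 1 I (P x t).
  by move=> t; exact: antiderivative.
pose IP s t := IP' t s.
have cf s t : closed_form_at P Q s t by have [L HL] := dG (Complex s t); exact: closed_form_cdiff HL.
have G0 := @goursat_rectangle _ P Q IP IQ (fun s t => IP'd t s) IQd cf.
have zero_deriv_cst (f : R -> R) (x y : R) : (forall x : R, is_derive x 1 f 0) -> f x = f y.
  move=> fd; wlog xy : x y / x < y.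
    move=> W; have [|h|->//] := ltgtP x y; [exact: W|exact/esym/W].
  by have [c _] := mvt_is_derive xy fd; rewrite mul0r => /eqP; rewrite subr_eq0 => /eqP.
(* The mean over a full period does not depend on its starting point [a]: the increment of [IQ s]
   over a period has derivative [0] because [Q s] is periodic. *)
have mQ s a : cmean (fun t => Q s (a + t)) = (IQ s (pi *+ 2) - IQ s 0) / (pi *+ 2).
  have c1 : continuous (fun t => Q s (a + t)).
    move=> x; apply: (@continuous_comp _ _ _ (fun t => a + t)); last exact: cQ.
    by apply: cvgD; [exact: cvg_cst|exact: cvg_id].
  have d1 (x : R) : is_derive x 1 (fun t => IQ s (t + a)) (Q s (a + x)).
    rewrite (addrC a x).
    by have := @is_derive1_comp _ (IQ s) (fun t => t + a) x _ _ (IQd s (x + a)) (is_derive_shift x 1 a); rewrite mulr1.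
  rewrite (cmean_FTC c1 d1).
  congr (_ / _); rewrite add0r.
  have := @zero_deriv_cst (fun x => IQ s (x + pi *+ 2) - IQ s x) a 0.
  rewrite add0r (addrC a); apply=> x.
  rewrite -(subrr (Q s x)); apply: is_deriveB.
  have := @is_derive1_comp _ (IQ s) (fun t => t + pi *+ 2) x _ _ (IQd s (x + pi *+ 2)) (is_derive_shift x 1 (pi *+ 2)).
  by rewrite mulr1 {1}/Q pG.
rewrite (_ : (fun t => complex.Re (G (w + Complex 0 t))) = fun t => Q (complex.Re w) (complex.Im w + t)); last first.
  by apply/funext => t; case: w => a b; rewrite /Q; simpc.
rewrite mQ (_ : (fun t => complex.Re (G (Complex 0 t))) = fun t => Q 0 (0 + t)); last first.
  by apply/funext => t; rewrite add0r.
rewrite mQ; congr (_ / _).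
have mono (x y : R) : x < y -> IQ y (pi *+ 2) - IQ y 0 = IQ x (pi *+ 2) - IQ x 0.
  move=> xy; have yx0 : 0 < y - x by rewrite subr_gt0.
  have := G0 x 0 _ _ yx0 twopi_gt0; rewrite /diff2 subrKC add0r => H.
  have := @zero_deriv_cst (fun s => IP' (pi *+ 2) s - IP' 0 s) x y.
  suff d0 : forall s : R, is_derive s 1 (fun s => IP' (pi *+ 2) s - IP' 0 s) 0.
    by move=> /(_ d0); rewrite /IP in H; lra.
  move=> s.
  suff d1 : is_derive s 1 (IP' (pi *+ 2)) (P s 0).
    by have := is_deriveB d1 (IP'd 0 s); rewrite subrr.
  by have := IP'd (pi *+ 2) s; rewrite /P -[in Complex s (pi *+ 2)](add0r (pi *+ 2)) pG.
by have [/mono->|/mono->|->] := ltgtP (complex.Re w) 0.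
Qed.

Lemma cmean_circle_cexp (N : R[i] -> R[i]) (j : nat) (B : R[i]) :
  (forall z, exists L, cdiff N z L) ->
  forall z, z != 0 ->
  cmean (fun t => complex.Re (B * N (cis t * z) * (cis t * z) ^- j)) =
  cmean (fun t => complex.Re (B * N (cis t) * (cis t) ^- j)).
Proof.
move=> dN z /polar[w <-].
pose G (v : R[i]) := B * N (cexp v) * cexp (- v) ^+ j.
have cV (v : R[i]) : cexp v ^- j = cexp (- v) ^+ j.
  rewrite -exprVn; congr (_ ^+ _); apply: (@mulfI _ (cexp v)).
    by apply: contra_eq_neq (cexpN v) => ->; rewrite mul0r eq_sym oner_neq0.
  rewrite cexpN mulfV//.
  by apply: contra_eq_neq (cexpN v) => ->; rewrite mul0r eq_sym oner_neq0.
have ci t : cexp (Complex 0 t) = cis t by rewrite /cexp /= expR0 mul1r.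
have dG (v : R[i]) : exists L, cdiff G v L.
  have [L1 H1] := dN (cexp v).
  have H2 := cdiff_comp (cdiff_cexp v) H1.
  have [L3 H3] := cdiffX j (cdiff_comp (cdiff_opp v) (cdiff_cexp (- v))).
  have H := cdiffM (cdiffM (cdiff_cst B v) H2) H3.
  by eexists; exact: H.
have pG s t : G (Complex s (t + pi *+ 2)) = G (Complex s t).
  have c1 : cexp (Complex s (t + pi *+ 2)) = cexp (Complex s t) by rewrite /cexp /= cis_periodic.
  by rewrite /G -(cV (Complex s (t + _))) -(cV (Complex s t)) c1.
have E t : G (w + Complex 0 t) = B * N (cis t * cexp w) * (cis t * cexp w) ^- j.
  by rewrite /G -(cV (w + Complex 0 t)) cexpD ci (mulrC (cexp w)).
have E' t : G (Complex 0 t) = B * N (cis t) * (cis t) ^- j.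
  by rewrite /G -(cV (Complex 0 t)) ci.
have := cmean_cexp_shift dG pG w.
under eq_fun do rewrite E.
by under [in X in _ = X]eq_fun do rewrite E'.
Qed.

End CircleMean.

(** * Integrals up to null sets *)

Section AlmostEverywhere.
Context d (T : measurableType d) (R : realType) (mu : {measure set T -> \bar R}).
Local Open Scope ereal_scope.
Import HBNNSimple.

(* No measurability: the integral is a supremum over simple functions below,
   and these may be cut off on a null set. *)
Lemma ge0_le_integral_off_null (N : set T) (f g : T -> \bar R) :
  measurable N -> mu N = 0 -> (forall x, 0 <= f x) -> (forall x, 0 <= g x) ->
  (forall x, ~ N x -> f x <= g x) -> \int[mu]_x f x <= \int[mu]_x g x.
Proof.
move=> mN N0 f0 g0 fg; rewrite (ge0_integralTE mu f0).
apply: ge_ereal_sup => _ [h /= hf <-].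
have mNC : measurable (~` N) by exact: measurableC.
pose h' := mul_nnsfun h (indic_nnsfun R mNC).
have -> : sintegral mu h = sintegral mu h'.
  rewrite -!integralT_nnsfun; apply: ge0_ae_eq_integral => //.
  - exact/measurable_EFinP.
  - exact/measurable_EFinP.
  - by move=> x _; rewrite lee_fin.
  - by move=> x _; rewrite lee_fin.
  - exists N; split => // x /= /not_implyP[_ hh']; apply: contrapT => Nx; apply: hh'.
    by rewrite /= mindicE mem_set// mulr1.
rewrite (ge0_integralTE mu g0); apply: ereal_sup_ubound; exists h' => //= x.
rewrite mindicE; case: (pselect (N x)) => Nx.
  by rewrite memNset ?mulr0//=; move=> /(_ Nx).
by rewrite mem_set// mulr1 (le_trans (hf x))// fg.
Qed.

Lemma eq_integral_off_null (N : set T) (f g : T -> \bar R) :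
  measurable N -> mu N = 0 -> (forall x, ~ N x -> f x = g x) ->
  \int[mu]_x f x = \int[mu]_x g x.
Proof.
move=> mN N0 fg; rewrite integralE [RHS]integralE.
congr (_ - _); apply/eqP; rewrite eq_le; apply/andP; split;
  apply: (ge0_le_integral_off_null mN) => // x Nx;
  by rewrite ?funeposE ?funenegE (fg x).
Qed.

Lemma fin_num_null (G : T -> \bar R) : measurable_fun setT G -> (forall x, 0 <= G x) ->
  \int[mu]_x G x < +oo ->
  exists N, [/\ measurable N, mu N = 0 & forall x, ~ N x -> G x \is a fin_num].
Proof.
move=> mG G0 iG.
have /integrable_ae : mu.-integrable setT G.
  by apply/integrableP; split => //; under eq_integral do rewrite gee0_abs//.
move=> /(_ measurableT)[N [mN N0 HN]]; exists N; split => // x.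
by apply: contra_notP => nf; apply: HN => /= /(_ I).
Qed.

Lemma integrable_fine (G : T -> \bar R) : measurable_fun setT G -> (forall x, 0 <= G x) ->
  \int[mu]_x G x < +oo -> mu.-integrable setT (EFin \o (fine \o G)).
Proof.
move=> mG G0 iG.
have mf : measurable_fun setT (EFin \o (fine \o G)).
  by apply/measurable_EFinP; apply: measurableT_comp => //; exact: fine_measurable.
apply/integrableP; split => //; apply: le_lt_trans iG; apply: ge0_le_integral => //.
  exact: measurableT_comp.
move=> x _ /=; rewrite ger0_norm ?fine_ge0//.
by move: (G0 x); case: (G x) => //= r _; rewrite leey.
Qed.

Lemma integral_fine (G : T -> \bar R) : measurable_fun setT G -> (forall x, 0 <= G x) ->
  \int[mu]_x G x < +oo -> \int[mu]_x (fine (G x))%:E = \int[mu]_x G x.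
Proof.
move=> mG G0 iG; have [N [mN N0 HN]] := fin_num_null mG G0 iG.
by apply: (eq_integral_off_null mN N0) => x /HN; exact: fineK.
Qed.

(** [g] may stand for an inner integral that has no meaning on exceptional slices. It is prescribed
    only off [N] and where both majorants are finite; the rest is null because [G1] and [G2] have
    finite integrals. No measurability of [g] is asked for. *)
Lemma Rintegral_fineB (N : set T) (G1 G2 : T -> \bar R) (g : T -> R) :
  measurable N -> mu N = 0 ->
  measurable_fun setT G1 -> measurable_fun setT G2 ->
  (forall x, 0 <= G1 x) -> (forall x, 0 <= G2 x) ->
  \int[mu]_x G1 x < +oo -> \int[mu]_x G2 x < +oo ->
  (forall x, ~ N x -> G1 x < +oo -> G2 x < +oo -> g x = (fine (G1 x) - fine (G2 x))%R) ->
  Rintegral mu setT g = (fine (\int[mu]_x G1 x) - fine (\int[mu]_x G2 x))%R.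
Proof.
move=> mN N0 m1 m2 p1 p2 i1 i2 Hg.
have [N1 [mN1 N10 H1]] := fin_num_null m1 p1 i1.
have [N2 [mN2 N20 H2]] := fin_num_null m2 p2 i2.
have E : \int[mu]_x (g x)%:E = \int[mu]_x (fine (G1 x) - fine (G2 x))%:E.
  apply: (@eq_integral_off_null (N `|` N1 `|` N2)).
  - by do 2 apply: measurableU => //.
  - by rewrite measureU0// ?measureU0//; exact: measurableU.
  - move=> x /not_orP[/not_orP[nN nN1] nN2]; rewrite Hg//.
    + by rewrite -ge0_fin_numE// H1.
    + by rewrite -ge0_fin_numE// H2.
rewrite /Rintegral E -/(Rintegral mu setT (fun x => (fine (G1 x) - fine (G2 x))%R)).
rewrite (@RintegralB _ _ _ _ setT (fine \o G1) (fine \o G2))//; [|exact: integrable_fine..].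
by rewrite /Rintegral /= !integral_fine.
Qed.

End AlmostEverywhere.

(** * Plane integrals: measurability and rotation invariance *)

Section Plane.
Variable R : realType.
Notation mu := (@lebesgue_measure R).
Notation RR := (measurableTypeR R * measurableTypeR R)%type.
Local Open Scope ereal_scope.
Implicit Types F G : R[i] -> \bar R.

(** The pushforward of Lebesgue measure under a translation agrees with length on half-open
    intervals, hence is Lebesgue measure. *)
Lemma ge0_integral_shift (f : measurableTypeR R -> \bar R) (t : R) :
  measurable_fun setT f -> (forall x, 0 <= f x) ->
  \int[mu]_x f (x + t)%R = \int[mu]_x f x.
Proof.
move=> mf f0.
pose phi (x : measurableTypeR R) : measurableTypeR R := (x + t)%R.
have mphi : measurable_fun setT phi by apply: measurable_funD.
transitivity (\int[pushforward mu phi]_x f x).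
  by rewrite (ge0_integral_pushforward mphi).
apply: eq_measure_integral => A mA _.
apply/esym; apply: lebesgue_measure_unique => // _ [[a b] _ <-] /=.
rewrite /pushforward.
have -> : (phi @^-1` `]a, b] = `](a - t)%R, (b - t)%R])%classic.
  by apply/seteqP; split => x /=; rewrite /phi !in_itv /= ltrBlDr lerBrDr.
rewrite !lebesgue_measure_itv /= !lte_fin ltrD2r; case: ifPn => // _.
by rewrite -!EFinB; congr EFin; ring.
Qed.

Definition measC (G : R[i] -> \bar R) : Prop :=
  measurable_fun [set: RR] (fun xy : RR => G (Complex xy.1 xy.2)).

Lemma intCE G : measC G -> (forall z, 0 <= G z) ->
  intC G = \int[mu \x mu]_xy G (Complex xy.1 xy.2).
Proof. by move=> mG G0; rewrite (fubini_tonelli1 _ mG). Qed.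

Lemma measC_fiber G x : measC G -> measurable_fun [set: measurableTypeR R] (fun y => G (Complex x y)).
Proof. by move=> mG; exact: (measurable_fun_pair2 x mG). Qed.

Lemma measC_int G : measC G -> (forall z, 0 <= G z) ->
  measurable_fun [set: measurableTypeR R] (fun x => \int[mu]_y G (Complex x y)).
Proof. by move=> mG G0; exact: (measurable_fun_fubini_tonelli_F _ mG). Qed.

Lemma intC_ge0 G : (forall z, 0 <= G z) -> 0 <= intC G.
Proof. by move=> G0; apply: integral_ge0 => x _; exact: integral_ge0. Qed.

Lemma intCD F G : measC F -> measC G -> (forall z, 0 <= F z) -> (forall z, 0 <= G z) ->
  intC (fun z => F z + G z) = intC F + intC G.
Proof.
move=> mF mG F0 G0; rewrite !intCE//; first exact: ge0_integralD.
- exact: emeasurable_funD.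
- by move=> z; exact: adde_ge0.
Qed.

Lemma intCZl (c : \bar R) G : measC G -> (forall z, 0 <= G z) -> 0 <= c ->
  intC (fun z => c * G z) = c * intC G.
Proof.
move=> mG G0 c0; rewrite !intCE//; first exact: ge0_integralZl.
- exact: measurable_funeM.
- by move=> z; exact: mule_ge0.
Qed.

Lemma le_intC F G : measC F -> measC G -> (forall z, 0 <= F z) ->
  (forall z, F z <= G z) -> intC F <= intC G.
Proof.
move=> mF mG F0 FG; rewrite !intCE//; first exact: ge0_le_integral.
by move=> z; exact: le_trans (F0 z) (FG z).
Qed.

(** The origin is excluded because circle means are compared only on circles of positive radius. In
    iterated form the whole line [Re z = 0] is discarded, a null set for the outer integral. *)
Lemma RintC_fineB (G1 G2 : R[i] -> \bar R) (g : R[i] -> R) :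
  measC G1 -> measC G2 -> (forall z, 0 <= G1 z) -> (forall z, 0 <= G2 z) ->
  intC G1 < +oo -> intC G2 < +oo ->
  (forall z, z != 0%R -> G1 z < +oo -> G2 z < +oo -> g z = (fine (G1 z) - fine (G2 z))%R) ->
  Defs.RintC g = (fine (intC G1) - fine (intC G2))%R.
Proof.
move=> m1 m2 p1 p2 i1 i2 H.
rewrite /Defs.RintC /intC.
apply: (@Rintegral_fineB _ _ _ mu [set 0%R] (fun x => \int[mu]_y G1 (Complex x y)) (fun x => \int[mu]_y G2 (Complex x y))) => //.
- exact: lebesgue_measure_set1.
- exact: measC_int.
- exact: measC_int.
- by move=> x; exact: integral_ge0.
- by move=> x; exact: integral_ge0.
move=> x x0 f1 f2.
apply: (@Rintegral_fineB _ _ _ mu set0 (fun y => G1 (Complex x y)) (fun y => G2 (Complex x y))) => //.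
- exact: measC_fiber.
- exact: measC_fiber.
move=> y _; apply: H; apply/eqP => -[x0' _]; exact: x0.
Qed.

Definition lsc1 (G : R[i] -> \bar R) := forall z (a : R), a%:E < G z ->
  exists2 d : R, (0 < d)%R & forall w, (cabs (w - z) < d)%R -> a%:E < G w.

(** Superlevel sets are open, hence countable unions of rational rectangles, which are measurable in
    the product. *)
Lemma lsc1_measC G : lsc1 G -> measC G.
Proof.
move=> lG; apply: (measurability _ (ErealGenOInfty.measurableE R)).
move=> /= _ [_ [a ->]] <-; rewrite setTI.
pose P (p q r s : rat) := forall x y : R, (ratr p < x < ratr q)%R -> (ratr r < y < ratr s)%R -> a%:E < G (Complex x y).
(* A rectangle not contained in the superlevel set is replaced by the empty set, so that the union
   may range over all rational corners. *)
pose B (p q r s : rat) : set RR := if pselect (P p q r s) then (`](ratr p : R), ratr q[ `*` `](ratr r : R), ratr s[)%classic else set0.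
rewrite [X in measurable X](_ : _ = \bigcup_p \bigcup_q \bigcup_r \bigcup_s B p q r s).
  apply: bigcupT_measurable_rat => p; apply: bigcupT_measurable_rat => q.
  apply: bigcupT_measurable_rat => r; apply: bigcupT_measurable_rat => s.
  rewrite /B; case: pselect => hP; last exact: measurable0.
  by apply: measurableX; exact: measurable_itv.
apply/seteqP; split => -[x y] /=.
  rewrite in_itv /= andbT => /lG[d d0 Hd].
  have d2 : (0 < d / 2)%R by lra.
  have dd (v : R) : (v - d / 2 < v)%R /\ (v < v + d / 2)%R by lra.
  have [p] := rat_in_itvoo (dd x).1; rewrite in_itv /= => /andP[p1 p2].
  have [q] := rat_in_itvoo (dd x).2; rewrite in_itv /= => /andP[q1 q2].
  have [r] := rat_in_itvoo (dd y).1; rewrite in_itv /= => /andP[r1 r2].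
  have [s] := rat_in_itvoo (dd y).2; rewrite in_itv /= => /andP[s1 s2].
  exists p => //; exists q => //; exists r => //; exists s => //.
  rewrite /B; case: pselect => [hP|[]]; first by split; rewrite /= in_itv /= ?p2 ?q1 ?r2 ?s1.
  move=> x' y' /andP[h1 h2] /andP[h3 h4]; apply: Hd; apply: (le_lt_trans (cabs_le_ReIm _)).
  simpc => /=; have A : (`|x' - x| < d / 2)%R by rewrite ltr_norml; lra.
  have A' : (`|y' - y| < d / 2)%R by rewrite ltr_norml; lra.
  lra.
move=> [p _ [q _ [r _ [s _]]]]; rewrite /B; case: pselect => //= H [].
by rewrite !in_itv /= andbT => h1 h2; exact: H.
Qed.

Lemma intC_shearY (t : R) (g : RR -> \bar R) : measurable_fun setT g -> (forall z, 0 <= g z) ->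
  \int[mu]_x \int[mu]_y g (x, (y + t * x)%R) = \int[mu]_x \int[mu]_y g (x, y).
Proof.
move=> mg g0; apply: eq_integral => x _.
by apply: (@ge0_integral_shift (fun y => g (x, y))) => //; exact: measurable_fun_pair2.
Qed.

Lemma measurable_shearX (t : R) : measurable_fun [set: RR] (fun xy : RR => ((xy.1 + t * xy.2)%R, xy.2) : RR).
Proof.
apply: measurable_fun_pair => //; apply: measurable_funD => //.
by apply: measurable_funM.
Qed.

Lemma measurable_shearY (t : R) : measurable_fun [set: RR] (fun xy : RR => (xy.1, (xy.2 + t * xy.1)%R) : RR).
Proof.
apply: measurable_fun_pair => //; apply: measurable_funD => //.
by apply: measurable_funM.
Qed.

(** For fixed [y] the shear is a translation in [x]; Tonelli first makes [x] the inner variable. *)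
Lemma intC_shearX (t : R) (g : RR -> \bar R) : measurable_fun setT g -> (forall z, 0 <= g z) ->
  \int[mu]_x \int[mu]_y g ((x + t * y)%R, y) = \int[mu]_x \int[mu]_y g (x, y).
Proof.
move=> mg g0; rewrite [RHS](fubini_tonelli g)//.
rewrite (fubini_tonelli (fun xy : RR => g ((xy.1 + t * xy.2)%R, xy.2)))//=; last first.
  exact: (measurableT_comp mg (measurable_shearX t)).
apply: eq_integral => y _.
by apply: (@ge0_integral_shift (fun x => g (x, y))) => //; exact: measurable_fun_pair1.
Qed.

Lemma measC_rot (u : R[i]) G : measC G -> measC (fun z => G (u * z)%R).
Proof.
move=> mG; case: u => c s.
pose phi (xy : RR) : RR := ((c * xy.1 - s * xy.2)%R, (c * xy.2 + s * xy.1)%R).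
have mphi : measurable_fun setT phi.
  apply: measurable_fun_pair; first by apply: measurable_funB; apply: measurable_funM.
  by apply: measurable_funD; apply: measurable_funM.
rewrite /measC (_ : (fun xy : RR => _) = (fun xy : RR => G (Complex xy.1 xy.2)) \o phi); first exact: measurableT_comp.
by apply/funext => -[x y] /=; congr G; simpc; congr Complex; rewrite addrC.
Qed.

(* A rotation other than [-1] is a product of three shears. *)
Lemma intC_rot (u : R[i]) G : cabs u = 1%R -> measC G -> (forall z, 0 <= G z) ->
  intC (fun z => G (u * z)%R) = intC G.
Proof.
have main c s : (s != 0)%R -> (c ^+ 2 + s ^+ 2 = 1)%R -> forall G, measC G -> (forall z, 0 <= G z) ->
    intC (fun z => G (Complex c s * z)%R) = intC G.
  move=> s0 cs {}G mG G0.
  (* For the angle [theta] this is [- tan (theta / 2)]: the rotation is [X \o Y \o X], where [X] has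
     slope [t] and [Y] has slope [s = sin theta]. *)
  pose t : R := ((c - 1) / s)%R.
  pose g (xy : RR) := G (Complex xy.1 xy.2).
  pose X (xy : RR) : RR := ((xy.1 + t * xy.2)%R, xy.2).
  pose Y (xy : RR) : RR := (xy.1, (xy.2 + s * xy.1)%R).
  have mX : measurable_fun setT X by exact: measurable_shearX.
  have mY : measurable_fun setT Y by exact: measurable_shearY.
  have mgX : measurable_fun setT (g \o X) by exact: measurableT_comp mG mX.
  have mgXY : measurable_fun setT (g \o X \o Y) by exact: measurableT_comp mgX mY.
  have -> : intC (fun z => G (Complex c s * z)%R) = \int[mu]_x \int[mu]_y (g \o X \o Y) (X (x, y)).
    rewrite /intC; apply: eq_integral => x _; apply: eq_integral => y _.
    rewrite /g /X /Y /=; congr G; simpc; congr Complex.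
      have -> : (s * y = - t * (1 + c) * y)%R.
        rewrite /t; congr (_ * y)%R; apply: (mulfI s0); rewrite mulNr mulrN mulrA (mulrC s (_ / _)%R) divfK// -expr2; lra.
      by rewrite /t; field.
    by rewrite /t; field.
  have p1 xy : 0 <= (g \o X \o Y) xy by exact: G0.
  have p2 xy : 0 <= (g \o X) xy by exact: G0.
  have p3 xy : 0 <= g xy by exact: G0.
  transitivity (\int[mu]_x \int[mu]_y (g \o X \o Y) (x, y)); first exact: (intC_shearX t mgXY p1).
  transitivity (\int[mu]_x \int[mu]_y (g \o X) (x, y)); first exact: (intC_shearY s mgX p2).
  exact: (intC_shearX t mG p3).
case: u => c s u1 mG G0.
have cs : (c ^+ 2 + s ^+ 2 = 1)%R by have := cabs_sqr (Complex c s); rewrite u1 expr1n /= => <-.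
have [s0|s0] := eqVneq s 0%R; last exact: main.
have [c1|cN1] : c = 1%R \/ c = (-1)%R.
  have : ((c - 1) * (c + 1) = 0)%R by rewrite s0 expr0n addr0 in cs; rewrite -subr_sqr cs expr1n subrr.
  by move=> /eqP; rewrite mulf_eq0 subr_eq0 addr_eq0 => /orP[/eqP|/eqP]; [left|right].
- by rewrite c1 s0; under [LHS]eq_integral do under eq_integral do rewrite mul1r.
(* [-1] is [i * i], and the rotation by [i] has nonzero imaginary part. *)
- have i1 : (0 ^+ 2 + 1 ^+ 2 = 1 :> R)%R by rewrite expr0n expr1n add0r.
  have mG' : measC (fun z => G (Complex 0 1 * z)%R) by exact: measC_rot.
  have G0' z : 0 <= G (Complex 0 1 * z)%R by exact: G0.
  transitivity (intC (fun z => G (Complex 0 1 * z)%R)); last exact: (main _ _ (oner_neq0 _) i1).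
  transitivity (intC (fun z => G (Complex 0 1 * (Complex 0 1 * z))%R)); last exact: (main _ _ (oner_neq0 _) i1 _ mG' G0').
  rewrite /intC; apply: eq_integral => x _; apply: eq_integral => y _; congr G.
  rewrite cN1 s0 mulrA; congr (_ * _)%R.
  by apply/eqP; rewrite eq_complex /=; apply/andP; split; apply/eqP; ring.
Qed.

End Plane.

(** * Plane integrals through circle averages *)

Section PlaneCircle.
Variable R : realType.
Notation mu := (@lebesgue_measure R).
Notation RR := (measurableTypeR R * measurableTypeR R)%type.
Notation circ := (uniform_prob (twopi_gt0 R)).
Implicit Types (G : R[i] -> \bar R) (K q : R[i] -> R).

Definition ccont1 K := forall z (e : R), 0 < e -> exists2 d : R, 0 < d &
  forall w, cabs (w - z) < d -> `|K w - K z| < e.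

Lemma ccont1_curve K (Z : R -> R[i]) : ccont1 K ->
  continuous (fun t => complex.Re (Z t)) -> continuous (fun t => complex.Im (Z t)) ->
  continuous (fun t => K (Z t)).
Proof.
move=> cK cR cI x; apply/cvgrPdist_lt => e e0.
have [d d0 Hd] := cK (Z x) e e0.
have d2 : 0 < d / 2 by lra.
have /cvgrPdist_lt /(_ _ d2) nR := cR x; have /cvgrPdist_lt /(_ _ d2) nI := cI x.
near=> t; rewrite distrC; apply: Hd.
apply: (le_lt_trans (cabs_le_ReIm _)).
have h1 : `|complex.Re (Z x) - complex.Re (Z t)| < d / 2 by near: t.
have h2 : `|complex.Im (Z x) - complex.Im (Z t)| < d / 2 by near: t.
by rewrite distrC in h1; rewrite distrC in h2; rewrite ReB ImB; lra.
Unshelve. all: by end_near. Qed.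

Lemma ccont1_circle K z : ccont1 K -> continuous (fun t => K (cis t * z)).
Proof.
move=> cK; case: z => a b; apply: ccont1_curve => //; rewrite /cis; simpc => /= t.
  by apply: cvgB; apply: cvgM; (try exact: cvg_cst); [exact: continuous_cos|exact: continuous_sin].
by apply: cvgD; apply: cvgM; (try exact: cvg_cst); [exact: continuous_cos|exact: continuous_sin].
Qed.

Lemma ccont1_measC K : ccont1 K -> measC (fun z => (K z)%:E).
Proof.
move=> cK; apply: lsc1_measC => z a; rewrite lte_fin => az.
have e0 : 0 < K z - a by rewrite subr_gt0.
have [d d0 Hd] := cK z _ e0; exists d => // w /Hd; rewrite lte_fin ltr_norml; lra.
Qed.

Lemma ccont1_max0 K : ccont1 K -> ccont1 (fun z => Num.max (K z) 0).
Proof.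
move=> cK z e e0; have [d d0 Hd] := cK z e e0; exists d => // w /Hd.
by rewrite !ltr_norml => ?; case: (leP (K w) 0%R); case: (leP (K z) 0%R); lra.
Qed.

Lemma ccont1N K : ccont1 K -> ccont1 (fun z => - K z).
Proof.
move=> cK z e e0; have [d d0 Hd] := cK z e e0; exists d => // w /Hd.
by rewrite -opprD normrN.
Qed.

Local Open Scope ereal_scope.

Let mcos : measurable_fun [set: measurableTypeR R] (cos : R -> R).
Proof. by apply: continuous_measurable_fun; exact: continuous_cos. Qed.
Let msin : measurable_fun [set: measurableTypeR R] (sin : R -> R).
Proof. by apply: continuous_measurable_fun; exact: continuous_sin. Qed.

(** The space [T] stays general because the angle and the two coordinates are grouped differently in
    the successive uses of Tonelli. *)
Lemma measurable_circ_action d (T : measurableType d) G (t x y : T -> measurableTypeR R) :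
  measC G -> measurable_fun setT t -> measurable_fun setT x -> measurable_fun setT y ->
  measurable_fun setT (fun v => G (cis (t v) * Complex (x v) (y v))%R).
Proof.
move=> mG mt mx my.
pose phi (v : T) : RR := ((cos (t v) * x v - sin (t v) * y v)%R, (cos (t v) * y v + sin (t v) * x v)%R).
have mc : measurable_fun setT (fun v => cos (t v) : measurableTypeR R) by exact: (measurableT_comp mcos).
have ms : measurable_fun setT (fun v => sin (t v) : measurableTypeR R) by exact: (measurableT_comp msin).
have mphi : measurable_fun setT phi.
  apply: measurable_fun_pair; first by apply: measurable_funB; apply: measurable_funM.
  by apply: measurable_funD; apply: measurable_funM.
exact: (measurableT_comp mG mphi).
Qed.

Lemma measC_circ G : measC G -> (forall z, 0 <= G z) ->
  measC (fun z => \int[circ]_t G (cis t * z)%R).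
Proof.
move=> mG G0.
apply: (@measurable_fun_fubini_tonelli_F _ _ RR (measurableTypeR R) R circ
  (fun v => G (cis v.2 * Complex v.1.1 v.1.2)%R)) => //.
by apply: measurable_circ_action => //; apply: measurableT_comp.
Qed.

(** Each rotation preserves the integral, hence so does the average over all of them. The average is
    then moved inside past [x] and past [y], one use of Tonelli for each. *)
Lemma intC_circ G : measC G -> (forall z, 0 <= G z) ->
  intC (fun z => \int[circ]_t G (cis t * z)%R) = intC G.
Proof.
move=> mG G0; apply/esym.
transitivity (\int[circ]_t intC (fun z => G (cis t * z)%R)).
  rewrite (eq_integral (fun=> intC G)) ?integral_cst//; last first.
    by move=> t _; apply: intC_rot => //; exact: cabs_cis.
  rewrite -[LHS]mule1; congr (_ * _); apply/esym; exact: (probability_setT circ).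
rewrite /intC.
transitivity (\int[mu]_x \int[circ]_t \int[mu]_y G (cis t * Complex x y)%R).
  apply: (@fubini_tonelli _ _ _ _ _ circ mu (fun v => \int[mu]_y G (cis v.1 * Complex v.2 y)%R)).
    apply: (@measurable_fun_fubini_tonelli_F _ _ RR (measurableTypeR R) R mu
      (fun v => G (cis v.1.1 * Complex v.1.2 v.2)%R)) => //.
    by apply: measurable_circ_action => //; apply: measurableT_comp.
  by move=> v; exact: integral_ge0.
apply: eq_integral => x _.
apply: (@fubini_tonelli _ _ _ _ _ circ mu (fun v => G (cis v.1 * Complex x v.2)%R)) => //.
by apply: measurable_circ_action.
Qed.

Lemma RintC_posneg K : ccont1 K -> intC (fun z => `|K z|%:E) < +oo ->
  [/\ intC (fun z => (Num.max (K z) 0)%:E) < +oo,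
      intC (fun z => (Num.max (- K z) 0)%:E) < +oo &
      Defs.RintC K = (fine (intC (fun z => (Num.max (K z) 0)%:E)) -
                 fine (intC (fun z => (Num.max (- K z) 0)%:E)))%R].
Proof.
move=> cK iK.
have mp := ccont1_measC (ccont1_max0 cK).
have mn := ccont1_measC (ccont1_max0 (ccont1N cK)).
have mK : measC (fun z => `|K z|%:E).
  apply: ccont1_measC => z e e0; have [d d0 Hd] := cK z e e0; exists d => // w /Hd.
  by apply: le_lt_trans; exact: ler_dist_dist.
have p0 z : 0 <= (Num.max (K z) 0)%:E by rewrite lee_fin le_max lexx orbT.
have n0 z : 0 <= (Num.max (- K z) 0)%:E by rewrite lee_fin le_max lexx orbT.
have ip : intC (fun z => (Num.max (K z) 0)%:E) < +oo.
  apply: le_lt_trans iK; apply: le_intC => // z.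
  by rewrite lee_fin ge_max ler_norm normr_ge0.
have in_ : intC (fun z => (Num.max (- K z) 0)%:E) < +oo.
  apply: le_lt_trans iK; apply: le_intC => // z.
  by rewrite lee_fin ge_max -normrN ler_norm normr_ge0.
split => //; apply: RintC_fineB => // z _ _ _ /=.
by case: (leP (K z) 0%R); case: (leP (- K z)%R 0%R); lra.
Qed.

Lemma RintCZr q (c : R) : ccont1 q -> (forall z, (0 <= q z)%R) ->
  intC (fun z => (q z)%:E) < +oo ->
  Defs.RintC (fun z => q z * c)%R = (fine (intC (fun z => (q z)%:E)) * c)%R.
Proof.
move=> cq q0 iq; have mq := ccont1_measC cq.
have q0' z : 0 <= (q z)%:E by rewrite lee_fin.
have Z b : (0 <= b)%R -> intC (fun z => (b * q z)%:E) = b%:E * intC (fun z => (q z)%:E).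
  by move=> b0; rewrite -intCZl.
have fq : intC (fun z => (q z)%:E) \is a fin_num by rewrite ge0_fin_numE// intC_ge0.
have L b : (0 <= b)%R -> intC (fun z => (b * q z)%:E) < +oo.
  by move=> b0; rewrite Z// lte_mul_pinfty.
have p0 : (0 <= Num.max c 0)%R by rewrite le_max lexx orbT.
have n0 : (0 <= Num.max (- c) 0)%R by rewrite le_max lexx orbT.
have M b : measC (fun z => (b * q z)%:E) by exact: (@measurable_funeM _ _ _ _ _ b%:E mq).
rewrite (@RintC_fineB _ (fun z => (Num.max c 0 * q z)%:E) (fun z => (Num.max (- c) 0 * q z)%:E)) ?L//.
- rewrite !Z// !fineM//= mulrC [X in (_ - X)%R]mulrC -mulrBr; congr (_ * _)%R.
  by case: (leP c 0%R); case: (leP (- c)%R 0%R); lra.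
- by move=> z; rewrite lee_fin mulr_ge0.
- by move=> z; rewrite lee_fin mulr_ge0.
- move=> z _ _ _ /=; rewrite mulrC -mulrBl; congr (_ * _)%R.
  by case: (leP c 0%R); case: (leP (- c)%R 0%R); lra.
Qed.

(** Positive and negative parts are each replaced by their circle averages, which leaves their
    integrals unchanged. The difference of the averages is the circle mean of [K], that is
    [q z * c], so no radial integration is carried out. *)
Lemma RintC_circle K q (c : R) : ccont1 K -> intC (fun z => `|K z|%:E) < +oo ->
  ccont1 q -> (forall z, (0 <= q z)%R) -> intC (fun z => (q z)%:E) < +oo ->
  (forall z, z != 0%R -> cmean (fun t => K (cis t * z)%R) = q z * c)%R ->
  Defs.RintC K = (fine (intC (fun z => (q z)%:E)) * c)%R.
Proof.
move=> cK iK cq q0 iq HK; rewrite -RintCZr//.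
have [ip in_ ->] := RintC_posneg cK iK.
have cp := ccont1_max0 cK; have cn := ccont1_max0 (ccont1N cK).
have mp := ccont1_measC cp; have mn := ccont1_measC cn.
have p0 z : 0 <= (Num.max (K z) 0)%:E by rewrite lee_fin le_max lexx orbT.
have n0 z : 0 <= (Num.max (- K z) 0)%:E by rewrite lee_fin le_max lexx orbT.
have Ep := intC_circ mp p0; have En := intC_circ mn n0.
rewrite -Ep -En; apply/esym; apply: RintC_fineB.
- exact: (measC_circ mp p0).
- exact: (measC_circ mn n0).
- by move=> z; apply: integral_ge0 => t _.
- by move=> z; apply: integral_ge0 => t _.
- by rewrite Ep.
- by rewrite En.
move=> z z0 _ _; rewrite -HK//.
have c1 := ccont1_circle (z := z) cp; have c2 := ccont1_circle (z := z) cn.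
rewrite -[RHS]/(cmean (fun t => Num.max (K (cis t * z)) 0) - cmean (fun t => Num.max (- K (cis t * z)) 0))%R.
rewrite -mulN1r -cmeanZ// -cmeanD//; last first.
  by move=> t; apply: cvgM; [exact: cvg_cst|exact: c2].
congr cmean; apply/funext => t; set k := K _.
by case: (leP k 0%R); case: (leP (- k)%R 0%R); lra.
Qed.

End PlaneCircle.

(** * Iterated integrals of lower semicontinuous functions *)

Section IteratedIntegrals.
Variables (R : realType) (n : nat).
Notation mu := (@lebesgue_measure R).
Notation RR := (measurableTypeR R * measurableTypeR R)%type.
Notation T := ('I_n -> R[i]).
Implicit Types (F G : T -> \bar R) (K : T -> R) (z w : T) (k : nat).

Definition ccont K := forall z (e : R), 0 < e -> exists2 d : R, 0 < d &
  forall w, (forall i, cabs (w i - z i) < d) -> `|K w - K z| < e.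

Definition lscT G := forall z (a : R), (a%:E < G z)%E -> exists2 d : R, 0 < d &
  forall w, (forall i, cabs (w i - z i) < d) -> (a%:E < G w)%E.

Lemma ccont_lscT K : ccont K -> lscT (fun z => (K z)%:E).
Proof.
move=> cK z a; rewrite lte_fin => az.
have e0 : 0 < K z - a by rewrite subr_gt0.
have [d d0 Hd] := cK z _ e0; exists d => // w /Hd; rewrite lte_fin ltr_norml; lra.
Qed.

Lemma ccont_comp1 K (Z : R[i] -> T) : ccont K ->
  (forall (w : R[i]) (e : R), 0 < e -> exists2 d : R, 0 < d &
     forall w' : R[i], cabs (w' - w) < d -> forall i, cabs (Z w' i - Z w i) < e) ->
  ccont1 (fun w : R[i] => K (Z w)).
Proof.
move=> cK cZ w e e0; have [d d0 Hd] := cK (Z w) e e0.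
by have [d' d'0 Hd'] := cZ w d d0; exists d' => // w' /Hd'; exact: Hd.
Qed.

Lemma upd_dist z w k (a b : R[i]) (d : R) :
  (forall i, cabs (w i - z i) < d) -> cabs (a - b) < d ->
  forall i, cabs (upd w k a i - upd z k b i) < d.
Proof. by move=> wz ab i; rewrite /upd; case: ifP. Qed.

Lemma ccont_slice K z k : ccont K -> ccont1 (fun w : R[i] => K (upd z k w)).
Proof.
move=> cK; apply: ccont_comp1 => // w e e0; exists e => // w' ww' i.
by apply: upd_dist => // ?; rewrite subrr cabs0.
Qed.

Lemma lscT_slice G z k : lscT G -> lsc1 (fun w : R[i] => G (upd z k w)).
Proof.
move=> lG w a /lG[d d0 Hd]; exists d => // w' ww'; apply: Hd.
by apply: upd_dist => // ?; rewrite subrr cabs0.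
Qed.

Lemma lscT_measC G z k : lscT G -> measC (fun w : R[i] => G (upd z k w)).
Proof. by move=> lG; apply: lsc1_measC; exact: lscT_slice. Qed.

Local Open Scope ereal_scope.

Lemma ereal_dense (x y : \bar R) : x < y -> exists a : R, x < a%:E /\ a%:E < y.
Proof.
case: x y => [x| |] [y| |] //.
- by rewrite lte_fin => xy; exists ((x + y) / 2)%R; rewrite !lte_fin; split; lra.
- by move=> _; exists (x + 1)%R; rewrite lte_fin ltry; split => //; lra.
- by move=> _; exists (y - 1)%R; rewrite lte_fin ltNyr; split => //; lra.
- by move=> _; exists 0%R; rewrite ltry ltNyr.
Qed.

Lemma le_limn_einf (u : nat -> \bar R) (l : \bar R) :
  (forall a : R, a%:E < l -> \forall m \near \oo, a%:E <= u m) -> l <= limn_einf u.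
Proof.
move=> H; rewrite leNgt; apply/negP => ul.
have [a [la lb]] := ereal_dense ul.
suff : a%:E <= limn_einf u by rewrite leNgt la.
have [m0 _ Hm] := H a lb; rewrite limn_einf_lim.
apply: lime_ge; first exact: is_cvg_einfs.
near=> m; apply: le_ereal_inf_tmp => _ [i /= mi <-]; apply: Hm => /=.
by apply: leq_trans mi; near: m; exists m0.
Unshelve. all: by end_near. Qed.

Lemma limn_einf_le (u : nat -> \bar R) (a : \bar R) :
  (forall m, u m <= a) -> limn_einf u <= a.
Proof.
move=> ua; rewrite limn_einf_lim; apply: lime_le; first exact: is_cvg_einfs.
apply: nearW => m; apply: le_trans (ua m); apply: ereal_inf_lbound.
by exists m => /=.
Qed.

(** Continuity need not survive an integration that may be infinite; lower semicontinuity does. If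
    it failed at [z], points [zs m] tending to [z] would have integrals at most [a]; Fatou and
    semicontinuity of the integrand would then bound the integral at [z] by [a]. *)
Lemma lscT_intC G k : lscT G -> (forall z, 0 <= G z) ->
  lscT (fun z => intC (fun w : R[i] => G (upd z k w))).
Proof.
move=> lG G0 z a az; apply: contrapT => nd.
have /choice[zs zsP] : forall m : nat, exists w : T,
    (forall i, (cabs (w i - z i) < m.+1%:R^-1)%R) /\ intC (fun v : R[i] => G (upd w k v)) <= a%:E.
  move=> m; apply: contrapT => nw; apply: nd; exists (m.+1%:R^-1)%R.
    by rewrite invr_gt0.
  by move=> w wz; rewrite ltNge; apply/negP => wa; apply: nw; exists w.
suff : intC (fun w : R[i] => G (upd z k w)) <= a%:E by rewrite leNgt az.
have mz w : measC (fun v : R[i] => G (upd w k v)) by exact: lscT_measC.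
have {}zsP m : (forall i, (cabs (zs m i - z i) < m.+1%:R^-1)%R) /\
    \int[mu \x mu]_xy G (upd (zs m) k (Complex xy.1 xy.2)) <= a%:E.
  by have [h1 h2] := zsP m; split => //; rewrite -(@intCE _ (fun v => G (upd (zs m) k v))).
rewrite intCE//.
apply: le_trans (limn_einf_le (fun m => (zsP m).2)).
have mf m : measurable_fun [set: RR] (fun xy : RR => G (upd (zs m) k (Complex xy.1 xy.2))) by exact: mz.
have := @fatou _ RR R (mu \x mu) setT measurableT _ mf (fun m x _ => G0 _).
apply: le_trans; apply: (@ge0_le_integral_off_null _ _ _ _ set0) => //.
  move=> xy; apply: le_limn_einf => b b0; apply: nearW => m.
  by apply: le_trans (G0 _); exact: ltW.
move=> xy _; apply: le_limn_einf => b /lG[d d0 Hd].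
have [m0 m0d] : exists m0 : nat, (m0.+1%:R^-1 < d)%R.
  have [m0 _ /(_ m0 (leqnn _)) h] := near_infty_natSinv_lt (PosNum d0).
  by exists m0.
exists m0 => // m /= mm0; apply/ltW/Hd; apply: upd_dist; last by rewrite subrr cabs0.
move=> i; apply: lt_trans ((zsP m).1 i) _; apply: le_lt_trans m0d.
by rewrite lef_pV2 ?posrE// ler_nat.
Qed.

Lemma iterC_ge0 k G z : (forall z, 0 <= G z) -> 0 <= iterC k G z.
Proof. by move=> G0; elim: k z => //= k IH z; exact: intC_ge0. Qed.

Lemma iterC_lsc k G : lscT G -> (forall z, 0 <= G z) -> lscT (iterC k G).
Proof.
by move=> lG G0; elim: k => //= k IH; apply: lscT_intC => // z; exact: iterC_ge0.
Qed.

Lemma le_iterC k F G z : lscT F -> lscT G -> (forall z, 0 <= F z) ->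
  (forall z, F z <= G z) -> iterC k F z <= iterC k G z.
Proof.
move=> lF lG F0 FG; elim: k z => //= k IH z.
have G0 w : 0 <= G w by exact: le_trans (FG w).
apply: le_intC => //; [| |by move=> w; exact: iterC_ge0]; apply: lscT_measC; exact: iterC_lsc.
Qed.

Lemma iterCD k F G z : lscT F -> lscT G -> (forall z, 0 <= F z) ->
  (forall z, 0 <= G z) -> iterC k (fun z => F z + G z) z = iterC k F z + iterC k G z.
Proof.
move=> lF lG F0 G0; elim: k z => //= k IH z.
under [in LHS]eq_fun do rewrite IH.
apply: intCD; [apply: lscT_measC; exact: iterC_lsc..|by move=> w; exact: iterC_ge0|].
by move=> w; exact: iterC_ge0.
Qed.

Lemma iterCZ k (c : R) G z : (0 <= c)%R -> lscT G -> (forall z, 0 <= G z) ->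
  iterC k (fun z => c%:E * G z) z = c%:E * iterC k G z.
Proof.
move=> c0 lG G0; elim: k z => //= k IH z.
under [in LHS]eq_fun do rewrite IH.
apply: intCZl; [apply: lscT_measC; exact: iterC_lsc|by move=> w; exact: iterC_ge0|].
by rewrite lee_fin.
Qed.

(** Finiteness is assumed only at the given [z]: the next inner integrals are then finite on almost
    every slice, which is all [RintC_fineB] asks for. *)
Lemma RiterC_posneg k K z : ccont K ->
  iterC k (fun z => (Num.max (K z) 0)%:E) z < +oo ->
  iterC k (fun z => (Num.max (- K z) 0)%:E) z < +oo ->
  RiterC k K z = (fine (iterC k (fun z => (Num.max (K z) 0)%:E) z) -
                  fine (iterC k (fun z => (Num.max (- K z) 0)%:E) z))%R.
Proof.
move=> cK.
have p0 w : 0 <= (Num.max (K w) 0)%:E by rewrite lee_fin le_max lexx orbT.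
have n0 w : 0 <= (Num.max (- K w) 0)%:E by rewrite lee_fin le_max lexx orbT.
have lp : lscT (fun z => (Num.max (K z) 0)%:E).
  apply: ccont_lscT => w e e0; have [d d0 Hd] := cK w e e0; exists d => // w' /Hd.
  by rewrite !ltr_norml => ?; case: (leP (K w) 0%R); case: (leP (K w') 0%R); lra.
have ln : lscT (fun z => (Num.max (- K z) 0)%:E).
  apply: ccont_lscT => w e e0; have [d d0 Hd] := cK w e e0; exists d => // w' /Hd.
  by rewrite !ltr_norml => ?; case: (leP (- K w)%R 0%R); case: (leP (- K w')%R 0%R); lra.
elim: k z => [|k IH] z /=.
  by move=> _ _; case: (leP (K z) 0%R); case: (leP (- K z)%R 0%R); lra.
move=> i1 i2; apply: RintC_fineB => //.
- by apply: lscT_measC; exact: iterC_lsc.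
- by apply: lscT_measC; exact: iterC_lsc.
- by move=> w; exact: iterC_ge0.
- by move=> w; exact: iterC_ge0.
by move=> w _ ? ?; exact: IH.
Qed.

Lemma intC_gt0 (G : R[i] -> \bar R) (c d : R) (v : R[i]) : measC G ->
  (forall z : R[i], 0 <= G z) -> (0 < c)%R -> (0 < d)%R ->
  (forall z : R[i], (cabs (z - v) < d)%R -> c%:E <= G z) -> 0 < intC G.
Proof.
move=> mG G0 c0 d0 Gc; case: v Gc => a b Gc.
pose A := `](a - d / 2)%R, (a + d / 2)%R[%classic : set (measurableTypeR R).
pose B := `](b - d / 2)%R, (b + d / 2)%R[%classic : set (measurableTypeR R).
have lA : mu A = d%:E.
  rewrite lebesgue_measure_itv /= lte_fin ifT; last lra.
  by rewrite -EFinB; congr EFin; field.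
have lB : mu B = d%:E.
  rewrite lebesgue_measure_itv /= lte_fin ifT; last lra.
  by rewrite -EFinB; congr EFin; field.
have mA : measurable A by exact: measurable_itv.
have mB : measurable B by exact: measurable_itv.
have h x : A x -> (c * d)%:E <= \int[mu]_y G (Complex x y).
  rewrite /A /= in_itv /= => /andP[x1 x2].
  apply: (@le_trans _ _ (\int[mu]_(y in B) (cst c%:E) y)).
    by rewrite integral_cst// [X in _ * X](_ : _ = d%:E)//.
  rewrite [leLHS]integral_mkcond; apply: ge0_le_integral => //.
  - by move=> y _; rewrite patchE; case: ifP => // _; rewrite lee_fin ltW.
  - by apply/(measurable_restrictT _ _).1.
  - exact: measC_fiber.
  move=> y _; rewrite patchE; case: ifPn => [|_]; last exact: G0.
  rewrite inE /B /= in_itv /= => /andP[y1 y2]; apply: Gc.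
  apply: (le_lt_trans (cabs_le_ReIm _)); simpc => /=.
  have A1 : (`|x - a| < d / 2)%R by rewrite ltr_norml; lra.
  have A2 : (`|y - b| < d / 2)%R by rewrite ltr_norml; lra.
  lra.
apply: (@lt_le_trans _ _ (\int[mu]_(x in A) (cst (c * d)%:E) x)).
  by rewrite integral_cst// [X in _ * X](_ : _ = d%:E)// -EFinM lte_fin !mulr_gt0.
rewrite [leLHS]integral_mkcond; apply: ge0_le_integral => //.
- by move=> y _; rewrite patchE; case: ifP => // _; rewrite lee_fin ltW// mulr_gt0.
- by apply/(measurable_restrictT _ _).1.
- exact: measC_int.
by move=> x _; rewrite patchE; case: ifPn => [/set_mem/h//|_]; exact: integral_ge0.
Qed.

(** Positivity at the single point [z0] propagates: the partial integral is positive at the slice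
    through [z0], by semicontinuity it exceeds a positive constant nearby, and the next integral is
    positive. Only coordinates not yet integrated have to agree with [z0]. *)
Lemma iterC_gt0 k G z z0 : lscT G -> (forall z, 0 <= G z) -> 0 < G z0 ->
  (forall i : 'I_n, (k <= i)%N -> z i = z0 i) -> 0 < iterC k G z.
Proof.
move=> lG G0 Gz0; elim: k z => [|k IH] z zz0 /=.
  by have -> : z = z0 by apply/funext => i; exact: zz0.
(* For [k >= n] the default [0] is harmless, since [upd z k] then changes no coordinate. *)
pose v : R[i] := if insub k is Some i then z0 i else 0%R.
have : 0 < iterC k G (upd z k v).
  apply: IH => i ki; rewrite /upd; case: eqP => [ik|/eqP ik].
    by rewrite /v -ik valK.
  by apply: zz0; rewrite ltn_neqAle eq_sym ik.
move=> pos.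
have [c [c0 cl]] : exists c : R, (0 < c)%R /\ c%:E < iterC k G (upd z k v).
  by have [q [q1 q2]] := ereal_dense pos; exists q; rewrite -lte_fin.
have [d d0 Hd] := lscT_slice (iterC_lsc (k := k) lG G0) cl.
apply: (@intC_gt0 _ c d v) => //.
- by apply: lscT_measC; exact: iterC_lsc.
- by move=> w; exact: iterC_ge0.
- by move=> w /Hd /ltW.
Qed.

End IteratedIntegrals.

(** * Torus means and integrands with proportional circle means *)

Section TorusMean.
Variables (R : realType) (n : nat).
Notation mu := (@lebesgue_measure R).
Notation circ := (uniform_prob (twopi_gt0 R)).
Notation RR := (measurableTypeR R * measurableTypeR R)%type.
Notation T := ('I_n -> R[i]).
Implicit Types (K : T -> R) (z w : T) (k l : nat).

Lemma cis_near (s e : R) : 0 < e -> exists2 d : R, 0 < d &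
  forall t, `|t - s| < d -> cabs (cis t - cis s) < e.
Proof.
move=> e0; have e2 : 0 < e / 2 by lra.
have /cvgrPdist_lt /(_ _ e2) := @continuous_cos R s.
have /cvgrPdist_lt /(_ _ e2) := @continuous_sin R s.
move=> /nbhs_ballP[d1 /= d10 H1] /nbhs_ballP[d2 /= d20 H2].
exists (Num.min d1 d2); first by rewrite lt_min d10.
move=> t; rewrite lt_min => /andP[t1 t2]; apply: (le_lt_trans (cabs_le_ReIm _)).
have := H1 t; rewrite /ball /= distrC => /(_ t1); rewrite distrC => h1.
have := H2 t; rewrite /ball /= distrC => /(_ t2); rewrite distrC => h2.
by rewrite /cis; simpc => /=; lra.
Qed.

Lemma cis_mod (t : R) : exists2 s : R, - pi <= s <= pi & cis s = cis t.
Proof.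
have c1 : -1 <= cos t <= 1 by rewrite cos_geN1 cos_le1.
have h1 : cos (acos (cos t)) = cos t by apply: acosK; rewrite in_itv.
have h2 : sin (acos (cos t)) = `|sin t|.
  rewrite sin_acos// (_ : 1 - cos t ^+ 2 = sin t ^+ 2) ?sqrtr_sqr//.
  by have := cos2Dsin2 t; lra.
have a0 := acos_ge0 c1; have api := acos_lepi c1; have p0 := pi_ge0 R.
have [d0|d0] := leP 0 (sin t).
  by exists (acos (cos t)); rewrite ?/cis ?h1 ?h2 ?ger0_norm//; lra.
exists (- acos (cos t)); first lra.
by rewrite /cis cosN sinN h1 h2 ltr0_norm// opprK.
Qed.

(** Angles may be taken in the compact interval [[- pi, pi]], so the radius of continuity can be
    chosen uniformly along the circle. This is what makes circle means continuous in the remaining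
    variables. *)
Lemma ccont_circle_unif K k z (e : R) : ccont K -> 0 < e -> exists2 d : R, 0 < d &
  forall w, (forall i, cabs (w i - z i) < d) ->
  forall t, `|K (upd w k (cis t)) - K (upd z k (cis t))| < e.
Proof.
move=> cK e0.
have /compact_near_coveringP cpt := @segment_compact R (- pi) pi.
pose P (d t : R) := forall w, (forall i, cabs (w i - z i) < d) ->
  `|K (upd w k (cis t)) - K (upd z k (cis t))| < e.
have := cpt R 0^'+ P _ _; case.
  move=> s _; have e2 : 0 < e / 2 by lra.
  have [d d0 Hd] := cK (upd z k (cis s)) _ e2.
  have [d' d'0 Hd'] := cis_near s d0.
  exists ([set t | `|t - s| < d'], [set x | 0 < x < d]) => /=.
    split; first exact: nbhs_dist.
    by near=> x => /=; apply/andP; split; near: x; [exact: nbhs_right_gt|exact: nbhs_right_lt].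
  move=> [t x] /= [ts /andP[x0 xd]] w wz.
  have cts := Hd' t ts.
  have h1 : `|K (upd w k (cis t)) - K (upd z k (cis s))| < e / 2.
    by apply: Hd; apply: upd_dist => // i; apply: lt_trans xd.
  have h2 : `|K (upd z k (cis t)) - K (upd z k (cis s))| < e / 2.
    by apply: Hd; apply: upd_dist => // i; rewrite subrr cabs0.
  by move: h1 h2; rewrite !ltr_norml; lra.
move=> d /= d0 Hd; exists (d / 2); first lra.
move=> w wz t; have [s sp <-] := cis_mod t.
have d2 : 0 < d / 2 by lra.
have hd : `|0 - d / 2| < d by rewrite sub0r normrN gtr0_norm//; lra.
by apply: (Hd (d / 2) hd d2 s _ w wz); rewrite /= in_itv.
Unshelve. all: by end_near. Qed.

Definition updmean k K z := cmean (fun t => K (upd z k (cis t))).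

Lemma ccont1_cis (L : R[i] -> R) : ccont1 L -> continuous (fun t => L (cis t)).
Proof.
move=> cL; have := ccont1_circle (z := 1) cL.
by under eq_fun do rewrite mulr1.
Qed.

Lemma ccont_cis K z k : ccont K -> continuous (fun t => K (upd z k (cis t))).
Proof. by move=> cK; apply: (@ccont1_cis (fun v => K (upd z k v))); exact: ccont_slice. Qed.

Lemma ccont_updmean k K : ccont K -> ccont (updmean k K).
Proof.
move=> cK z e e0; have e2 : 0 < e / 2 by lra.
have [d d0 Hd] := ccont_circle_unif k z cK e2; exists d => // w /Hd {}Hd.
have cw := @ccont_cis _ w k cK; have cz := @ccont_cis _ z k cK.
have cc (c : R) : continuous (fun _ : R => c) by move=> ?; exact: cvg_cst.
have cwz (u v : R -> R) : continuous u -> continuous v -> continuous (fun t => u t + v t).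
  by move=> cu cv t; apply: cvgD; [exact: cu|exact: cv].
have h1 : updmean k K w <= updmean k K z + e / 2.
  rewrite -(cmean_cst (e / 2)) -cmeanD//; apply: le_cmean => // [|t]; first exact: cwz.
  by have := Hd t; rewrite ltr_norml; lra.
have h2 : updmean k K z <= updmean k K w + e / 2.
  rewrite -(cmean_cst (e / 2)) -cmeanD//; apply: le_cmean => // [|t]; first exact: cwz.
  by have := Hd t; rewrite ltr_norml; lra.
by rewrite ltr_norml; lra.
Qed.

(** Fubini for the product of two uniform laws. Continuity of the inner mean of [|u|] provides
    integrability on the product; [u] is read as a function of a complex number to inherit joint
    measurability from [ccont1_measC]. *)
Lemma cmean_swap (u : R -> R -> R) :
  ccont1 (fun v : R[i] => u (complex.Re v) (complex.Im v)) ->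
  continuous (fun s => cmean (fun t => `|u s t|)) ->
  cmean (fun s => cmean (u s)) = cmean (fun t => cmean (u^~ t)).
Proof.
move=> cu cn.
have cidR : continuous (fun t : R => t) by move=> t; exact: cvg_id.
have cc (c : R) : continuous (fun _ : R => c) by move=> ?; exact: cvg_cst.
have cs s : continuous (u s) by exact: (@ccont1_curve _ _ (fun t => Complex s t) cu (cc s) cidR).
have ct t : continuous (u^~ t) by exact: (@ccont1_curve _ _ (fun s => Complex s t) cu cidR (cc t)).
have cmE (v : R -> R) : continuous v -> (cmean v)%:E = (\int[circ]_t (v t)%:E)%E.
  by move=> cv; rewrite /cmean /Rintegral fineK//; apply: integrable_fin_num => //; exact: circ_integrable.
pose U (v : RR) := (u v.1 v.2)%:E.
have mU : measurable_fun [set: RR] U by exact: (ccont1_measC cu).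
have iU : (circ \x circ)%E.-integrable [set: RR] U.
  apply/(@integrable12ltyP _ _ _ _ _ circ circ _ mU) => /=.
  have /integrableP[_] := circ_integrable cn; apply: le_lt_trans.
  apply: (@le_trans _ _ (\int[circ]_s (cmean (fun t => `|u s t|))%:E)%E).
    rewrite le_eqVlt; apply/orP; left; apply/eqP; apply: eq_integral => s _.
    by rewrite cmE// => t; apply: cvg_norm; exact: cs.
  apply: ge0_le_integral => //.
  - by move=> s _; rewrite lee_fin; apply: Rintegral_ge0.
  - by apply/measurable_EFinP; exact: continuous_measurable_fun.
  - by apply: measurableT_comp => //; apply/measurable_EFinP; exact: continuous_measurable_fun.
  - by move=> s _ /=; rewrite lee_fin ler_norm.
have := Fubini iU; rewrite /U /= => H.
rewrite {1}/cmean /Rintegral; under eq_integral do rewrite cmE//.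
rewrite H [in RHS]/cmean /Rintegral; congr fine.
by apply: eq_integral => t _; rewrite cmE.
Qed.

Lemma upd_upd z k l (a b : R[i]) : k != l -> upd (upd z k a) l b = upd (upd z l b) k a.
Proof.
move=> kl; apply/funext => i; rewrite /upd; case: eqP => // il; case: eqP => // ik.
by move: kl; rewrite -ik -il eqxx.
Qed.

Lemma cmean_updmean k l K z (v : R[i]) : ccont K -> k != l ->
  cmean (fun s => updmean k K (upd z l (cis s * v))) =
  cmean (fun t => cmean (fun s => K (upd (upd z k (cis t)) l (cis s * v)))).
Proof.
move=> cK kl; rewrite /updmean.
rewrite (@cmean_swap (fun s t => K (upd (upd z l (cis s * v)) k (cis t)))).
- congr cmean; apply/funext => t; congr cmean; apply/funext => s.
  by rewrite upd_upd// eq_sym.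
- apply: ccont_comp1 => // w e e0.
  have m0 : 0 < e / (cabs v + 1) by rewrite divr_gt0//; have := cabs_ge0 v; lra.
  have [d1 d10 H1] := cis_near (complex.Re w) m0.
  have [d2 d20 H2] := cis_near (complex.Im w) e0.
  exists (Num.min d1 d2); first by rewrite lt_min d10.
  move=> w'; rewrite lt_min => /andP[h1 h2].
  have hr := cabs_Re (w' - w); have hi := cabs_Im (w' - w); rewrite ReB in hr; rewrite ImB in hi.
  apply: upd_dist; last by apply: H2; lra.
  apply: upd_dist; first by move=> i; rewrite subrr cabs0.
  rewrite -mulrBl cabsM.
  have h3 : cabs (cis (complex.Re w') - cis (complex.Re w)) < e / (cabs v + 1) by apply: H1; lra.
  have v0 := cabs_ge0 v; rewrite ltr_pdivlMr in h3; last lra.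
  by have := cabs_ge0 (cis (complex.Re w') - cis (complex.Re w)); nra.
- have ca : ccont (fun z => `|K z|).
    move=> w e e0; have [d d0 Hd] := cK w e e0; exists d => // w' /Hd.
    by apply: le_lt_trans; exact: ler_dist_dist.
  have := ccont1_circle (z := v) (@ccont_slice _ _ _ z l (@ccont_updmean k _ ca)).
  exact.
Qed.

(* [I k] is the integral of [q k]; on fibres with finite integral,
   [partial_mean] is the integral of [K] over the first [k] variables. *)
Fixpoint partial_mean (I : nat -> R) K k : T -> R :=
  if k is k'.+1 then fun z => I k' * updmean k' (partial_mean I K k') z else K.

(** The factor [q v] does not depend on the other variables [z]; this is why the property survives
    averaging over them. *)
Definition radial_in K (q : R[i] -> R) l := forall z (v : R[i]), v != 0 ->
  cmean (fun t => K (upd z l (cis t * v))) = q v * updmean l K z.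

Lemma ccontZ (c : R) K : ccont K -> ccont (fun z => c * K z).
Proof.
move=> cK z e e0; have c1 : 0 < `|c| + 1 by have := normr_ge0 c; lra.
have [d d0 Hd] := cK z _ (divr_gt0 e0 c1); exists d => // w /Hd.
rewrite ltr_pdivlMr// -mulrBr normrM => h.
by have := normr_ge0 (K w - K z); have := normr_ge0 c; nra.
Qed.

Lemma ccont_partial_mean I K k : ccont K -> ccont (partial_mean I K k).
Proof. by move=> cK; elim: k => //= k IH; apply: ccontZ; exact: ccont_updmean. Qed.

(** Circle means in different variables commute: the mean in [l] is moved inside, evaluated there by
    the induction hypothesis, and moved out again. The second exchange is on the unit circle,
    written as the circle through [v = 1]. *)
Lemma radial_partial_mean I K (q : nat -> R[i] -> R) k :
  ccont K -> (forall l, (l < n)%N -> radial_in K (q l) l) ->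
  forall l, (k <= l < n)%N -> radial_in (partial_mean I K k) (q l) l.
Proof.
move=> cK rK; elim: k => [|k IH] l /andP[kl ln]; first exact: rK.
move=> z v v0 /=.
have cP := @ccont_partial_mean I K k cK.
have cU := @ccont_updmean k _ cP.
have nkl : k != l by rewrite neq_ltn kl.
rewrite cmeanZ; last exact: (ccont1_circle (z := v) (@ccont_slice _ _ _ z l cU)).
rewrite cmean_updmean//.
have rk : radial_in (partial_mean I K k) (q l) l by apply: IH; rewrite (ltnW kl).
under eq_fun do rewrite rk//.
rewrite cmeanZ; last exact: (@ccont_cis _ z k (@ccont_updmean l _ cP)).
rewrite [in RHS]/updmean cmeanZ; last exact: (@ccont_cis _ z l cU).
rewrite mulrCA; congr (_ * (_ * _)); rewrite -/(updmean l (updmean k (partial_mean I K k)) z).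
have := @cmean_updmean k l _ z 1 cP nkl.
rewrite /updmean => E; rewrite [RHS](_ : _ = cmean (fun s =>
  cmean (fun t => partial_mean I K k (upd (upd z l (cis s * 1)) k (cis t))))).
  by rewrite E; congr cmean; apply/funext => t; congr cmean; apply/funext => s; rewrite mulr1.
by congr cmean; apply/funext => t; rewrite mulr1.
Qed.

Local Open Scope ereal_scope.

(** The partial mean is continuous everywhere, whereas the partial integrals of [Kp] and [Kn] may be
    infinite on some slices. The induction [main] equates them only where both are finite, and [iK]
    ensures this after all [n] steps. *)
Lemma RintCn_radial K (q : nat -> R[i] -> R) :
  ccont K -> intCn (fun z => `|K z|%:E) < +oo ->
  (forall l, (l < n)%N -> [/\ ccont1 (q l), forall v, (0 <= q l v)%R,
      intC (fun v => (q l v)%:E) < +oo & radial_in K (q l) l]) ->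
  RintCn K = partial_mean (fun l => fine (intC (fun v => (q l v)%:E))) K n (fun=> 0%R).
Proof.
move=> cK iK Hq; set I := fun l => _.
pose Kp z := (Num.max (K z) 0)%:E; pose Kn z := (Num.max (- K z) 0)%:E.
have p0 w : 0 <= Kp w by rewrite lee_fin le_max lexx orbT.
have n0 w : 0 <= Kn w by rewrite lee_fin le_max lexx orbT.
have lp : lscT Kp.
  apply: ccont_lscT => w e e0; have [d d0 Hd] := cK w e e0; exists d => // w' /Hd.
  by rewrite !ltr_norml => ?; case: (leP (K w) 0%R); case: (leP (K w') 0%R); lra.
have ln : lscT Kn.
  apply: ccont_lscT => w e e0; have [d d0 Hd] := cK w e e0; exists d => // w' /Hd.
  by rewrite !ltr_norml => ?; case: (leP (- K w)%R 0%R); case: (leP (- K w')%R 0%R); lra.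
have la : lscT (fun z => `|K z|%:E).
  apply: ccont_lscT => w e e0; have [d d0 Hd] := cK w e e0; exists d => // w' /Hd.
  by apply: le_lt_trans; exact: ler_dist_dist.
have main k : (k <= n)%N -> forall z, iterC k Kp z < +oo -> iterC k Kn z < +oo ->
    partial_mean I K k z = (fine (iterC k Kp z) - fine (iterC k Kn z))%R.
  elim: k => [|k IH] kn z.
    by move=> _ _ /=; case: (leP (K z) 0%R); case: (leP (- K z)%R 0%R); lra.
  have {}IH := IH (ltnW kn).
  move=> ip in_.
  have [cq q0 iq _] := Hq k kn.
  have cP := @ccont_partial_mean I K k cK.
  pose L v := partial_mean I K k (upd z k v).
  have mp : measC (fun v => iterC k Kp (upd z k v)) by apply: lscT_measC; exact: iterC_lsc.
  have mn : measC (fun v => iterC k Kn (upd z k v)) by apply: lscT_measC; exact: iterC_lsc.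
  have pp v : 0 <= iterC k Kp (upd z k v) by exact: iterC_ge0.
  have pn v : 0 <= iterC k Kn (upd z k v) by exact: iterC_ge0.
  have cL : ccont1 L by exact: ccont_slice.
  (* [|L|] is dominated by the sum of the two partial integrals: by the induction hypothesis where
     both are finite, and trivially where the sum is [+oo]. *)
  have iL : intC (fun v => `|L v|%:E) < +oo.
    apply: (@le_lt_trans _ _ (intC (fun v => iterC k Kp (upd z k v) + iterC k Kn (upd z k v)))).
      apply: le_intC.
      - apply: ccont1_measC => w e e0; have [d d0 Hd] := cL w e e0; exists d => // w' /Hd.
        by apply: le_lt_trans; exact: ler_dist_dist.
      - exact: emeasurable_funD.
      - by move=> v; rewrite lee_fin.
      move=> v; have := pp v; have := pn v; rewrite /L.
      have := IH (upd z k v).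
      case: (iterC k Kp (upd z k v)) => [a| |//]; case: (iterC k Kn (upd z k v)) => [b| |//].
      - rewrite !ltry !lee_fin => /(_ isT isT) -> b0 a0.
        by rewrite (le_trans (ler_normB _ _))// !ger0_norm.
      - by move=> _ _ _; rewrite addey// leey.
      - by move=> _ _ _; rewrite addye// leey.
      - by move=> _ _ _; rewrite addye// leey.
    have -> : intC (fun v => iterC k Kp (upd z k v) + iterC k Kn (upd z k v)) =
        intC (fun v => iterC k Kp (upd z k v)) + intC (fun v => iterC k Kn (upd z k v)).
      exact: (intCD mp mn pp pn).
    exact: (lte_add_pinfty ip in_).
  (* [RintC L] is evaluated in two ways: as a difference of partial integrals, and through circle
     means as the mass of [q k] times the unit circle mean. *)
  have <- : Defs.RintC L = (fine (iterC k.+1 Kp z) - fine (iterC k.+1 Kn z))%R.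
    by apply: (RintC_fineB mp mn pp pn ip in_) => v _ h1 h2; exact: IH.
  apply/esym; apply: (RintC_circle cL iL cq q0 iq) => v v0.
  have rK l : (l < n)%N -> radial_in K (q l) l by case/Hq.
  have kkn : (k <= k < n)%N by rewrite leqnn kn.
  exact: (@radial_partial_mean I K q k cK rK k kkn z v v0).
have fp : iterC n Kp (fun=> 0%R) < +oo.
  apply: le_lt_trans iK; apply: le_iterC => // w.
  by rewrite lee_fin ge_max ler_norm normr_ge0.
have fn : iterC n Kn (fun=> 0%R) < +oo.
  apply: le_lt_trans iK; apply: le_iterC => // w.
  by rewrite lee_fin ge_max -normrN ler_norm normr_ge0.
by rewrite main// /RintCn RiterC_posneg.
Qed.

End TorusMean.

(** * Continuity of the integrands *)

Section Continuity.
Variables (R : realType) (n : nat).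
Notation T := ('I_n -> R[i]).
Implicit Types (K L : T -> R) (z w : T) (F G : T -> R[i]).

Definition ccontC F := forall z (e : R), 0 < e -> exists2 d : R, 0 < d &
  forall w, (forall i, cabs (w i - z i) < d) -> cabs (F w - F z) < e.

Lemma ccontCM F G : ccontC F -> ccontC G -> ccontC (fun z => F z * G z).
Proof.
move=> cF cG z e e0.
have f0 := cabs_ge0 (F z); have g0 := cabs_ge0 (G z).
have e1 : 0 < e / 2 / (cabs (G z) + 1) by rewrite !divr_gt0//; lra.
have e2 : 0 < Num.min 1 (e / 2 / (cabs (F z) + 1)) by rewrite lt_min !divr_gt0//; lra.
have [d1 d10 H1] := cF z _ e1; have [d2 d20 H2] := cG z _ e2.
exists (Num.min d1 d2); first by rewrite lt_min d10.
move=> w Hw.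
have /H1 h1 : forall i, cabs (w i - z i) < d1 by move=> i; have := Hw i; rewrite lt_min => /andP[].
have /H2 : forall i, cabs (w i - z i) < d2 by move=> i; have := Hw i; rewrite lt_min => /andP[].
rewrite lt_min => /andP[h2 h3].
have -> : F w * G w - F z * G z = (F w - F z) * G w + F z * (G w - G z) by ring.
apply: (le_lt_trans (cabsD _ _)); rewrite !cabsM.
have gw : cabs (G w) <= cabs (G z) + 1.
  by have := cabsD (G w - G z) (G z); rewrite subrK; lra.
rewrite ltr_pdivlMr in h1; last lra.
rewrite ltr_pdivlMr in h3; last lra.
have a0 := cabs_ge0 (F w - F z); have b0 := cabs_ge0 (G w - G z).
have A : cabs (F w - F z) * cabs (G w) <= cabs (F w - F z) * (cabs (G z) + 1) by rewrite ler_wpM2l.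
have B : cabs (F z) * cabs (G w - G z) <= cabs (G w - G z) * (cabs (F z) + 1).
  by rewrite mulrC ler_wpM2l//; lra.
lra.
Qed.

Lemma ccontCD F G : ccontC F -> ccontC G -> ccontC (fun z => F z + G z).
Proof.
move=> cF cG z e e0; have e2 : 0 < e / 2 by lra.
have [d1 d10 H1] := cF z _ e2; have [d2 d20 H2] := cG z _ e2.
exists (Num.min d1 d2); first by rewrite lt_min d10.
move=> w Hw.
have /H1 h1 : forall i, cabs (w i - z i) < d1 by move=> i; have := Hw i; rewrite lt_min => /andP[].
have /H2 h2 : forall i, cabs (w i - z i) < d2 by move=> i; have := Hw i; rewrite lt_min => /andP[].
have -> : F w + G w - (F z + G z) = (F w - F z) + (G w - G z) by ring.
by apply: (le_lt_trans (cabsD _ _)); lra.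
Qed.

Lemma ccontC_cst (c : R[i]) : ccontC (fun=> c).
Proof. by move=> z e e0; exists 1 => // w _; rewrite subrr cabs0. Qed.

Lemma ccontC_conj F : ccontC F -> ccontC (fun z => cconj (F z)).
Proof.
move=> cF z e e0; have [d d0 H] := cF z e e0; exists d => // w /H.
have -> : cconj (F w) - cconj (F z) = cconj (F w - F z).
  by case: (F w) => a b; case: (F z) => c d'; rewrite /cconj; simpc => /=; congr Complex; ring.
by rewrite cabs_conj.
Qed.

Lemma ccontC_real K : ccont K -> ccontC (fun z => (K z)%:C%C).
Proof.
move=> cK z e e0; have [d d0 H] := cK z e e0; exists d => // w /H.
rewrite -rmorphB /= => h; apply: le_lt_trans h; apply: (le_trans (cabs_le_ReIm _)).
by rewrite /= normr0 addr0.
Qed.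

Lemma ccontC_coord (i : 'I_n) : ccontC (fun z => z i).
Proof. by move=> z e e0; exists e => // w /(_ i). Qed.

Lemma ccontC_monom (j : 'I_n -> nat) : ccontC (monom j).
Proof.
rewrite /monom; elim: (index_enum _) => [|i r IH].
  by under eq_fun do rewrite big_nil; exact: ccontC_cst.
under eq_fun do rewrite big_cons.
apply: ccontCM => //; elim: (j i) => [|m IHm].
  by under eq_fun do rewrite expr0; exact: ccontC_cst.
by under eq_fun do rewrite exprS; apply: ccontCM => //; exact: ccontC_coord.
Qed.

Lemma ccont_Re F : ccontC F -> ccont (fun z => complex.Re (F z)).
Proof.
move=> cF z e e0; have [d d0 H] := cF z e e0; exists d => // w /H.
by apply: le_lt_trans; rewrite -ReB; exact: cabs_Re.
Qed.

Lemma ccont_cabs F : ccontC F -> ccont (fun z => cabs (F z)).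
Proof.
move=> cF z e e0; have [d d0 H] := cF z e e0; exists d => // w /H.
by apply: le_lt_trans; exact: cabs_dist.
Qed.

Lemma ccontM K L : ccont K -> ccont L -> ccont (fun z => K z * L z).
Proof.
move=> cK cL.
have := ccont_Re (ccontCM (ccontC_real cK) (ccontC_real cL)).
by congr ccont; apply/funext => z /=; rewrite !mul0r subr0.
Qed.

Lemma ccontD K L : ccont K -> ccont L -> ccont (fun z => K z + L z).
Proof.
move=> cK cL.
by have := ccont_Re (ccontCD (ccontC_real cK) (ccontC_real cL)).
Qed.

Lemma ccont_cst (c : R) : ccont (fun _ : T => c).
Proof. by move=> z e e0; exists 1 => // w _; rewrite subrr normr0. Qed.

Lemma ccont_comp (g : R -> R) K : continuous g -> ccont K -> ccont (fun z => g (K z)).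
Proof.
move=> cg cK z e e0; have /cvgrPdist_lt /(_ _ e0) := cg (K z).
move=> /nbhs_ballP[d /= d0 H]; have [d' d'0 H'] := cK z d d0.
by exists d' => // w /H' h; rewrite distrC; apply: H; rewrite /ball /= distrC.
Qed.

Lemma ccont_sqnorm : ccont (@sqnorm R n).
Proof.
rewrite /sqnorm; elim: (index_enum _) => [|i r IH].
  by under eq_fun do rewrite big_nil; exact: ccont_cst.
under eq_fun do rewrite big_cons.
apply: ccontD => //; under eq_fun do rewrite expr2.
by apply: ccontM; apply: ccont_cabs; exact: ccontC_coord.
Qed.

(** At [y = 0], where [s > 0], the radius is [e^(1/s)]. At [y > 0] the power is [expR (s * ln x)],
    and [s] may be negative. *)
Lemma powR_near (y s e : R) : 0 <= y -> 0 < s \/ 0 < y -> 0 < e -> exists2 d : R, 0 < d &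
  forall x, 0 <= x -> `|x - y| < d -> `|x `^ s - y `^ s| < e.
Proof.
move=> y0 sy e0; have [y_eq0|yn0] := eqVneq y 0.
  move: sy; rewrite y_eq0 ltxx => -[s0|//].
  exists (e `^ s^-1); first exact: powR_gt0.
  move=> x x0; rewrite subr0 ger0_norm// powR0 ?gt_eqF// subr0 ger0_norm ?powR_ge0// => xe.
  have := @gt0_ltr_powR _ s s0 x (e `^ s^-1); rewrite !nnegrE powR_ge0 => /(_ x0 isT xe).
  by rewrite -powRrM mulVf ?gt_eqF// powRr1// ltW.
have yp : 0 < y by rewrite lt_def yn0.
have cg : {for y, continuous (fun x => expR (s * ln x))}.
  apply: (@continuous_comp _ _ _ (fun x => s * ln x) expR); last exact: continuous_expR.
  by apply: cvgM; [exact: cvg_cst|exact: continuous_ln].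
have /cvgrPdist_lt /(_ _ e0) := cg.
move=> /nbhs_ballP[d /= d0 H]; exists (Num.min d y); first by rewrite lt_min d0.
move=> x x0; rewrite lt_min => /andP[xd xy].
have xp : 0 < x by move: xy; rewrite ltr_norml; lra.
have := H x; rewrite /ball /= distrC => /(_ xd).
by rewrite /powR !gt_eqF// distrC.
Qed.

Lemma ccont_powR K (s : R) : 0 < s -> (forall z, 0 <= K z) -> ccont K ->
  ccont (fun z => K z `^ s).
Proof.
move=> s0 K0 cK z e e0; have [d d0 H] := powR_near (K0 z) (or_introl s0) e0.
by have [d' d'0 H'] := cK z d d0; exists d' => // w /H'; exact: H.
Qed.

(* [t > -1] may be negative: the factor [X = O(Y)] then restores continuity
   where [Y] vanishes. *)
Lemma ccont_mul_powR (X Y B : T -> R) (t : R) : -1 < t ->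
  ccont X -> ccont Y -> ccont B -> (forall z, 0 <= Y z) ->
  (forall z, `|X z| <= B z * Y z) -> ccont (fun z => X z * Y z `^ t).
Proof.
move=> t1 cX cY cB Y0 XY z.
have [Yz|Yn] := eqVneq (Y z) 0.
  have X0 w : Y w = 0 -> X w = 0.
    by move=> Yw; have := XY w; rewrite Yw mulr0 normr_le0 => /eqP.
  have t10 : 0 < 1 + t by lra.
  have B0 w : Y w != 0 -> 0 <= B w.
    by move=> Yw; rewrite -(@pmulr_lge0 _ (Y w)) ?lt_def ?Yw ?Y0//; exact: le_trans (XY w).
  have := ccontM cB (ccont_powR t10 Y0 cY); rewrite /ccont => /(_ z) H e e0.
  have [d d0 Hd] := H e e0; exists d => // w /Hd.
  rewrite Yz powR0 ?gt_eqF// mulr0 subr0 (X0 z Yz) mul0r subr0.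
  have [Yw|Yw] := eqVneq (Y w) 0; first by rewrite (X0 w Yw) mul0r normr0.
  apply: le_lt_trans; have := B0 w Yw => Bw.
  rewrite [leRHS]ger0_norm ?mulr_ge0 ?powR_ge0// normrM (ger0_norm (powR_ge0 _ _)).
  rewrite powRD ?Yw ?implybT// powRr1// mulrA ler_wpM2r ?powR_ge0//.
have Yp : 0 < Y z by rewrite lt_def Yn Y0.
have cP : forall e : R, 0 < e -> exists2 d : R, 0 < d &
    forall w, (forall i, cabs (w i - z i) < d) -> `|Y w `^ t - Y z `^ t| < e.
  move=> e e0; have [d d0 H] := powR_near (Y0 z) (or_intror Yp) (s := t) e0.
  by have [d' d'0 H'] := cY z d d0; exists d' => // w /H'; exact: H.
move=> e e0.
have e1 : 0 < e / 2 / (Y z `^ t + 1).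
  by rewrite !divr_gt0//; have := powR_ge0 (Y z) t; lra.
have e2 : 0 < Num.min 1 (e / 2 / (`|X z| + 1)).
  by rewrite lt_min !divr_gt0//; have := normr_ge0 (X z); lra.
have [d1 d10 H1] := cX z _ e1; have [d2 d20 H2] := cP _ e2.
exists (Num.min d1 d2); first by rewrite lt_min d10.
move=> w Hw.
have /H1 h1 : forall i, cabs (w i - z i) < d1 by move=> i; have := Hw i; rewrite lt_min => /andP[].
have /H2 : forall i, cabs (w i - z i) < d2 by move=> i; have := Hw i; rewrite lt_min => /andP[].
rewrite lt_min => /andP[h2 h3].
have p0 := powR_ge0 (Y z) t; have x0 := normr_ge0 (X z).
rewrite ltr_pdivlMr in h1; last lra.
rewrite ltr_pdivlMr in h3; last lra.
have -> : X w * Y w `^ t - X z * Y z `^ t = (X w - X z) * Y w `^ t + X z * (Y w `^ t - Y z `^ t) by ring.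
apply: (le_lt_trans (ler_normD _ _)); rewrite !normrM (ger0_norm (powR_ge0 _ _)).
have yw : Y w `^ t <= Y z `^ t + 1 by move: h2; rewrite ltr_norml; lra.
have A : `|X w - X z| * Y w `^ t <= `|X w - X z| * (Y z `^ t + 1) by rewrite ler_wpM2l.
have B' : `|X z| * `|Y w `^ t - Y z `^ t| <= `|Y w `^ t - Y z `^ t| * (`|X z| + 1).
  by rewrite mulrC ler_wpM2l//; lra.
lra.
Qed.

End Continuity.

(** * Algebra of the torus mean *)

Section TorusMeanAlgebra.
Variables (R : realType) (n : nat).
Notation T := ('I_n -> R[i]).
Implicit Types (K L : T -> R) (z w : T).

(** With all masses equal to [1], [partial_mean] over the [n] variables is the mean over the unit
    torus; every coordinate of the base point gets overwritten. *)
Definition tmean K : R := partial_mean (fun=> 1) K n (fun=> 0).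

Lemma partial_mean_scale (I : nat -> R) K k z : ccont K ->
  partial_mean I K k z = (\prod_(l < k) I l) * partial_mean (fun=> 1) K k z.
Proof.
move=> cK; elim: k z => [|k IH] z /=; first by rewrite big_ord0 mul1r.
rewrite big_ord_recr /= mul1r -mulrA mulrCA; congr (_ * _).
have -> : partial_mean I K k = (fun z => (\prod_(l < k) I l) * partial_mean (fun=> 1) K k z).
  by apply/funext.
rewrite /updmean cmeanZ//; apply: ccont_cis; exact: ccont_partial_mean.
Qed.

Lemma tmean_lin (a b : R) K L : ccont K -> ccont L ->
  tmean (fun z => a * K z + b * L z) = a * tmean K + b * tmean L.
Proof.
move=> cK cL; rewrite /tmean.
suff H k z : partial_mean (fun=> 1) (fun z => a * K z + b * L z) k z =
    a * partial_mean (fun=> 1) K k z + b * partial_mean (fun=> 1) L k z by exact: H.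
elim: k z => [//|k IH] z /=; rewrite !mul1r /updmean.
under eq_fun do rewrite IH.
have cu := @ccont_cis _ _ _ z k (@ccont_partial_mean _ _ (fun=> 1) K k cK).
have cv := @ccont_cis _ _ _ z k (@ccont_partial_mean _ _ (fun=> 1) L k cL).
have cZ (c : R) (u : R -> R) : continuous u -> continuous (fun t => c * u t).
  by move=> c' t; apply: cvgM; [exact: cvg_cst|exact: c'].
by rewrite cmeanD ?cmeanZ//; exact: cZ.
Qed.

Lemma tmean_ext K L : (forall z, (forall i, cabs (z i) = 1) -> K z = L z) ->
  tmean K = tmean L.
Proof.
move=> KL; rewrite /tmean.
(* The first [k] coordinates are overwritten by the means, so the induction constrains only the
   later ones. *)
suff H k z : (forall i : 'I_n, (k <= i)%N -> cabs (z i) = 1) ->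
    partial_mean (fun=> 1) K k z = partial_mean (fun=> 1) L k z.
  by apply: H => i; rewrite leqNgt ltn_ord.
elim: k z => [|k IH] z zk /=; first by apply: KL => i; exact: zk.
congr (_ * _); rewrite /updmean; congr cmean; apply/funext => t; apply: IH => i ki.
rewrite /upd; case: eqP => [_|/eqP ik]; first exact: cabs_cis.
by apply: zk; rewrite ltn_neqAle eq_sym ik.
Qed.

Lemma tmean_cst (c : R) : tmean (fun=> c) = c.
Proof.
rewrite /tmean; suff H k z : partial_mean (fun=> 1) (fun _ : T => c) k z = c by exact: H.
by elim: k z => //= k IH z; rewrite mul1r /updmean; under eq_fun do rewrite IH; rewrite cmean_cst.
Qed.

End TorusMeanAlgebra.

(** * Monomials are integrable against Gaussians *)

Section Gaussian.
Variable R : realType.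
Notation mu := (@lebesgue_measure R).

Lemma integral_gauss_lty (b : R) : 0 < b ->
  (\int[mu]_x (expR (- (b * x ^+ 2)))%:E < +oo)%E.
Proof.
(* The standard deviation for which the centred normal density is a multiple of [exp (- b x^2)]; its
   total mass is [1]. *)
move=> b0; pose s := Num.sqrt ((b *+ 2)^-1).
have b20 : 0 < (b *+ 2)^-1 by rewrite invr_gt0 pmulrn_lgt0.
have s0 : s != 0 by rewrite gt_eqF// sqrtr_gt0.
have s2 : s ^+ 2 *+ 2 = b^-1.
  rewrite sqr_sqrtr; last exact: ltW.
  by rewrite -mulr_natl -[b *+ 2]mulr_natl invfM mulrA divff ?mul1r// pnatr_eq0.
have pk := normal_peak_gt0 s0.
have E x : (expR (- (b * x ^+ 2)))%:E = ((normal_peak s)^-1%:E * (normal_pdf 0 s x)%:E)%E.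
  have -> : normal_pdf 0 s x = normal_peak s * normal_fun 0 s x by rewrite normal_pdfE.
  rewrite /normal_fun s2 invrK subr0 -EFinM mulKf ?gt_eqF//.
  by rewrite mulNr mulrC.
under eq_integral do rewrite E.
rewrite ge0_integralZl//.
- by rewrite integral_normal_pdf mule1 ltry.
- by apply/measurable_EFinP; exact: measurable_normal_pdf.
- by move=> x _; rewrite lee_fin normal_pdf_ge0.
- by rewrite lee_fin invr_ge0 ltW.
Qed.

Lemma intC_gauss_lty (b : R) : 0 < b ->
  (intC (fun v : R[i] => (expR (- (b * cabs v ^+ 2)))%:E) < +oo)%E.
Proof.
move=> b0; have L := integral_gauss_lty b0.
set c := (\int[mu]_x _)%E in L.
have c0 : (0 <= c)%E by apply: integral_ge0 => x _; rewrite lee_fin expR_ge0.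
have cf : c \is a fin_num by rewrite ge0_fin_numE.
have mg : measurable_fun [set: measurableTypeR R] (fun x => (expR (- (b * x ^+ 2)))%:E).
  apply/measurable_EFinP; apply: measurableT_comp => //; apply: measurableT_comp => //.
  by apply: measurable_funM => //; exact: measurable_funX.
have E x y : (expR (- (b * cabs (Complex x y) ^+ 2)))%:E = ((expR (- (b * x ^+ 2)))%:E * (expR (- (b * y ^+ 2)))%:E)%E.
  by rewrite cabs_sqr /= mulrDr opprD expRD -EFinM.
have g0 x : (0 <= (expR (- (b * x ^+ 2)))%:E)%E by rewrite lee_fin expR_ge0.
have -> : intC (fun v : R[i] => (expR (- (b * cabs v ^+ 2)))%:E) = (c * c)%E.
  rewrite /intC; transitivity (\int[mu]_x ((expR (- (b * x ^+ 2)))%:E * c))%E.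
    apply: eq_integral => x _; under eq_integral do rewrite E.
    by rewrite ge0_integralZl.
  by rewrite ge0_integralZr.
by rewrite lte_mul_pinfty.
Qed.

Variable n : nat.
Notation T := ('I_n -> R[i]).

Lemma ccont_gauss (b : R) : ccont (fun z : T => expR (- (b * sqnorm z))).
Proof.
apply: (@ccont_comp _ _ (fun x => expR (- x))).
  move=> x; apply: (@continuous_comp _ _ _ (fun x => - x) expR); last exact: continuous_expR.
  exact: opp_continuous.
exact: ccontZ (@ccont_sqnorm R n).
Qed.

Lemma intCn_gauss_lty (b : R) : 0 < b ->
  (intCn (fun z : T => (expR (- (b * sqnorm z)))%:E) < +oo)%E.
Proof.
move=> b0; have L := intC_gauss_lty b0.
set g := intC _ in L.
have g0 : (0 <= g)%E by apply: intC_ge0 => v; rewrite lee_fin expR_ge0.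
have gE : g = (fine g)%:E by rewrite fineK// ge0_fin_numE.
have mg : measC (fun v : R[i] => (expR (- (b * cabs v ^+ 2)))%:E).
  apply: ccont1_measC.
  apply: (@ccont_comp1 _ 1 (fun z => expR (- (b * cabs (z ord0) ^+ 2))) (fun v _ => v)).
    apply: (@ccont_comp _ _ (fun x : R => expR (- (b * x ^+ 2)))); last exact/ccont_cabs/ccontC_coord.
    move=> x; apply: (@continuous_comp R R R (fun x => - (b * x ^+ 2)) expR); last exact: continuous_expR.
    apply: cvgN; apply: cvgM; [exact: cvg_cst|exact: exprn_continuous].
  by move=> w e e0; exists e.
(* The exact value after [k] integrations: the Gaussian of the remaining coordinates times the
   [k]-th power of the one-variable integral. *)
have H k : (k <= n)%N -> forall z : T, iterC k (fun z : T => (expR (- (b * sqnorm z)))%:E) z =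
    (fine g ^+ k * expR (- (b * \sum_(i < n | (k <= i)%N) cabs (z i) ^+ 2)))%:E.
  elim: k => [|k IH] kn z /=; first by rewrite expr0 mul1r.
  pose i0 := Ordinal kn.
  have S v : \sum_(i < n | (k <= i)%N) cabs (upd z k v i) ^+ 2 =
      cabs v ^+ 2 + \sum_(i < n | (k < i)%N) cabs (z i) ^+ 2.
    rewrite (bigD1 i0) //= /upd /= eqxx; congr (_ + _).
    apply: eq_big => [i|i].
      by rewrite ltn_neqAle andbC eq_sym.
    by move=> /andP[_]; rewrite -val_eqE /= => /negbTE ->.
  set C := fine g ^+ k * expR (- (b * \sum_(i < n | (k < i)%N) cabs (z i) ^+ 2)).
  have C0 : 0 <= C by rewrite mulr_ge0 ?expR_ge0// exprn_ge0// fine_ge0.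
  have -> : (fun w : R[i] => iterC k (fun z : T => (expR (- (b * sqnorm z)))%:E) (upd z k w)) =
      (fun v : R[i] => C%:E * (expR (- (b * cabs v ^+ 2)))%:E)%E.
    apply/funext => v; rewrite (IH (ltnW kn)) S mulrDr opprD expRD -EFinM; congr EFin.
    by rewrite /C; ring.
  rewrite intCZl// (_ : intC _ = (fine g)%:E)// -EFinM; congr EFin.
  by rewrite /C exprS; ring.
by rewrite /intCn H// ltry.
Qed.

Lemma expR_powR (x s : R) : expR x `^ s = expR (s * x).
Proof. by rewrite /powR gt_eqF ?expR_gt0// expRK. Qed.

(** The Gaussian splits over the coordinates, so each factor can be treated alone. From
    [1 + y <= exp y] and [x <= 1 + x^2] one gets [x <= (1 + 1/D) exp (D x^2)]. Raised to the powers
    [m] and [s], this costs the exponent [s m D], which the choice of [D] keeps below [b]. *)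
Lemma monom_gauss_bound (j : 'I_n -> nat) (s b : R) : 0 <= s -> 0 < b ->
  exists2 C : R, 0 <= C & forall z : T, cabs (monom j z) `^ s <= C * expR (b * sqnorm z).
Proof.
move=> s0 b0; rewrite /monom /sqnorm; elim: (index_enum _) => [|i r [C C0 IH]].
  by exists 1 => // z; rewrite !big_nil cabs1 powR1 mulr0 expR0 mulr1.
pose m := j i; pose D : R := b / (m%:R * s + 1).
have ms : 0 < m%:R * s + 1 by rewrite ltr_wpDl// mulr_ge0.
have D0 : 0 < D by rewrite divr_gt0.
have mDs : s * (m%:R * D) <= b.
  rewrite (_ : s * (m%:R * D) = b * (m%:R * s / (m%:R * s + 1))); last by rewrite /D; ring.
  by rewrite ler_piMr ?(ltW b0)// ler_pdivrMr// mul1r lerDl.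
have bd (x : R) : 0 <= x -> (x ^+ m) `^ s <= ((1 + D^-1) ^+ m) `^ s * expR (b * x ^+ 2).
  move=> x0; have x1 : x <= (1 + D^-1) * expR (D * x ^+ 2).
    have e1 : 1 + D * x ^+ 2 <= expR (D * x ^+ 2) by exact: expR_ge1Dx.
    apply: (@le_trans _ _ ((1 + D^-1) * (1 + D * x ^+ 2))).
      have -> : (1 + D^-1) * (1 + D * x ^+ 2) = 1 + D^-1 + D * x ^+ 2 + x ^+ 2 by field; rewrite gt_eqF.
      have := sqr_ge0 (x - 1); have Di : 0 < D^-1 by rewrite invr_gt0.
      have : 0 <= D * x ^+ 2 by rewrite mulr_ge0 ?sqr_ge0// ltW.
      have := sqr_ge0 x; rewrite sqrrB mulr1 expr1n; lra.
    by rewrite ler_wpM2l// addr_ge0// invr_ge0 ltW.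
  have C10 : 0 <= 1 + D^-1 by rewrite addr_ge0// invr_ge0 ltW.
  apply: (@le_trans _ _ ((((1 + D^-1) * expR (D * x ^+ 2)) ^+ m) `^ s)).
    apply: ge0_ler_powR => //; rewrite ?nnegrE ?exprn_ge0// ?mulr_ge0 ?expR_ge0//.
    by apply: lerXn2r; rewrite ?nnegrE// mulr_ge0// expR_ge0.
  rewrite exprMn powRM ?exprn_ge0 ?expR_ge0//; apply: ler_wpM2l; first exact: powR_ge0.
  rewrite -expRM_natl expR_powR ler_expR.
  rewrite mulrA mulrA -[s * m%:R * D]mulrA; apply: ler_wpM2r => //; exact: sqr_ge0.
exists (((1 + D^-1) ^+ m) `^ s * C); first by rewrite mulr_ge0 ?powR_ge0.
move=> z; rewrite !big_cons cabsM powRM ?cabs_ge0// mulrDr expRD mulrACA cabsX.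
by apply: ler_pM; rewrite ?powR_ge0 ?bd ?cabs_ge0.
Qed.

(** Half of the Gaussian exponent absorbs the monomial, and the other half is integrated. *)
Lemma monom_gauss_lty (j : 'I_n -> nat) (s b A : R) : 0 < s -> 0 < b -> 0 <= A ->
  (intCn (fun z : T => (cabs (monom j z) `^ s * (A * expR (- (b * sqnorm z))))%:E) < +oo)%E.
Proof.
move=> s0 b0 A0; have b20 : 0 < b / 2 by lra.
have [C C0 HC] := monom_gauss_bound j (ltW s0) b20.
have cg := @ccont_gauss (b / 2).
apply: (@le_lt_trans _ _ (intCn (fun z : T => ((C * A)%:E * (expR (- (b / 2 * sqnorm z)))%:E)%E))).
  apply: le_iterC.
  - apply: ccont_lscT; apply: ccontM; last exact: ccontZ (@ccont_gauss b).
    apply: ccont_powR => // [z|]; first exact: cabs_ge0.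
    exact/ccont_cabs/ccontC_monom.
  - by apply: (@ccont_lscT _ _ (fun z => (C * A) * expR (- (b / 2 * sqnorm z)))); exact: ccontZ cg.
  - by move=> z; rewrite lee_fin mulr_ge0 ?powR_ge0// mulr_ge0 ?expR_ge0.
  - move=> z; rewrite -EFinM lee_fin.
    have -> : C * A * expR (- (b / 2 * sqnorm z)) = (C * expR (b / 2 * sqnorm z)) * (A * expR (- (b * sqnorm z))).
      by rewrite mulrACA -expRD; congr (_ * expR _); field.
    by apply: ler_wpM2r; rewrite ?mulr_ge0 ?expR_ge0.
rewrite /intCn iterCZ ?mulr_ge0//; last exact: ccont_lscT.
apply: lte_mul_pinfty; rewrite ?lee_fin ?mulr_ge0//.
exact: intCn_gauss_lty.
Qed.

End Gaussian.

(** * The kernel attached to a monomial and its integral *)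

Section MonomialKernel.
Variables (R : realType) (n : nat) (j : 'I_n -> nat).
Notation T := ('I_n -> R[i]).
Implicit Types (F : T -> R[i]) (z : T).

Definition holo F := ccontC F /\ forall z (k : 'I_n) (v : R[i]),
  exists L, cdiff (fun u => F (upd z k u)) v L.

(** One family covers both integrals of the argument: [t = 0], [b = a] is the inner product with
    [h], while [t = p - 2], [b = a p / 2] is the linear term of the convexity inequality. *)
Definition kern F (t A b : R) z : R :=
  complex.Re (F z * cconj (monom j z)) * cabs (monom j z) `^ t *
  (A * expR (- (b * sqnorm z))).

(** The factor [expR b] normalises the weight to [1] on the unit circle, as [radial_in] requires. In
    the exponent, [2] comes from [conj U = |U|^2 / U] for [U = v^m] and [t] from the weight
    [|h|^t]. *)
Definition radial_weight (t b : R) (m : nat) (v : R[i]) : R :=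
  cabs (v ^+ m) `^ (2 + t) * (expR b * expR (- (b * cabs v ^+ 2))).

Lemma ccont_kern F (t A b : R) : -1 < t -> ccontC F -> ccont (kern F t A b).
Proof.
move=> t1 cF; apply: ccontM; last exact: ccontZ (@ccont_gauss R n b).
have ch := @ccontC_monom R n j.
apply: (@ccont_mul_powR _ _ _ _ (fun z => cabs (F z))) => //.
- by apply: ccont_Re; apply: ccontCM => //; exact: ccontC_conj.
- exact: ccont_cabs.
- exact: ccont_cabs.
- by move=> z; exact: cabs_ge0.
- by move=> z; apply: le_trans (cabs_Re _) _; rewrite cabsM cabs_conj.
Qed.

Lemma monom_upd z (i : 'I_n) (u : R[i]) :
  monom j (upd z i u) = u ^+ j i * \prod_(k < n | k != i) z k ^+ j k.
Proof.
rewrite /monom (bigD1 i)//= {1}/upd eqxx; congr (_ * _).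
by apply: eq_bigr => k ki; rewrite /upd (_ : (nat_of_ord k == i) = (k == i))// (negbTE ki).
Qed.

Lemma sqnorm_upd z (i : 'I_n) (u : R[i]) :
  sqnorm (upd z i u) = cabs u ^+ 2 + \sum_(k < n | k != i) cabs (z k) ^+ 2.
Proof.
rewrite /sqnorm (bigD1 i)//= {1}/upd eqxx; congr (_ + _).
by apply: eq_bigr => k ki; rewrite /upd (_ : (nat_of_ord k == i) = (k == i))// (negbTE ki).
Qed.

Lemma kern_upd F (t A b : R) z (i : 'I_n) : exists B : R[i], forall u : R[i], u != 0 ->
  kern F t A b (upd z i u) =
  cabs (u ^+ j i) `^ (2 + t) * expR (- (b * cabs u ^+ 2)) *
  complex.Re (B * F (upd z i u) * u ^- j i).
Proof.
pose h := \prod_(k < n | k != i) z k ^+ j k.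
pose S := \sum_(k < n | k != i) cabs (z k) ^+ 2.
pose r : R := cabs h `^ t * (A * expR (- (b * S))).
exists (cconj h * r%:C%C) => u u0.
rewrite /kern monom_upd sqnorm_upd -/h -/S; set f := F _; set U := u ^+ j i.
have U0 : U != 0 by rewrite expf_neq0.
have X0 : 0 < cabs U by rewrite cabs_gt0.
have -> : cconj (U * h) = (cabs U ^+ 2)%:C%C * (U^-1 * cconj h).
  by rewrite cconjM -mul_cconj mulrACA divff// mul1r.
have ReZ (x : R) (w : R[i]) : complex.Re (x%:C%C * w) = x * complex.Re w.
  by case: w => c d /=; rewrite mul0r subr0.
have -> : f * ((cabs U ^+ 2)%:C%C * (U^-1 * cconj h)) = (cabs U ^+ 2)%:C%C * (cconj h * f * U^-1) by ring.
have -> : cconj h * r%:C%C * f * U^-1 = r%:C%C * (cconj h * f * U^-1) by ring.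
rewrite !ReZ cabsM powRM ?cabs_ge0// powRD; last by apply/implyP => _; rewrite (gt_eqF X0).
have -> : cabs U `^ 2 = cabs U ^+ 2 by rewrite powR_mulrn// ltW.
by rewrite mulrDr opprD expRD /r; ring.
Qed.

(** On the circle through [w] the kernel is [c w] times the real part of a holomorphic function
    whose mean ignores the radius. The means at [v] and at [1] thus have ratio [c v / c 1], which is
    the normalised weight. *)
Lemma kern_radial F (t A b : R) (i : 'I_n) : -1 < t -> holo F ->
  radial_in (kern F t A b) (radial_weight t b (j i)) i.
Proof.
move=> t1 [cF dF] z v v0.
have cK := ccont_kern A b t1 cF.
have [B HB] := kern_upd F t A b z i.
pose g (w : R[i]) s := complex.Re (B * F (upd z i (cis s * w)) * (cis s * w) ^- j i).
pose c (w : R[i]) := cabs (w ^+ j i) `^ (2 + t) * expR (- (b * cabs w ^+ 2)).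
have c0 w : w != 0 -> 0 < c w.
  by move=> w0; rewrite mulr_gt0 ?expR_gt0// powR_gt0// cabs_gt0 expf_neq0.
have cis0 s : cis s != 0 :> R[i] by rewrite -cabs_gt0 cabs_cis.
have kE w s : w != 0 -> kern F t A b (upd z i (cis s * w)) = c w * g w s.
  move=> w0; rewrite HB ?mulf_neq0// /c /g exprMn !cabsM !cabsX !cabs_cis.
  by rewrite expr1n !mul1r.
have cm w : w != 0 -> cmean (fun s => kern F t A b (upd z i (cis s * w))) = c w * cmean (g w).
  move=> w0.
  have ck : continuous (fun s => kern F t A b (upd z i (cis s * w))).
    exact: (ccont1_circle (z := w) (@ccont_slice _ _ _ z i cK)).
  have -> : g w = (fun s => (c w)^-1 * kern F t A b (upd z i (cis s * w))).
    by apply/funext => s; rewrite kE// mulKf// gt_eqF// c0.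
  by rewrite cmeanZ// mulVKf// gt_eqF// c0.
have gg w : w != 0 -> cmean (g w) = cmean (g 1).
  move=> w0; rewrite /g (cmean_circle_cexp (j i) B (dF z i) w0).
  by congr cmean; apply/funext => s; rewrite mulr1.
rewrite cm// gg// /updmean.
have -> : (fun s => kern F t A b (upd z i (cis s))) = (fun s => kern F t A b (upd z i (cis s * 1))).
  by apply/funext => s; rewrite mulr1.
rewrite cm ?oner_neq0// mulrA; congr (_ * _).
rewrite /radial_weight /c expr1n cabs1 powR1 mul1r expr1n mulr1.
have E : expR b * expR (- b) = 1 by rewrite -expRD subrr expR0.
rewrite -mulrA [X in _ = _ * X](_ : _ = expR (- (b * cabs v ^+ 2)))//.
by rewrite mulrAC E mul1r.
Qed.

(** Read as monomial times Gaussian on [C^1], the weight inherits continuity and integrability from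
    the [n]-variable statements at [n = 1]. *)
Lemma radial_weightE (t b : R) m (v : R[i]) :
  radial_weight t b m v = (fun z : 'I_1 -> R[i] =>
    cabs (monom (fun=> m) z) `^ (2 + t) * (expR b * expR (- (b * sqnorm z)))) (fun=> v).
Proof. by rewrite /radial_weight /monom /sqnorm !big_ord1. Qed.

Lemma radial_weight_ge0 (t b : R) m (v : R[i]) : 0 <= radial_weight t b m v.
Proof. by rewrite mulr_ge0 ?powR_ge0// mulr_ge0 ?expR_ge0. Qed.

Lemma radial_weight_props (t b : R) m : -1 < t -> 0 < b ->
  [/\ ccont1 (radial_weight t b m),
      (intC (fun v => (radial_weight t b m v)%:E) < +oo)%E &
      0 < fine (intC (fun v => (radial_weight t b m v)%:E))].
Proof.
move=> t1 b0; have s0 : 0 < 2 + t by lra.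
have c1 : ccont1 (radial_weight t b m).
  pose K (z : 'I_1 -> R[i]) := cabs (monom (fun=> m) z) `^ (2 + t) * (expR b * expR (- (b * sqnorm z))).
  have cK : ccont K.
    apply: ccontM; last exact: ccontZ (@ccont_gauss R 1 b).
    apply: ccont_powR => // [z|]; first exact: cabs_ge0.
    exact/ccont_cabs/ccontC_monom.
  have -> : radial_weight t b m = (fun v => K (fun=> v)).
    by apply/funext => v; exact: radial_weightE.
  by apply: (ccont_comp1 cK) => w e e0; exists e.
have fin : (intC (fun v => (radial_weight t b m v)%:E) < +oo)%E.
  have := @monom_gauss_lty R 1 (fun=> m) (2 + t) b (expR b) s0 b0 (expR_ge0 b).
  set G := fun z : 'I_1 -> R[i] => (_)%:E.
  have -> : (fun v => (radial_weight t b m v)%:E) = (fun v => G (upd (fun=> 0) 0 v)); last by [].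
  apply/funext => v; rewrite /G radial_weightE.
  by have -> : upd (fun=> 0) 0 v = (fun=> v) :> ('I_1 -> R[i]) by apply/funext => i; rewrite /upd ord1.
have ge0 v : (0 <= (radial_weight t b m v)%:E)%E by rewrite lee_fin radial_weight_ge0.
split => //; apply: fine_gt0; rewrite fin andbT.
have w1 : 0 < radial_weight t b m 1.
  by rewrite /radial_weight expr1n cabs1 powR1 mul1r mulr_gt0 ?expR_gt0.
have w2 : 0 < radial_weight t b m 1 / 2 by lra.
have [d d0 Hd] := c1 1 _ w2.
apply: (intC_gt0 (ccont1_measC c1) ge0 w2 d0) => z /Hd; rewrite lee_fin ltr_norml; lra.
Qed.

(** This stands for the integral of [|h|^(2+t) A exp (- b |z|^2)]: the factor [exp (- b n)] undoes
    the [n] normalisations by [expR b]. *)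
Definition weight_mass (t A b : R) : R :=
  (\prod_(i < n) fine (intC (fun v => (radial_weight t b (j i) v)%:E))) *
  (A * expR (- (b * n%:R))).

Lemma weight_mass_gt0 (t A b : R) : -1 < t -> 0 < b -> 0 < A -> 0 < weight_mass t A b.
Proof.
move=> t1 b0 A0; rewrite mulr_gt0 ?(mulr_gt0 A0) ?expR_gt0//.
by apply: prodr_gt0 => i _; have [] := radial_weight_props (j i) t1 b0.
Qed.

(** Real part of the Fourier coefficient of [F] on the unit torus at the multi-index [j]. *)
Definition tcoef F : R := tmean (fun z => complex.Re (F z * cconj (monom j z))).

Lemma torus_cabs_monom z : (forall i, cabs (z i) = 1) -> cabs (monom j z) = 1.
Proof.
move=> z1; rewrite /monom; elim: (index_enum _) => [|i r IH]; first by rewrite big_nil cabs1.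
by rewrite big_cons cabsM cabsX z1 expr1n IH mul1r.
Qed.

Lemma ccont_Re_conj_monom F : ccontC F ->
  ccont (fun z => complex.Re (F z * cconj (monom j z))).
Proof.
move=> cF; apply: ccont_Re; apply: ccontCM => //.
by apply: ccontC_conj; exact: ccontC_monom.
Qed.

(** Radiality in every variable reduces the integral to a torus mean. On the torus [|h| = 1] and
    [|z|^2 = n], so the kernel there is [A exp (- b n) Re(F conj h)]. *)
Lemma RintCn_kern F (t A b : R) : -1 < t -> 0 < b -> holo F ->
  (intCn (fun z => `|kern F t A b z|%:E) < +oo)%E ->
  RintCn (kern F t A b) = weight_mass t A b * tcoef F.
Proof.
move=> t1 b0 hF fin; have [cF _] := hF.
(* The weights of [RintCn_radial] are indexed by natural numbers; [j] is extended by [0] beyond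
   [n]. *)
pose jn l := if insub l is Some i then j i else 0%N.
have jnE (i : 'I_n) : jn i = j i by rewrite /jn valK.
have cK := ccont_kern A b t1 cF.
rewrite (@RintCn_radial _ _ _ (fun l => radial_weight t b (jn l)))//; last first.
  move=> l ln; have [h1 h2 _] := radial_weight_props (jn l) t1 b0.
  split => //; first by move=> v; exact: radial_weight_ge0.
  have := @kern_radial F t A b (Ordinal ln) t1 hF.
  by rewrite -jnE.
rewrite partial_mean_scale//.
have -> : \prod_(l < n) fine (intC (fun v => (radial_weight t b (jn l) v)%:E)) =
    \prod_(i < n) fine (intC (fun v => (radial_weight t b (j i) v)%:E)).
  by apply: eq_bigr => i _; rewrite jnE.
rewrite /weight_mass -mulrA; congr (_ * _); rewrite -/(tmean _) /tcoef.
have cR := ccont_Re_conj_monom cF.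
have := tmean_lin (A * expR (- (b * n%:R))) 0 cR cR; rewrite mul0r addr0 => <-.
apply: tmean_ext => z z1; rewrite mul0r addr0 /kern torus_cabs_monom// powR1 mulr1 mulrC.
congr (_ * expR (- (b * _)) * _); rewrite /sqnorm.
rewrite (eq_bigr (fun=> 1)); last by move=> i _; rewrite z1 expr1n.
by rewrite sumr_const card_ord.
Qed.

End MonomialKernel.

(** * Stability of holomorphy *)

Section Holo.
Variables (R : realType) (n : nat).
Notation T := ('I_n -> R[i]).
Implicit Types (F G : T -> R[i]) (z : T).

Lemma upd_same z k (a b : R[i]) : upd (upd z k a) k b = upd z k b.
Proof. by apply/funext => i; rewrite /upd; case: (nat_of_ord i == k). Qed.

Lemma holomorphic_holo F : holomorphic F -> holo F.
Proof.
move=> [cF dF]; split => // z k v.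
have [L HL] := dF (upd z k v) k; exists L => e e0.
have [d d0 Hd] := HL e e0; exists d => // h hd.
have [->|h0] := eqVneq h 0; first by rewrite addr0 subrr mulr0 subr0 cabs0 mulr0.
have vk : upd z k v k = v by rewrite /upd eqxx.
have := Hd h h0 hd; rewrite upd_same vk; set D := _ - F (upd z k v) => /ltW H.
have -> : D - L * h = (D / h - L) * h by rewrite mulrBl divfK.
by rewrite cabsM ler_wpM2r// cabs_ge0.
Qed.

Lemma cdiffD (N M : R[i] -> R[i]) v L L' : cdiff N v L -> cdiff M v L' ->
  cdiff (fun u => N u + M u) v (L + L').
Proof.
move=> dN dM e e0; have e2 : 0 < e / 2 by lra.
have [d1 d10 H1] := dN _ e2; have [d2 d20 H2] := dM _ e2.
exists (Num.min d1 d2); first by rewrite lt_min d10.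
move=> h; rewrite lt_min => /andP[/H1 h1 /H2 h2].
have -> : N (v + h) + M (v + h) - (N v + M v) - (L + L') * h =
  (N (v + h) - N v - L * h) + (M (v + h) - M v - L' * h) by ring.
by apply: (le_trans (cabsD _ _)); lra.
Qed.

Lemma holo_lin (c d : R[i]) F G : holo F -> holo G -> holo (fun z => c * F z + d * G z).
Proof.
move=> [cF dF] [cG dG]; split.
  by apply: ccontCD; apply: ccontCM => //; exact: ccontC_cst.
move=> z k v; have [L HL] := dF z k v; have [M HM] := dG z k v.
have := cdiffD (cdiffM (cdiff_cst c v) HL) (cdiffM (cdiff_cst d v) HM).
by eexists; eassumption.
Qed.

Lemma holo_monom (j : 'I_n -> nat) : holo (monom j : T -> R[i]).
Proof.
split; first exact: ccontC_monom.
move=> z k v; set h := \prod_(i < n | i != k) z i ^+ j i.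
have did : cdiff (fun u : R[i] => u) v 1.
  move=> e e0; exists 1 => // u _.
  by rewrite (_ : v + u - v - 1 * u = 0) ?cabs0 ?mulr_ge0 ?cabs_ge0 ?(ltW e0)//; ring.
have [L HL] := cdiffX (j k) did.
exists (L * h + v ^+ j k * 0).
have -> : (fun u => monom j (upd z k u)) = (fun u => u ^+ j k * h).
  by apply/funext => u; rewrite monom_upd.
exact: (cdiffM HL (cdiff_cst h v)).
Qed.

End Holo.

(** * Strict convexity of the [p]-th power of the modulus *)

Section PointwiseConvexity.
Variable R : realType.
Implicit Types (x y p : R) (u v : R[i]).

(** For positive arguments and [r = ln (x / y)] the difference is
    [y^p e^r (e^((p-1) r) + (p-1) e^-r - p)]. Applying [1 + s <= e^s] to both exponentials makes the
    bracket nonnegative, and strictness in the second one forces [r = 0] in the equality case. *)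
Lemma young_strict x y p : 1 < p -> 0 <= x -> 0 <= y ->
  p * x * y `^ (p - 1) <= x `^ p + (p - 1) * y `^ p /\
  (p * x * y `^ (p - 1) = x `^ p + (p - 1) * y `^ p -> x = y).
Proof.
move=> p1 x0 y0; have p0 : 0 < p by lra.
have pn0 : p != 0 by lra.
have p1n0 : p - 1 != 0 by lra.
have [->|yn] := eqVneq y 0.
  rewrite !powR0// !mulr0 addr0; split; first exact: powR_ge0.
  by move=> /esym /powR_eq0_eq0.
have yp : 0 < y by rewrite lt_def yn.
have py : 0 < (p - 1) * y `^ p by rewrite mulr_gt0 ?powR_gt0//; lra.
have [->|xn] := eqVneq x 0.
  by rewrite powR0// mulr0 mul0r add0r; split; lra.
have xp : 0 < x by rewrite lt_def xn.
pose r := ln x - ln y.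
have xE : x = y * expR r by rewrite /r expRB !lnK ?posrE// mulrCA divff// mulr1.
have yE : y `^ p = y * y `^ (p - 1) by rewrite mulr_powRB1.
have xpE : x `^ p = y `^ p * expR (p * r).
  by rewrite {1}xE powRM ?expR_ge0// /powR [expR r == 0]gt_eqF ?expR_gt0// expRK.
have key : p * x * y `^ (p - 1) = y `^ p * expR r * p by rewrite {1}xE yE; ring.
have Y : 0 < y `^ p by rewrite powR_gt0.
have fac : x `^ p + (p - 1) * y `^ p - p * x * y `^ (p - 1) =
    y `^ p * expR r * (expR ((p - 1) * r) + (p - 1) * expR (- r) - p).
  rewrite key xpE.
  have -> : expR (p * r) = expR r * expR ((p - 1) * r) by rewrite -expRD; congr expR; ring.
  have -> : (p - 1) * y `^ p = y `^ p * (p - 1) * (expR r * expR (- r)).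
    by rewrite -expRD subrr expR0; ring.
  ring.
have Z : 0 < y `^ p * expR r by rewrite mulr_gt0 ?expR_gt0.
have e1 := expR_ge1Dx ((p - 1) * r); have e2 := expR_ge1Dx (- r).
split.
  rewrite -subr_ge0 fac; apply: mulr_ge0; first exact: ltW.
  have e4 : (p - 1) * (1 - r) <= (p - 1) * expR (- r) by rewrite ler_wpM2l//; lra.
  lra.
move=> /esym /eqP; rewrite -subr_eq0 fac mulf_eq0 (gt_eqF Z) /= => /eqP E0.
have [r0|rn] := eqVneq r 0; first by rewrite xE r0 expR0 mulr1.
have e3 : 1 + - r < expR (- r) by apply: expR_gt1Dx; rewrite oppr_eq0.
have e4 : (p - 1) * (1 - r) < (p - 1) * expR (- r) by rewrite ltr_pM2l//; lra.
lra.
Qed.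

(** The Bregman divergence of [|.|^p]: the gap at [u] between the function and its real tangent at
    [v]. *)
Definition bregman p u v : R := cabs u `^ p - cabs v `^ p -
  p * (cabs v `^ (p - 2) * complex.Re ((u - v) * cconj v)).

(** [Re(u conj v) <= |u| |v|] reduces the claim to Young's inequality for the moduli. Equality
    forces [|u| = |v|] and [Re(u conj v) = |u| |v|], hence [|u - v|^2 = 0]. *)
Lemma bregman_ge0 p u v : 1 < p -> 0 <= bregman p u v /\ (bregman p u v = 0 -> u = v).
Proof.
move=> p1; have p0 : 0 < p by lra. have pn0 : p != 0 by lra.
have u0 := cabs_ge0 u; have v0 := cabs_ge0 v.
rewrite /bregman; have [->|vn] := eqVneq v 0.
  rewrite cabs0 powR0// !subr0 (_ : cconj 0 = 0); last by rewrite /cconj /= oppr0.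
  rewrite mulr0 /= !mulr0 subr0; split; first exact: powR_ge0.
  by move=> /powR_eq0_eq0 /eqP; rewrite cabs_eq0 => /eqP.
have vp : 0 < cabs v by rewrite cabs_gt0.
have pw1 : cabs v `^ (p - 1) = cabs v `^ (p - 2) * cabs v.
  have -> : p - 1 = (p - 2) + 1 by ring.
  rewrite powRD ?powRr1//; apply/implyP => _; exact: lt0r_neq0.
have pw : cabs v `^ p = cabs v `^ (p - 2) * cabs v ^+ 2.
  by rewrite -(@mulr_powRB1 _ (cabs v) p)// pw1; ring.
have ReE : complex.Re ((u - v) * cconj v) = complex.Re (u * cconj v) - cabs v ^+ 2.
  by rewrite mulrBl mul_cconj ReB.
have P0 : 0 < cabs v `^ (p - 2) by exact: powR_gt0.
have Rle : complex.Re (u * cconj v) <= cabs u * cabs v.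
  by apply: le_trans (ler_norm _) _; apply: le_trans (cabs_Re _) _; rewrite cabsM cabs_conj.
have [Y1 Y2] := young_strict p1 u0 v0.
have m1 : p * (cabs v `^ (p - 2) * complex.Re (u * cconj v)) <= p * (cabs v `^ (p - 2) * (cabs u * cabs v)).
  by rewrite ler_pM2l// ler_pM2l.
have E1 : p * (cabs v `^ (p - 2) * (cabs u * cabs v)) = p * cabs u * cabs v `^ (p - 1) by rewrite pw1; ring.
have E2 : p * (cabs v `^ (p - 2) * complex.Re ((u - v) * cconj v)) =
    p * (cabs v `^ (p - 2) * complex.Re (u * cconj v)) - p * cabs v `^ p by rewrite ReE pw; ring.
rewrite E2; split; first lra.
move=> H.
have uv : cabs u = cabs v by apply: Y2; lra.
have RR : complex.Re (u * cconj v) = cabs u * cabs v.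
  have : p * (cabs v `^ (p - 2) * complex.Re (u * cconj v)) = p * (cabs v `^ (p - 2) * (cabs u * cabs v)) by lra.
  by move=> /(mulfI pn0) /(mulfI (lt0r_neq0 P0)).
apply/eqP; rewrite -subr_eq0 -cabs_eq0 -sqrf_eq0.
have -> : cabs (u - v) ^+ 2 = cabs u ^+ 2 + cabs v ^+ 2 - 2 * complex.Re (u * cconj v).
  by rewrite !cabs_sqr; case: (u) => a b; case: (v) => c d; rewrite /cconj /=; ring.
by rewrite RR uv; apply/eqP; ring.
Qed.

End PointwiseConvexity.

(** * Integrability and torus coefficients in the Fock space *)

Section Fock.
Variables (R : realType) (n : nat) (j : 'I_n -> nat) (a p p' : R).
Hypotheses (a0 : 0 < a) (p1 : 1 < p) (pp' : p^-1 + p'^-1 = 1).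
Notation T := ('I_n -> R[i]).
Notation h := (monom j : T -> R[i]).
Implicit Types (F : T -> R[i]) (z : T).

Let p0 : 0 < p. Proof. exact: lt_trans ltr01 p1. Qed.

Lemma conjugate_gt0 : 0 < p'.
Proof.
have pV : p^-1 < 1 by rewrite invf_lt1.
by have := pp'; rewrite -invr_gt0; lra.
Qed.

Let b : R := a * p / 2.
Let A : R := (b / pi) ^+ n.

Let b0 : 0 < b. Proof. by rewrite /b divr_gt0// mulr_gt0. Qed.
Let A0 : 0 < A. Proof. by rewrite exprn_gt0// divr_gt0// pi_gt0. Qed.

Lemma ccont_Nint_integrand F (q c : R) : 0 < q -> ccontC F ->
  ccont (fun z : T => cabs (F z) `^ q * gdens c z).
Proof.
move=> q0 cF; apply: ccontM; last exact: ccontZ (@ccont_gauss R n c).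
apply: ccont_powR => // [z|]; first exact: cabs_ge0.
exact: ccont_cabs.
Qed.

Lemma Nint_integrand_ge0 F (q c : R) z : 0 <= c ->
  (0 <= (cabs (F z) `^ q * gdens c z)%:E)%E.
Proof.
move=> c0; rewrite lee_fin mulr_ge0 ?powR_ge0// mulr_ge0 ?expR_ge0// exprn_ge0//.
by rewrite divr_ge0// pi_ge0.
Qed.

Lemma Nint_monom_lty (q : R) : 0 < q -> (Nint q a h < +oo)%E.
Proof.
move=> q0; apply: monom_gauss_lty => //; first by rewrite divr_gt0// mulr_gt0.
by rewrite exprn_ge0// divr_ge0// ?pi_ge0// ltW// divr_gt0// mulr_gt0.
Qed.

Lemma Nint_gt0 F (q : R) z : 0 < q -> ccontC F -> F z != 0 -> (0 < Nint q a F)%E.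
Proof.
move=> q0 cF Fz; have c0 : 0 < a * q / 2 by rewrite divr_gt0// mulr_gt0.
apply: (@iterC_gt0 _ _ _ _ _ z).
- exact: (ccont_lscT (ccont_Nint_integrand _ q0 cF)).
- by move=> w; apply: Nint_integrand_ge0; exact: ltW.
- rewrite lte_fin mulr_gt0 ?powR_gt0 ?cabs_gt0// mulr_gt0 ?expR_gt0// exprn_gt0//.
  by rewrite divr_gt0// pi_gt0.
- by move=> i; rewrite leqNgt ltn_ord.
Qed.

(** A common majorant for the inner product kernel, the convexity kernel and the [p]-th power of a
    combination of [F] and [h]. *)
Lemma dominated_lty (K : T -> R) F (s c C D : R) : ccont K -> ccontC F ->
  (Nint p a F < +oo)%E -> 0 < s -> 0 < c -> 0 <= C -> 0 <= D ->
  (forall z, `|K z| <= C * (cabs (F z) `^ p * gdens b z) +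
     cabs (h z) `^ s * (D * expR (- (c * sqnorm z)))) ->
  (intCn (fun z => `|K z|%:E) < +oo)%E.
Proof.
move=> cK cF fF s0 c0 C0 D0 HK.
pose G1 z := (C%:E * (cabs (F z) `^ p * gdens b z)%:E)%E.
pose G2 z := (cabs (h z) `^ s * (D * expR (- (c * sqnorm z))))%:E.
have g0 z : (0 <= (cabs (F z) `^ p * gdens b z)%:E)%E by apply: Nint_integrand_ge0; exact: ltW.
have cN := ccont_Nint_integrand b p0 cF.
have lN := ccont_lscT cN.
have l1 : lscT G1 by apply: (ccont_lscT (K := fun z => C * (cabs (F z) `^ p * gdens b z))); exact: ccontZ.
have c2 : ccont (fun z : T => cabs (h z) `^ s * (D * expR (- (c * sqnorm z)))).
  apply: ccontM; last exact: ccontZ (@ccont_gauss R n c).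
  apply: ccont_powR => // [z|]; first exact: cabs_ge0.
  exact/ccont_cabs/ccontC_monom.
have l2 : lscT G2 by exact: ccont_lscT.
have p1' z : (0 <= G1 z)%E by rewrite mule_ge0.
have p2' z : (0 <= G2 z)%E by rewrite lee_fin mulr_ge0 ?powR_ge0// mulr_ge0 ?expR_ge0.
apply: (@le_lt_trans _ _ (intCn (fun z => (G1 z + G2 z)%E))).
  apply: le_iterC.
  - apply: ccont_lscT => w e e0; have [d d0 Hd] := cK w e e0; exists d => // w' /Hd.
    by apply: le_lt_trans; exact: ler_dist_dist.
  - apply: (ccont_lscT (K := fun z => C * (cabs (F z) `^ p * gdens b z) + cabs (h z) `^ s * (D * expR (- (c * sqnorm z))))).
    by apply: ccontD => //; exact: ccontZ.
  - by move=> z; rewrite lee_fin.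
  - by move=> z; rewrite lee_fin.
rewrite /intCn iterCD//; apply: lte_add_pinfty; last exact: monom_gauss_lty.
by rewrite iterCZ//; apply: lte_mul_pinfty; rewrite ?lee_fin.
Qed.

Lemma kern_le F (t B c : R) z : 0 <= B ->
  `|kern j F t B c z| <= cabs (F z) * cabs (h z) * cabs (h z) `^ t * (B * expR (- (c * sqnorm z))).
Proof.
move=> B0; rewrite /kern !normrM (ger0_norm (powR_ge0 _ _)) (ger0_norm B0) (ger0_norm (expR_ge0 _)).
rewrite ler_wpM2r ?mulr_ge0 ?expR_ge0// ler_wpM2r ?powR_ge0//.
by apply: le_trans (cabs_Re _) _; rewrite cabsM cabs_conj.
Qed.

(** Split [exp (- a |z|^2)] into two equal factors, attach one to [F] and one to [h], and apply
    Young's inequality: the powers [p] and [p'] produce exactly the Gaussian exponents [a p / 2] and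
    [a p' / 2] of the two norms. The constant [B / A] cancels the normalisation of [gdens]. *)
Lemma kern_inner_lty F (B : R) : 0 <= B -> ccontC F -> (Nint p a F < +oo)%E ->
  (intCn (fun z => `|kern j F 0 B a z|%:E) < +oo)%E.
Proof.
move=> B0 cF fF; have q0 := conjugate_gt0; have hpp := pp'.
have ap : 0 < a * p' / 2 by rewrite divr_gt0// mulr_gt0.
apply: (@dominated_lty _ F p' (a * p' / 2) (B / A) B) => //.
- by apply: ccont_kern => //; lra.
- by rewrite divr_ge0// ltW.
move=> z; apply: le_trans (kern_le F 0 a z B0) _; rewrite powRr0 mulr1.
set x := cabs (F z); set y := cabs (h z); set S := sqnorm z.
have x0 : 0 <= x by exact: cabs_ge0.
have y0 : 0 <= y by exact: cabs_ge0.
have e0 := expR_ge0 (- (a / 2 * S)).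
have := @conjugate_powR _ (x * expR (- (a / 2 * S))) (y * expR (- (a / 2 * S))) p p'
  (mulr_ge0 x0 e0) (mulr_ge0 y0 e0) p0 q0 pp'.
rewrite !powRM ?expR_ge0// !expR_powR.
have -> : p * - (a / 2 * S) = - (b * S) by rewrite /b; field.
have -> : p' * - (a / 2 * S) = - (a * p' / 2 * S) by field.
have -> : x * expR (- (a / 2 * S)) * (y * expR (- (a / 2 * S))) = x * y * expR (- (a * S)).
  by rewrite mulrACA -expRD; congr (_ * expR _); field.
set U := x `^ p * expR _; set V := y `^ p' * expR _ => H.
have U0 : 0 <= U by rewrite mulr_ge0 ?powR_ge0 ?expR_ge0.
have V0 : 0 <= V by rewrite mulr_ge0 ?powR_ge0 ?expR_ge0.
have pV : 0 < p^-1 by rewrite invr_gt0.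
have qV : 0 < p'^-1 by rewrite invr_gt0.
have h1 : U / p <= U by rewrite ler_piMr//; lra.
have h2 : V / p' <= V by rewrite ler_piMr//; lra.
have -> : B / A * (x `^ p * gdens b z) = B * U.
  by rewrite /gdens -/S -/A /U; field; rewrite gt_eqF.
have -> : y `^ p' * (B * expR (- (a * p' / 2 * S))) = B * V by rewrite /V; ring.
rewrite -mulrDr mulrCA ler_wpM2l//; lra.
Qed.

(** The modulus of the kernel is at most [|F| |h|^(p-1)] times the Gaussian factor, and
    [x y^(p-1) <= x^p + y^p] by comparing [x] with [y]. *)
Lemma kern_norm_lty F (B : R) : 0 <= B -> ccontC F -> (Nint p a F < +oo)%E ->
  (intCn (fun z => `|kern j F (p - 2) B b z|%:E) < +oo)%E.
Proof.
move=> B0 cF fF; have hp1 := p1.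
apply: (@dominated_lty _ F p b (B / A) B) => //.
- by apply: ccont_kern => //; lra.
- by rewrite divr_ge0// ltW.
move=> z; apply: le_trans (kern_le F (p - 2) b z B0) _.
set x := cabs (F z); set y := cabs (h z); set S := sqnorm z.
have x0 : 0 <= x by exact: cabs_ge0.
have y0 : 0 <= y by exact: cabs_ge0.
have xy : x * y * y `^ (p - 2) <= x `^ p + y `^ p.
  have P1 := powR_ge0 x p; have P2 := powR_ge0 y p.
  have [yE|yn] := eqVneq y 0; first by rewrite {1}yE mulr0 mul0r addr_ge0.
  have -> : x * y * y `^ (p - 2) = x * y `^ (p - 1).
    have -> : p - 1 = 1 + (p - 2) by ring.
    rewrite [y `^ (1 + _)]powRD; last by apply/implyP.
    by rewrite powRr1// mulrA.
  have [xy|yx] := leP x y.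
    have : x * y `^ (p - 1) <= y * y `^ (p - 1) by rewrite ler_wpM2r ?powR_ge0.
    by rewrite mulr_powRB1//; lra.
  have : x * y `^ (p - 1) <= x * x `^ (p - 1).
    by rewrite ler_wpM2l// ge0_ler_powR ?nnegrE ?(ltW yx)//; lra.
  by rewrite mulr_powRB1//; lra.
have -> : B / A * (x `^ p * gdens b z) = x `^ p * (B * expR (- (b * S))).
  by rewrite /gdens -/S -/A; field; rewrite gt_eqF.
by rewrite -mulrDl ler_wpM2r// mulr_ge0 ?expR_ge0.
Qed.

(** Since [Re(- i w) = Im w], the imaginary part is the real coefficient of [- i F]; only real
    kernels have to be integrated. *)
Definition tcoefC F : R[i] := Complex (tcoef j F) (tcoef j (fun z => Complex 0 (-1) * F z)).

(** The value of the inner product of [h] with itself, by [innerH_monom] at [F = h]. *)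
Definition inner_mass : R := weight_mass j 0 ((a / pi) ^+ n) a.

Lemma inner_mass_gt0 : 0 < inner_mass.
Proof. by apply: weight_mass_gt0 => //; rewrite exprn_gt0// divr_gt0// pi_gt0. Qed.

Lemma innerH_monom F : holo F -> (Nint p a F < +oo)%E ->
  innerH a F h = inner_mass%:C%C * tcoefC F.
Proof.
move=> hF fF; set B := (a / pi) ^+ n.
have B0 : 0 <= B by rewrite exprn_ge0// divr_ge0 ?pi_ge0// ltW.
have t1 : -1 < 0 :> R by lra.
have [cF _] := hF.
have hi : holo (fun z => Complex 0 (-1) * F z).
  have := holo_lin (Complex 0 (-1)) 0 hF hF.
  by congr holo; apply/funext => z; rewrite mul0r addr0.
have fi : (Nint p a (fun z => (Complex 0 (-1) * F z)%R) < +oo)%E.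
  move: fF; congr (_ < _)%E; congr intCn; apply/funext => z; congr (_ `^ _ * _)%:E.
  by rewrite cabsM [cabs (Complex _ _)](_ : _ = 1) ?mul1r// /cabs /= expr0n sqrrN expr1n add0r sqrtr1.
rewrite /innerH /CintCn.
have -> : (fun z : T => complex.Re (F z * cconj (h z) * Complex (gdens a z) 0)) = kern j F 0 B a.
  apply/funext => z; rewrite /kern powRr0 mulr1 /gdens -/B.
  by case: (F z * _) => x y /=; rewrite mulr0 subr0.
have -> : (fun z : T => complex.Im (F z * cconj (h z) * Complex (gdens a z) 0)) =
    kern j (fun z => Complex 0 (-1) * F z) 0 B a.
  apply/funext => z; rewrite /kern powRr0 mulr1 /gdens -/B -[Complex 0 (-1) * _ * _]mulrA.
  by case: (F z * cconj (h z)) => x y /=; ring.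
rewrite !RintCn_kern//; try exact: kern_inner_lty; last by apply: kern_inner_lty => //; case: hi.
by rewrite /tcoefC /inner_mass; simpc.
Qed.

Lemma tcoef_monom (c : R[i]) : tcoefC (fun z => c * h z) = c.
Proof.
have H (d : R[i]) : tcoef j (fun z => d * h z) = complex.Re d.
  rewrite /tcoef -[RHS](tmean_cst n); apply: tmean_ext => z z1.
  rewrite -mulrA mul_cconj torus_cabs_monom// expr1n.
  by case: d => x y /=; rewrite mulr1 mulr0 subr0.
rewrite /tcoefC H.
have -> : (fun z => Complex 0 (-1) * (c * h z)) = (fun z => (Complex 0 (-1) * c) * h z).
  by apply/funext => z; rewrite mulrA.
by rewrite H; case: c => x y /=; congr Complex; ring.
Qed.

(** The function is [conj C (F - C h)], and [F - C h] has torus coefficient [C - C = 0]. The factor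
    [conj C] is the one left by [conj (C h)] in the linear term of the convexity inequality. *)
Lemma tcoef_residual F : ccontC F -> let C := tcoefC F in
  tcoef j (fun z => cconj C * F z + (- (cconj C * C)) * h z) = 0.
Proof.
move=> cF C; rewrite /tcoef.
have c1 := ccont_Re_conj_monom j cF.
have cF' : ccontC (fun z => Complex 0 (-1) * F z) by apply: ccontCM => //; exact: ccontC_cst.
have c2 := ccont_Re_conj_monom j cF'.
have c3 := @ccont_cst R n 1.
have c4 : ccont (fun z => complex.Im C * complex.Re (Complex 0 (-1) * F z * cconj (h z)) + (- cabs C ^+ 2) * 1).
  by apply: ccontD; [exact: ccontZ|exact: ccontZ c3].
(* [Re(conj C w) = Re C Re w + Im C Im w] with [w = F conj h]; since [|h| = 1] on the torus, the
   remaining term is the constant [- |C|^2]. *)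
transitivity (tmean (fun z => complex.Re C * complex.Re (F z * cconj (h z)) +
    1 * (complex.Im C * complex.Re (Complex 0 (-1) * F z * cconj (h z)) + (- cabs C ^+ 2) * 1))).
  apply: tmean_ext => z z1.
  have -> : (cconj C * F z + - (cconj C * C) * h z) * cconj (h z) =
      cconj C * (F z * cconj (h z)) - (C * cconj C) * (h z * cconj (h z)) by ring.
  rewrite !mul_cconj torus_cabs_monom// -mulrA.
  case: (F z * cconj (h z)) => x y; rewrite /cconj.
  by case: (C) => u v /=; ring.
rewrite (tmean_lin _ _ c1 c4) (tmean_lin _ _ c2 c3) tmean_cst.
have -> : tmean (fun z => complex.Re (F z * cconj (h z))) = complex.Re C by [].
have -> : tmean (fun z => complex.Re (Complex 0 (-1) * F z * cconj (h z))) = complex.Im C by [].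
by rewrite cabs_sqr; ring.
Qed.

Lemma Nint_lin_lty F (c d : R[i]) : ccontC F -> (Nint p a F < +oo)%E ->
  (Nint p a (fun z => (c * F z + d * h z)%R) < +oo)%E.
Proof.
move=> cF fF.
have cL : ccontC (fun z => c * F z + d * h z).
  by apply: ccontCD; apply: ccontCM; rewrite //; (try exact: ccontC_cst); exact: ccontC_monom.
have cK := ccont_Nint_integrand b p0 cL.
have K0 z : 0 <= cabs (c * F z + d * h z) `^ p * gdens b z.
  by have := Nint_integrand_ge0 (fun z => c * F z + d * h z) p z (ltW b0); rewrite lee_fin.
(* The constants come from [(x + y)^p <= (2 x)^p + (2 y)^p], which holds because [x + y] is at most
   twice the larger term. *)
have := @dominated_lty _ F p b ((2 * cabs c) `^ p) ((2 * cabs d) `^ p * A) cK cF fF p0 b0 (powR_ge0 _ _) (mulr_ge0 (powR_ge0 _ _) (ltW A0)).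
have -> : (fun z : T => `|cabs (c * F z + d * h z) `^ p * gdens b z|%:E) =
    (fun z : T => (cabs (c * F z + d * h z) `^ p * gdens b z)%:E).
  by apply/funext => z; rewrite ger0_norm.
apply=> z; rewrite ger0_norm//.
set x := cabs (c * F z); set y := cabs (d * h z).
have x0 : 0 <= x by exact: cabs_ge0.
have y0 : 0 <= y by exact: cabs_ge0.
have g0 : 0 <= gdens b z.
  by rewrite mulr_ge0 ?expR_ge0// (ltW A0).
have -> : (2 * cabs c) `^ p * (cabs (F z) `^ p * gdens b z) +
    cabs (h z) `^ p * ((2 * cabs d) `^ p * A * expR (- (b * sqnorm z))) =
    ((2 * x) `^ p + (2 * y) `^ p) * gdens b z.
  have -> : (2 * x) `^ p = (2 * cabs c) `^ p * cabs (F z) `^ p.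
    by rewrite /x cabsM mulrA powRM ?cabs_ge0// mulr_ge0 ?cabs_ge0.
  have -> : (2 * y) `^ p = (2 * cabs d) `^ p * cabs (h z) `^ p.
    by rewrite /y cabsM mulrA powRM ?cabs_ge0// mulr_ge0 ?cabs_ge0.
  by rewrite /gdens -/A; ring.
rewrite ler_wpM2r//.
have s : cabs (c * F z + d * h z) <= x + y by exact: cabsD.
have P1 := powR_ge0 (2 * x) p; have P2 := powR_ge0 (2 * y) p.
have [xy|yx] := leP x y.
  suff : cabs (c * F z + d * h z) `^ p <= (2 * y) `^ p by lra.
  by rewrite ge0_ler_powR ?nnegrE ?cabs_ge0 ?mulr_ge0 ?(ltW p0)//; lra.
suff : cabs (c * F z + d * h z) `^ p <= (2 * x) `^ p by lra.
by rewrite ge0_ler_powR ?nnegrE ?cabs_ge0 ?mulr_ge0 ?(ltW p0)//; lra.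
Qed.

End Fock.

(** * The norm inequality with its defect *)

Section Extremal.
Variables (R : realType) (n : nat) (j : 'I_n -> nat) (a p : R).
Hypotheses (a0 : 0 < a) (p1 : 1 < p).
Notation T := ('I_n -> R[i]).
Notation h := (monom j : T -> R[i]).
Implicit Types (f : T -> R[i]) (z : T).

(** The defect [d] is the integral of the divergence of [f] from [C h] against the Gaussian. Keeping
    it as an explicit summand serves both the inequality and its equality case. *)
Lemma Nint_defect f : holo f -> (Nint p a f < +oo)%E -> let C := tcoefC j f in
  exists2 d : R, 0 <= d /\ fine (Nint p a f) = d + cabs C `^ p * fine (Nint p a h) &
  (d = 0 <-> forall z, f z = C * h z).
Proof.
move=> hf ff C; have hp1 := p1; have p0 : 0 < p by exact: lt_trans ltr01 p1.
pose b : R := a * p / 2; pose A : R := (b / pi) ^+ n.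
have b0 : 0 < b by rewrite /b divr_gt0// mulr_gt0.
have A0 : 0 < A by rewrite exprn_gt0// divr_gt0// pi_gt0.
have t1 : -1 < p - 2 by lra.
have [cf _] := hf.
pose F z := cconj C * f z + (- (cconj C * C)) * h z.
have hF : holo F by apply: holo_lin => //; exact: holo_monom.
have [cF _] := hF.
have fF : (Nint p a F < +oo)%E by exact: Nint_lin_lty.
(* The factor [p |C|^(p-2)] of the linear term, pulled out of [p |C h|^(p-2)]. *)
pose kap : R := p * cabs C `^ (p - 2).
have kap0 : 0 <= kap by rewrite mulr_ge0 ?powR_ge0// ltW.
pose X := kern j F (p - 2) (kap * A) b.
have kA0 : 0 <= kap * A by rewrite mulr_ge0// ltW.
have cX : ccont X by exact: ccont_kern.
have fX : (intCn (fun z => `|X z|%:E) < +oo)%E by exact: kern_norm_lty.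
have X0 : RintCn X = 0.
  by rewrite /X RintCn_kern// /F tcoef_residual// mulr0.
pose D z := bregman p (f z) (C * h z) * gdens b z.
pose U z := cabs (f z) `^ p * gdens b z.
pose V z := cabs (C * h z) `^ p * gdens b z.
have gd0 z : 0 < gdens b z by rewrite /gdens mulr_gt0 ?expR_gt0.
have DE z : D z = U z - V z - X z.
  rewrite /D /U /V /X /bregman /kern /F /gdens -/A /kap.
  have -> : (cconj C * f z + - (cconj C * C) * h z) * cconj (h z) = (f z - C * h z) * cconj (C * h z).
    by rewrite cconjM; ring.
  have -> : cabs (C * h z) `^ (p - 2) = cabs C `^ (p - 2) * cabs (h z) `^ (p - 2).
    by rewrite cabsM powRM ?cabs_ge0.
  ring.
have cU : ccont U by exact: ccont_Nint_integrand.
have cV : ccont V.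
  apply: ccont_Nint_integrand => //; apply: ccontCM; first exact: ccontC_cst.
  exact: ccontC_monom.
have cN K : ccont K -> ccont (fun z : T => - K z).
  by move=> cK; have := ccontZ (-1) cK; congr ccont; apply/funext => z; rewrite mulN1r.
have cD : ccont D.
  have -> : D = (fun z => U z + - V z + - X z) by apply/funext.
  by apply: ccontD; [apply: ccontD => //|]; exact: cN.
have D0 z : 0 <= D z.
  by apply: mulr_ge0; [have [] := bregman_ge0 (f z) (C * h z) p1|exact: ltW].
pose Xp z := Num.max (X z) 0; pose Xm z := Num.max (- X z) 0.
have cmax K : ccont K -> ccont (fun z : T => Num.max (K z) 0).
  move=> cK w e e0; have [d d0 Hd] := cK w e e0; exists d => // w' /Hd.
  by rewrite !ltr_norml => ?; case: (leP (K w) 0); case: (leP (K w') 0); lra.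
have cXp : ccont Xp by exact: cmax.
have cXm : ccont Xm by apply: cmax; exact: cN.
have Xp0 z : 0 <= Xp z by rewrite le_max lexx orbT.
have Xm0 z : 0 <= Xm z by rewrite le_max lexx orbT.
have U0 z : 0 <= U z by rewrite mulr_ge0 ?powR_ge0// ltW.
have V0 z : 0 <= V z by rewrite mulr_ge0 ?powR_ge0// ltW.
have labs : lscT (fun z => `|X z|%:E).
  apply: ccont_lscT => w e e0; have [d d0 Hd] := cX w e e0; exists d => // w' /Hd.
  by apply: le_lt_trans; exact: ler_dist_dist.
have fXp : (intCn (fun z => (Xp z)%:E) < +oo)%E.
  apply: le_lt_trans fX; apply: le_iterC => //; [exact: ccont_lscT|].
  by move=> z; rewrite lee_fin ge_max ler_norm normr_ge0.
have fXm : (intCn (fun z => (Xm z)%:E) < +oo)%E.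
  apply: le_lt_trans fX; apply: le_iterC => //; [exact: ccont_lscT|].
  by move=> z; rewrite lee_fin ge_max -normrN ler_norm normr_ge0.
(* The vanishing of the signed integral of [X] is restated as equality of two finite nonnegative
   integrals. *)
have XE : fine (intCn (fun z => (Xp z)%:E)) = fine (intCn (fun z => (Xm z)%:E)).
  have := X0; rewrite /RintCn RiterC_posneg// => /eqP; rewrite subr_eq0 => /eqP.
  exact.
have VE : intCn (fun z => (V z)%:E) = ((cabs C `^ p)%:E * Nint p a h)%E.
  rewrite /Nint -/b /intCn -iterCZ.
  - congr iterC; apply/funext => z; rewrite -EFinM; congr EFin.
    by rewrite /V cabsM powRM ?cabs_ge0// -mulrA.
  - exact: powR_ge0.
  - by apply: ccont_lscT; apply: ccont_Nint_integrand => //; exact: ccontC_monom.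
  - by move=> z; apply: Nint_integrand_ge0; exact: ltW.
have fh : (Nint p a h < +oo)%E by exact: Nint_monom_lty.
have hN0 : (0 <= Nint p a h)%E.
  by apply: iterC_ge0 => z; apply: Nint_integrand_ge0; exact: ltW.
have hfin : Nint p a h \is a fin_num by rewrite ge0_fin_numE.
(* [D = U - V - X] is rearranged as [D + V + Xp = U + Xm], so that only nonnegative functions are
   integrated and additivity applies. *)
have E : (intCn (fun z => (D z)%:E) + (intCn (fun z => (V z)%:E) + intCn (fun z => (Xp z)%:E)) =
    Nint p a f + intCn (fun z => (Xm z)%:E))%E.
  rewrite /Nint -/b /intCn -!iterCD//; try (by apply: ccont_lscT); try (by move=> z; rewrite lee_fin).
  - congr iterC; apply/funext => z; rewrite -!EFinD; congr EFin.
    rewrite DE /Xp /Xm -/(U z).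
    by case: (leP (X z) 0); case: (leP (- X z) 0); lra.
  - apply: (ccont_lscT (K := fun z => V z + Xp z)); exact: ccontD.
  - by move=> z; rewrite lee_fin addr_ge0.
pose dd := intCn (fun z => (D z)%:E).
have dd0 : (0 <= dd)%E by apply: iterC_ge0 => z; rewrite lee_fin.
have fin0 (x : \bar R) : (0 <= x)%E -> (x < +oo)%E -> x = (fine x)%:E.
  by move=> x0 xy; rewrite fineK// ge0_fin_numE.
have nonneg (K : T -> R) : (forall z, 0 <= K z) -> (0 <= intCn (fun z => (K z)%:E))%E.
  by move=> K0; apply: iterC_ge0 => z; rewrite lee_fin.
have Vlt : (intCn (fun z => (V z)%:E) < +oo)%E.
  by rewrite VE; apply: lte_mul_pinfty; rewrite ?lee_fin ?powR_ge0.
have ddlt : (dd < +oo)%E.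
  apply: (@le_lt_trans _ _ (Nint p a f + intCn (fun z => (Xm z)%:E))%E); last exact: lte_add_pinfty.
  by rewrite -E leeDl// adde_ge0// nonneg.
have f0 : (0 <= Nint p a f)%E.
  by apply: iterC_ge0 => z; apply: Nint_integrand_ge0; exact: ltW.
have Er : fine dd + (cabs C `^ p * fine (Nint p a h) + fine (intCn (fun z => (Xp z)%:E))) =
    fine (Nint p a f) + fine (intCn (fun z => (Xm z)%:E)).
  have := E; rewrite VE -/dd (fin0 dd)// {1}(fin0 (Nint p a h))// (fin0 (Nint p a f))//.
  by rewrite (fin0 _ (nonneg _ Xp0))// (fin0 _ (nonneg _ Xm0))// -EFinM -!EFinD => -[].
exists (fine dd); first by split; [exact: fine_ge0|lra].
split.
(* One point where [f] differs from [C h] is enough: the continuous nonnegative [D] is positive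
   there, hence so is its integral. *)
- move=> dd_eq0 z; apply: contrapT => /eqP fz.
  have Dz : 0 < D z.
    rewrite lt_def D0 andbT mulf_neq0 ?(gt_eqF (gd0 z))//.
    have [_ b2] := bregman_ge0 (f z) (C * h z) p1.
    by apply/eqP => /b2 /eqP; rewrite (negbTE fz).
  have : (0 < dd)%E.
    apply: (@iterC_gt0 _ _ _ _ _ z) => //; first exact: ccont_lscT.
    by move=> i; rewrite leqNgt ltn_ord.
  by rewrite (fin0 dd)// dd_eq0 ltxx.
- move=> fE.
  have NE : Nint p a f = intCn (fun z => (V z)%:E).
    by rewrite /Nint /intCn; congr iterC; apply/funext => z; rewrite /V fE.
  have : fine (Nint p a f) = cabs C `^ p * fine (Nint p a h).
    by rewrite NE VE fineM//=.
  lra.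
Qed.

End Extremal.

(** * From the norm inequality to the ratios *)

Lemma ratio_le (R : realType) (J c x y : R) : 0 < J -> 0 < x -> 0 < y -> c * y <= x ->
  J * c / x <= J / y /\ (J * c / x = J / y <-> c * y = x).
Proof.
move=> J0 x0 y0 cyx.
(* The difference of the ratios is a positive multiple of [x - c * y], which settles the inequality
   and the equality case together. *)
have E : J / y - J * c / x = J / (x * y) * (x - c * y) by field; rewrite !gt_eqF.
have P : 0 < J / (x * y) by rewrite divr_gt0// mulr_gt0.
split; first by rewrite -subr_ge0 E mulr_ge0 ?subr_ge0// ltW.
split=> [/esym/eqP|cE].
  by rewrite -subr_eq0 E mulf_eq0 (gt_eqF P) /= subr_eq0 => /eqP.
by apply/esym/eqP; rewrite -subr_eq0 E cE subrr mulr0.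
Qed.

Theorem theorem4p4 (R : realType) (n : nat) (a p p' : R)
  (ha : 0 < a) (hp : 1 < p) (hp' : p^-1 + p'^-1 = 1)
  (f : ('I_n -> R[i]) -> R[i]) (hf : inH p a f) (hf0 : f <> (fun _ => 0))
  (j : 'I_n -> nat) :
  [/\ cabs (innerH a f (monom j)) / normH p a f
        <= cabs (innerH a (monom j) (monom j)) / normH p a (monom j),
      Rpa p p' a f (monom j) <= Rpa p p' a (monom j) (monom j),
      (cabs (innerH a f (monom j)) / normH p a f
        = cabs (innerH a (monom j) (monom j)) / normH p a (monom j)
        <-> exists c : R[i], forall z, f z = c * monom j z)
    & (Rpa p p' a f (monom j) = Rpa p p' a (monom j) (monom j)
        <-> exists c : R[i], forall z, f z = c * monom j z)].
Proof.
set h : ('I_n -> R[i]) -> R[i] := monom j.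
have p0 : 0 < p by exact: lt_trans ltr01 hp.
have q0 : 0 < p' by exact: conjugate_gt0 hp hp'.
have [/holomorphic_holo hol ff] := hf.
have [cf _] := hol.
pose C := tcoefC j f; pose J := inner_mass j a.
have J0 : 0 < J by exact: inner_mass_gt0.
have cabsJ (w : R[i]) : cabs (J%:C%C * w) = J * cabs w.
  rewrite cabsM; congr (_ * _).
  by rewrite /cabs /= expr0n addr0 sqrtr_sqr gtr0_norm.
have iF : cabs (innerH a f h) = J * cabs C.
  by rewrite (innerH_monom j ha hp hp' hol ff) cabsJ.
have fh q : 0 < q -> (Nint q a h < +oo)%E by move=> ?; exact: Nint_monom_lty.
have iH : cabs (innerH a h h) = J.
  rewrite (innerH_monom j ha hp hp' (@holo_monom _ _ j) (fh p p0)) cabsJ.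
  have -> : tcoefC j h = 1; last by rewrite cabs1 mulr1.
  rewrite -[RHS](tcoef_monom j); congr tcoefC.
  by apply/funext => z; rewrite mul1r.
have Nh0 q : 0 < q -> 0 < fine (Nint q a h).
  move=> qp; apply: fine_gt0; rewrite fh// andbT.
  apply: (@Nint_gt0 _ _ _ ha _ _ (fun=> 1)) => //; first exact: ccontC_monom.
  by rewrite -cabs_gt0 torus_cabs_monom// => i; exact: cabs1.
have Nf0 : 0 < fine (Nint p a f).
  apply: fine_gt0; rewrite ff andbT.
  have [z fz] : exists z, f z != 0.
    apply: contrapT => nz; apply: hf0; apply/funext => z.
    by apply: contrapT => /eqP fz; apply: nz; exists z.
  exact: (Nint_gt0 ha p0 cf fz).
set nf := normH p a f; set nh := normH p a h.
have nf0 : 0 < nf by exact: powR_gt0.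
have nh0 : 0 < nh by apply: powR_gt0; exact: Nh0.
have [d [d0 dE] deq] := Nint_defect j ha hp hol ff.
have nfE : nf = (d + cabs C `^ p * fine (Nint p a h)) `^ p^-1 by rewrite /nf /normH dE.
(* Both [|C| ||h||] and [||f||] become [p]-th roots whose arguments differ by [d]: the inequality
   expresses [d >= 0], and equality [d = 0]. *)
have cnE : cabs C * nh = (cabs C `^ p * fine (Nint p a h)) `^ p^-1.
  rewrite powRM ?powR_ge0 ?(ltW (Nh0 _ p0))// -powRrM divff ?gt_eqF//.
  by rewrite powRr1// cabs_ge0.
have X0 : 0 <= cabs C `^ p * fine (Nint p a h).
  by rewrite mulr_ge0 ?powR_ge0// ltW// Nh0.
have pV : 0 < p^-1 by rewrite invr_gt0.
have le_main : cabs C * nh <= nf.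
  by rewrite nfE cnE ge0_ler_powR ?nnegrE ?(ltW pV) ?addr_ge0//; lra.
have eq_main : cabs C * nh = nf <-> exists c : R[i], forall z, f z = c * h z.
  split => [E|[c fc]].
    exists C; apply/deq; move: E; rewrite nfE cnE => /(powR_injective pV).
    by rewrite !nnegrE addr_ge0// => /(_ X0 isT); lra.
  (* A multiple [c h] has torus coefficient [c], so an arbitrary constant must coincide with [C]. *)
  have Cc : C = c.
    rewrite /C -[RHS](tcoef_monom j); congr tcoefC.
    by apply/funext => z; exact: fc.
  have d_eq0 : d = 0 by apply/deq => z; rewrite -/C Cc.
  by rewrite nfE cnE d_eq0 add0r.
have [le1 eq1] := ratio_le J0 nf0 nh0 le_main.
rewrite eq_main in eq1.
pose M := normH p' a h.
have M0 : 0 < M by apply: powR_gt0; exact: Nh0.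
(* The second pair of ratios is the first one divided by the positive number [||h||_p']. *)
have RpaE (g : ('I_n -> R[i]) -> R[i]) :
    Rpa p p' a g h = cabs (innerH a g h) / normH p a g / M.
  by rewrite /Rpa invfM mulrA.
rewrite (RpaE f) (RpaE h) iF iH.
have MV0 : 0 < M^-1 by rewrite invr_gt0.
split; [exact: le1|exact: (ler_wpM2r (ltW MV0) le1)|exact: eq1|].
rewrite -eq1; split=> [H|->//].
exact: (mulIf (lt0r_neq0 MV0) H).
Qed.
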